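(* Let $a$ be a positive integer with $a\equiv 3\pmod 6$ and $a<100$. Let $m$ be a nonnegative integer such that $m$ is odd if $a\equiv 3\pmod{12}$ and $m$ is even if $a\equiv 9\pmod{12}$. Then there exists a $\mathrm{TOC}_3(3^m a,5,3)$ if $a\notin\{57,87,93\}$, and there exists a $\mathrm{TOC}_3(3^m a+1,5,3)$ if $a\notin\{51,69,75\}$.
   Context: $\mathcal{H}_q(n,w)$ is the set of all words of length $n$ over $\mathbb{Z}_q$ with exactly $w$ nonzero entries, with the Hamming distance. An $(n,d,w)_q$-code is a nonempty subset of $\mathcal{H}_q(n,w)$ in which any two distinct words have Hamming distance at least $d$; $A_q(n,d,w)$ is the maximum size of such a code and a code of this size is optimal. A $\mathrm{TOC}_q(n,d,w)$ is a partition of $\mathcal{H}_q(n,w)$ into mutually disjoint optimal $(n,d,w)_q$-codes. *)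

(* Defs.v *)
From mathcomp Require Import all_boot all_order.
Set Implicit Arguments. Unset Strict Implicit. Unset Printing Implicit Defensive.

(* Words of length n over Z_q, represented with alphabet 'I_q = {0,..,q-1};
   the zero symbol is the element with value 0. *)
Definition word (q n : nat) := {ffun 'I_n -> 'I_q}.

Definition hdist (q n : nat) (x y : word q n) : nat := #|[set i | x i != y i]|.

Definition hweight (q n : nat) (x : word q n) : nat :=
  #|[set i | nat_of_ord (x i) != 0]|.

Definition Hq (q n w : nat) : {set word q n} := [set x | hweight x == w].

Definition is_code (q n d w : nat) (C : {set word q n}) : bool :=
  [&& C \subset Hq q n w, C != set0 &
      [forall x in C, forall y in C, (x != y) ==> (d <= hdist x y)]].

Definition Aq (q n d w : nat) : nat :=
  \max_(C : {set word q n} | is_code d w C) #|C|.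

Definition optimal_code (q n d w : nat) (C : {set word q n}) : bool :=
  is_code d w C && (#|C| == Aq q n d w).

Definition TOC (q n d w : nat) : Prop :=
  exists P : {set {set word q n}},
    partition P (Hq q n w) /\ (forall C, C \in P -> optimal_code d w C).

(* Main.v *)
Require Import Defs.
From mathcomp Require Import all_boot all_order all_algebra.
From mathcomp Require Import zify ring.
Set Implicit Arguments. Unset Strict Implicit. Unset Printing Implicit Defensive.
Import GRing.Theory.

(** Two words of weight 3 over Z_3 are at distance at least 5 iff their supports share at most
    one point and they have different symbols there.  Hence a code has at most 2n/3 words, and
    the supports of a code form a linear 3-uniform hypergraph of maximum degree 2; call such a
    hypergraph good.  Conversely every good hypergraph H supports 8 disjoint codes which use all
    sign patterns on its edges: give each point a vector of F_2^3 such that the three vectors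
    on every edge are independent (greedily possible, since each point has degree at most 2) and
    let l in F_2^3 choose the signs through the linear form <l, _>, the two edges at a point
    getting opposite signs.  So it is enough to cover all triples by good hypergraphs, as many as
    the count allows.

    Such covers are tripled.  On Z_3 x Z_n the translation orbits of the triples of the types
    {(j,x),(j,y),(i,z)} and {(k,x),(k,y),(i,z)} combine to good hypergraphs, and so do two orbits
    of transversal triples; the triples inside a level are covered recursively.  With an extra
    point at infinity each of 9 blocks replaces a third of a level, and in an orbit of transversal
    triples one edge is cut at infinity.  The initial covers are cyclic, from a computer search. *)

(** * Good hypergraphs *)

(** The counts have no slack: the number of hypergraphs allowed is so small that every code must
    reach the bound 2n/3, rounded down, and this is what proves the codes optimal. As codes come in
    groups of 8, order n = 3^m a requires (n-1)(n-2)/4 to be an integer here; for n = 3 mod 6 this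
    means n = 9 mod 12, which is what the conditions on m say. Tripling exchanges the residues 3 and
    9 mod 12, so covers of residue 3 are carried along with a surplus matching, which the next
    tripling absorbs. For order 3^m a + 1 the recursion occupies one level and infinity, and the
    other two levels must be filled separately. Cutting levels into thirds solves this: the six
    remaining blocks split into two block triples. With u points in a block, u odd, both u^2 and u
    orbits leave one unpaired. Packing these leftovers is a problem on 9 blocks that does not depend
    on u, so one explicit table settles it. The pairing of orbits uses 3 != 0 modulo u, so u = 3 is
    excluded; hence an initial cover for 27 besides the one for 9. *)

Lemma card_le2_eq (U : finType) (E : {set U}) : #|E| <= 2 -> 0 < #|U| ->
  exists e1 e2, forall t, t \in E -> t = e1 \/ t = e2.
Proof.
move=> E2 /card_gt0P[u _].
case: (set_0Vmem E) => [->|[e1 e1E]]; first by exists u, u => t; rewrite inE.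
case: (set_0Vmem (E :\ e1)) => [E0|[e2 e2E]].
  exists e1, e1 => t tE; left; apply/eqP; rewrite -[_ == _]negbK; apply/negP=> te.
  by have := in_set0 t; rewrite -E0 !inE te tE.
exists e1, e2 => t tE; case: (eqVneq t e1) => [->|te1]; first by left.
right; have /card_le1P h : #|E :\ e1| <= 1 by have := cardsD1 e1 E; rewrite e1E; lia.
by have := h _ e2E t; rewrite !inE te1 tE /= => /esym/eqP.
Qed.

Section Hypergraphs.
Variable T : finType.
Implicit Types (A B H : {set {set T}}) (t : {set T}) (x y z : T).

Definition tri x y z : {set T} := [set x; y; z].

Definition degr H x := #|[set t in H | x \in t]|.

Definition linear_hg H := forall t t' x y, t \in H -> t' \in H -> x != y ->
  x \in t -> y \in t -> x \in t' -> y \in t' -> t = t'.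

Definition good H := (forall x, degr H x <= 2) /\ linear_hg H.

Definition matching H :=
  forall t t' x, t \in H -> t' \in H -> x \in t -> x \in t' -> t = t'.

(** Edges need not have three points here; [TOC_of_cover] discards the others. *)
Definition triple_cover N := exists Hs : seq {set {set T}},
  [/\ size Hs <= N, {in Hs, forall H, good H} &
      forall t, #|t| = 3 -> exists2 H, H \in Hs & t \in H].

Lemma in_tri x y z w : (w \in tri x y z) = [|| w == x, w == y | w == z].
Proof. by rewrite !inE orbA. Qed.

Lemma card_tri x y z : x != y -> x != z -> y != z -> #|tri x y z| = 3.
Proof.
move=> xy xz yz; rewrite /tri -setUA cardsU1 cards2 yz !inE.
by rewrite (negPf xy) (negPf xz).
Qed.

Lemma card3_tri t : #|t| = 3 ->
  exists x y z, [/\ t = tri x y z, x != y, x != z & y != z].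
Proof.
move=> t3.
have /card_gt0P[x xt] : 0 < #|t| by rewrite t3.
have c2 : #|t :\ x| = 2 by have := cardsD1 x t; rewrite t3 xt; lia.
have /card_gt0P[y] : 0 < #|t :\ x| by rewrite c2.
rewrite !inE => /andP[yx yt].
have c1 : #|t :\ x :\ y| = 1 by have := cardsD1 y (t :\ x); rewrite c2 !inE yx yt; lia.
have /eqP/cards1P[z ez] := c1.
have : z \in t :\ x :\ y by rewrite ez inE.
rewrite !inE => /and3P[zy zx zt].
exists x, y, z; split; rewrite 1?eq_sym //.
have c3 : #|tri x y z| = 3 by apply: card_tri; rewrite eq_sym.
apply/eqP; rewrite eq_sym eqEcard t3 c3 andbT.
by apply/subsetP=> w; rewrite in_tri => /or3P[] /eqP->.
Qed.

Lemma tri_rot x y z : tri x y z = tri y z x.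
Proof. by apply/setP=> w; rewrite !in_tri orbC -orbA. Qed.

Lemma tri_swap x y z : tri x y z = tri x z y.
Proof. by apply/setP=> w; rewrite !in_tri [(w == y) || _]orbC. Qed.

Lemma tri_eq2 x y z y' z' : x != y -> x != z -> tri x y z = tri x y' z' ->
  y != z -> (y = y' /\ z = z') \/ (y = z' /\ z = y').
Proof.
move=> xy xz e yz.
have : y \in tri x y' z' by rewrite -e in_tri eqxx orbT.
have : z \in tri x y' z' by rewrite -e in_tri eqxx !orbT.
rewrite !in_tri (eq_sym z x) (eq_sym y x) (negPf xz) (negPf xy) /=.
case/orP=> /eqP ez; case/orP=> /eqP ey; try by [left|right].
  by rewrite ez ey eqxx in yz.
by rewrite ez ey eqxx in yz.
Qed.

Lemma degr_sub A B x : A \subset B -> degr A x <= degr B x.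
Proof.
move=> /subsetP AB; apply/subset_leq_card/subsetP=> t; rewrite !inE.
by case/andP=> /AB-> ->.
Qed.

Lemma degrU A B x : degr (A :|: B) x <= degr A x + degr B x.
Proof.
rewrite /degr; apply: leq_trans (leq_card_setU _ _); apply/subset_leq_card/subsetP=> t.
by rewrite !inE; case/andP=> /orP[]-> ->; rewrite ?orbT.
Qed.

Lemma degr0P A x : reflect (forall t, t \in A -> x \notin t) (degr A x == 0).
Proof.
rewrite cards_eq0; apply: (iffP eqP) => [e t tA|h].
  by apply/negP=> xt; have := in_set0 t; rewrite -e inE tA xt.
by apply/setP=> t; rewrite !inE; apply/negP=> /andP[/h /negP].
Qed.

Lemma matching_degr A x : matching A -> degr A x <= 1.
Proof.
move=> mA; apply/card_le1P=> t; rewrite inE => /andP[tA xt] t'; rewrite !inE.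
apply/andP/eqP=> [[t'A xt']|->//]; exact: mA xt' xt.
Qed.

Lemma matching_linear A : matching A -> linear_hg A.
Proof. by move=> mA t t' x y tA t'A _ xt _ xt' _; apply: mA xt xt'. Qed.

Lemma good0 : good set0.
Proof.
split=> [x|t t' x y]; last by rewrite inE.
by rewrite (_ : degr _ x = 0) //; apply/eqP/degr0P=> t; rewrite inE.
Qed.

Lemma good_sub A B : A \subset B -> good B -> good A.
Proof.
move=> AB [dB lB]; split=> [x|t t' x y tA t'A].
  exact: leq_trans (degr_sub x AB) (dB x).
by apply: lB; apply: (subsetP AB).
Qed.

Lemma linearU A B : linear_hg A -> linear_hg B ->
  (forall t t' x y, t \in A -> t' \in B -> x != y ->
     x \in t -> y \in t -> x \in t' -> y \in t' -> t = t') ->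
  linear_hg (A :|: B).
Proof.
move=> lA lB lAB t t' x y; rewrite !inE; case/orP=> tA; case/orP=> t'A nxy *.
- exact: lA nxy _ _ _ _.
- exact: lAB nxy _ _ _ _.
- by apply/esym/(lAB _ _ x y).
- exact: lB nxy _ _ _ _.
Qed.

Lemma good_disjU A B : good A -> good B ->
  (forall t t' x, t \in A -> t' \in B -> x \in t -> x \in t' -> False) -> good (A :|: B).
Proof.
move=> [dA lA] [dB lB] dis; split; last first.
  by apply: linearU => // t t' x y tA t'B _ xt _ xt' _; case: (dis t t' x).
move=> x; apply: leq_trans (degrU _ _ _) _.
case: (eqVneq (degr A x) 0) => [->|/degr0P nA]; first exact: dB.
suff -> : degr B x = 0 by rewrite addn0.
apply/eqP/degr0P=> t' t'B; apply/negP=> xt'; case: nA => t tA; apply/negP=> xt.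
exact: dis xt xt'.
Qed.

Lemma cover_of_fam (J : finType) (H : J -> {set {set T}}) N : #|J| <= N ->
  (forall j, good (H j)) -> (forall t, #|t| = 3 -> exists j, t \in H j) -> triple_cover N.
Proof.
move=> JN gH cH; exists [seq H j | j <- enum J]; split.
- by rewrite size_map -cardE.
- by move=> A /mapP[j _ ->].
- move=> t /cH[j tj]; exists (H j) => //; apply/mapP; exists j => //; exact: mem_enum.
Qed.

Lemma fam_of_cover (J : finType) N : triple_cover N -> #|J| = N ->
  exists H : J -> {set {set T}},
    (forall j, good (H j)) /\ (forall t, #|t| = 3 -> exists j, t \in H j).
Proof.
(* The list may be shorter than [J]; the remaining indices get the empty hypergraph, which is
   good. *)
move=> [Hs [sN gH cH]] JN; exists (fun j => nth set0 Hs (enum_rank j)); split.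
  move=> j; case: (ltnP (enum_rank j) (size Hs)) => hj; first by apply: gH; rewrite mem_nth.
  by rewrite nth_default //; exact: good0.
move=> t /cH[A AHs tA].
have iJ : index A Hs < #|J| by rewrite JN; apply: leq_trans sN; rewrite index_mem.
by exists (enum_val (Ordinal iJ)); rewrite enum_valK /= nth_index.
Qed.
End Hypergraphs.

(** With [g] a level number, sorting leaves only the patterns of equal and different levels to
    distinguish; ties are allowed. *)
Lemma card3_sorted (T : finType) (g : T -> nat) (t : {set T}) : #|t| = 3 ->
  exists x y z, [/\ t = tri x y z, x != y, x != z, y != z & g x <= g y <= g z].
Proof.
move=> t3; have [x [y [z [tE xy xz yz]]]] := card3_tri t3.
have [h|[h|[h|[h|[h|h]]]]] : g x <= g y <= g z \/ g x <= g z <= g y \/ g y <= g x <= g z \/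
    g y <= g z <= g x \/ g z <= g x <= g y \/ g z <= g y <= g x by lia.
- by exists x, y, z.
- by exists x, z, y; split=> //; [rewrite tE tri_swap | rewrite eq_sym].
- by exists y, x, z; split=> //; [rewrite tE tri_rot tri_swap | rewrite eq_sym].
- by exists y, z, x; split=> //; [rewrite tE tri_rot | rewrite eq_sym..].
- by exists z, x, y; split=> //; [rewrite tE -tri_rot | rewrite eq_sym..].
- by exists z, y, x; split=> //; [rewrite tE -tri_rot tri_swap | rewrite eq_sym..].
Qed.

(** * Images of hypergraphs under injections *)

Section Images.
Variables (T U : finType) (f : T -> U).
Hypothesis f_inj : injective f.

Definition himg (H : {set {set T}}) : {set {set U}} := [set f @: (t : {set T}) | t in H].

Lemma himg_tri x y z : f @: tri x y z = tri (f x) (f y) (f z).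
Proof. by rewrite /tri !imsetU !imset_set1. Qed.

Lemma mem_himg (H : {set {set T}}) (t : {set T}) : (f @: t \in himg H) = (t \in H).
Proof. by rewrite mem_imset //; exact: imset_inj. Qed.

Lemma himgP H u x : u \in himg H -> x \in u ->
  exists t y, [/\ t \in H, u = f @: t, x = f y & y \in t].
Proof. by case/imsetP=> t tH -> /imsetP[y yt ->]; exists t, y. Qed.

Lemma degr_himg H y : degr (himg H) (f y) = degr H y.
Proof.
rewrite /degr -(card_imset _ (imset_inj f_inj)); apply: eq_card => u; rewrite !inE.
apply/andP/imsetP=> [[/imsetP[t tH ->]]|[t]].
  by rewrite mem_imset // => yt; exists t; rewrite // inE tH.
by rewrite inE => /andP[tH yt] ->; rewrite mem_himg mem_imset.
Qed.

Lemma degr_himg0 H x : (forall y, x != f y) -> degr (himg H) x = 0.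
Proof.
move=> nx; apply/eqP/degr0P=> u uH; apply/negP=> /(himgP uH)[t [y [_ _ e _]]].
by have := nx y; rewrite e eqxx.
Qed.

Lemma degr_himg_le H d x : (forall y, degr H y <= d) -> degr (himg H) x <= d.
Proof.
move=> hd; case: (boolP [exists y, x == f y]) => [/existsP[y /eqP->]|/existsPn h].
  by rewrite degr_himg.
by rewrite degr_himg0.
Qed.

Lemma linear_himg H : linear_hg H -> linear_hg (himg H).
Proof.
move=> lH u u' x y uH u'H nxy xu yu xu' yu'.
have [t [x1 [tH eu ex x1t]]] := himgP uH xu.
have [t' [x2 [t'H eu' ex' x2t]]] := himgP u'H xu'.
move: yu yu'; rewrite eu eu' => /imsetP[y1 y1t ey1] /imsetP[y2 y2t ey2].
have e1 : x1 = x2 by apply: f_inj; rewrite -ex -ex'.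
have e2 : y1 = y2 by apply: f_inj; rewrite -ey1 -ey2.
suff -> : t = t' by [].
apply: (lH _ _ x1 y1) => //; rewrite ?e1 ?e2 //.
by apply: contraNneq nxy => e; rewrite ex' ey2 e.
Qed.

Lemma matching_himg H : matching H -> matching (himg H).
Proof.
move=> mH u u' x uH u'H xu xu'.
have [t [y [tH eu ex yt]]] := himgP uH xu; have [t' [y' [t'H eu' ex' yt']]] := himgP u'H xu'.
rewrite eu eu'; suff -> : t = t' by []; apply: (mH t t' y) => //.
by rewrite (_ : y = y') //; apply: f_inj; rewrite -ex -ex'.
Qed.

Lemma good_himg H : good H -> good (himg H).
Proof.
by move=> [dH lH]; split; [move=> x; apply: degr_himg_le | exact: linear_himg].
Qed.

Lemma preim_triple (u : {set U}) : (forall x, x \in u -> exists y, x = f y) -> #|u| = 3 ->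
  exists2 t : {set T}, u = f @: t & #|t| = 3.
Proof.
move=> hu u3; exists (f @^-1: u).
  apply/setP=> x; apply/idP/imsetP=> [xu|[y]]; last by rewrite inE => yu ->.
  by have [y e] := hu x xu; exists y; rewrite // inE -e.
rewrite -u3 -(card_imset _ f_inj); apply: eq_card => x.
apply/imsetP/idP=> [[y]|xu]; first by rewrite inE => yu ->.
by have [y e] := hu x xu; exists y; rewrite // inE -e.
Qed.
End Images.

Lemma card_eq_bij (T U : finType) : #|T| = #|U| ->
  exists2 f : T -> U, injective f & forall y, exists x, y = f x.
Proof.
move=> e; exists (fun x => enum_val (cast_ord e (enum_rank x))).
  by move=> x y /enum_val_inj/cast_ord_inj/enum_rank_inj.
move=> y; exists (enum_val (cast_ord (esym e) (enum_rank y))).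
by rewrite enum_valK cast_ordKV enum_rankK.
Qed.

Lemma cover_transport (T U : finType) N : #|T| = #|U| -> triple_cover T N -> triple_cover U N.
Proof.
move=> /card_eq_bij[f fi fs] [Hs [sN gH cH]]; exists (map (himg f) Hs); split.
- by rewrite size_map.
- by move=> A /mapP[B /gH gB ->]; apply: good_himg.
move=> u u3; have [t -> /cH[H HHs tH]] := @preim_triple _ _ f fi u (fun x _ => fs x) u3.
by exists (himg f H); [apply: map_f | rewrite mem_himg].
Qed.

(** * From covers to tilings *)

Definition vec := (bool * bool * bool)%type.
Definition vadd (a b : vec) : vec := (a.1.1 (+) b.1.1, a.1.2 (+) b.1.2, a.2 (+) b.2).
Definition vdot (a b : vec) := a.1.1 && b.1.1 (+) (a.1.2 && b.1.2 (+) a.2 && b.2).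
Definition v0 : vec := (false, false, false).

(** Over F_2, distinct nonzero vectors [a], [b], [c] are dependent only if their sum is zero, so
    these seven conditions are linear independence. *)
Definition indep (a b c : vec) :=
  [&& a != v0, b != v0, c != v0, a != b, a != c, b != c & c != vadd a b].

Lemma indep_solve a b c (s1 s2 s3 : bool) : indep a b c ->
  exists l, [/\ vdot l a = s1, vdot l b = s2 & vdot l c = s3].
Proof.
move=> h.
have : has (fun l => [&& vdot l a == s1, vdot l b == s2 & vdot l c == s3])
  [:: (false,false,false); (false,false,true); (false,true,false); (false,true,true);
      (true,false,false); (true,false,true); (true,true,false); (true,true,true)].
  by case: a b c h s1 s2 s3 => [[[] []] []] [[[] []] []] [[[] []] []] // _ [] [] [].
by case/hasP=> l _ /and3P[/eqP ? /eqP ? /eqP ?]; exists l.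
Qed.

Lemma vec_avoid (s : seq vec) : size s < 8 -> exists v, v \notin s.
Proof.
move=> s8; case: (boolP [exists v, v \notin s]) => [/existsP//|/existsPn h].
have : #|{: vec}| <= size s.
  apply: leq_trans (card_size s); apply/subset_leq_card/subsetP=> v _.
  by have := h v; rewrite negbK.
by rewrite !card_prod card_bool; lia.
Qed.

Section Signing.
Variables (T : finType) (H : {set {set T}}).
Hypothesis dH : forall x, degr H x <= 2.

(** Describing the edges at [a] by their other two points turns them into a finite list of vectors
    that a new value at [a] must avoid. *)
Lemma two_edges a : exists y1 z1 y2 z2, forall y z, a != y -> a != z -> y != z ->
  tri a y z \in H ->
  [\/ y = y1 /\ z = z1, y = z1 /\ z = y1, y = y2 /\ z = z2 | y = z2 /\ z = y2].
Proof.
have [e1 [e2 he]] : exists e1 e2, forall t, t \in [set t in H | a \in t] -> t = e1 \/ t = e2.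
  by apply: card_le2_eq (dH a) _; apply/card_gt0P; exists set0.
have key e : exists y1 z1, forall y z, a != y -> a != z -> y != z -> tri a y z = e ->
    (y = y1 /\ z = z1) \/ (y = z1 /\ z = y1).
  case: (boolP [exists y, [exists z, tri a y z == e]]) => [/existsP[y1 /existsP[z1 /eqP e1z]]|n].
    by exists y1, z1 => y z ay az yz; rewrite -e1z => /tri_eq2; apply.
  by exists a, a => y z _ _ _ e'; case/existsP: n; exists y; apply/existsP; exists z; rewrite e'.
have [y1 [z1 k1]] := key e1; have [y2 [z2 k2]] := key e2.
exists y1, z1, y2, z2 => y z ay az yz tH.
have /he[e|e] : tri a y z \in [set t in H | a \in t] by rewrite inE tH in_tri eqxx.
  by case: (k1 y z ay az yz e); [constructor 1 | constructor 2].
by case: (k2 y z ay az yz e); [constructor 3 | constructor 4].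
Qed.

(* Greedy: a point lies on at most two edges, each forbidding at most three nonzero
   vectors, so one of the seven nonzero vectors of F_2^3 is always free. *)
Lemma signing : exists f : T -> vec, forall x y z, x != y -> x != z -> y != z ->
  tri x y z \in H -> indep (f x) (f y) (f z).
Proof.
(* The induction runs over a list of treated points and constrains [f] only on these. The three
   conditions are a part of independence; applying them to the rotations of x, y, z gives the
   rest. *)
suff [f hf] : exists f : T -> vec, forall x y z, x != y -> x != z -> y != z ->
    tri x y z \in H ->
    [/\ x \in enum T -> f x != v0, x \in enum T -> y \in enum T -> f x != f y &
        x \in enum T -> y \in enum T -> z \in enum T -> f z != vadd (f x) (f y)].
  exists f => x y z xy xz yz tH; have mE w : w \in enum T by exact: mem_enum.
  have [h1 h2 h3] := hf x y z xy xz yz tH.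
  have [yx zx zy] : [/\ y != x, z != x & z != y] by split; rewrite eq_sym.
  have tH1 : tri y z x \in H by rewrite -tri_rot.
  have tH2 : tri z x y \in H by rewrite tri_rot.
  have [k1 k2 _] := hf y z x yz yx zx tH1; have [g1 g2 _] := hf z x y zx zy xy tH2.
  rewrite /indep (h1 (mE x)) (k1 (mE y)) (g1 (mE z)) (h2 (mE x) (mE y)).
  rewrite (eq_sym (f x) (f z)) (g2 (mE z) (mE x)) (k2 (mE y) (mE z)).
  exact: h3 (mE x) (mE y) (mE z).
elim: (enum T) => [|a s [f hf]]; first by exists (fun=> v0).
have [y1 [z1 [y2 [z2 he]]]] := two_edges a.
have [v] := @vec_avoid [:: v0; f y1; f z1; vadd (f y1) (f z1);
  f y2; f z2; vadd (f y2) (f z2)] isT.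
rewrite !inE !negb_or => /and5P[v0' vy1 vz1 v1 /and3P[vy2 vz2 v2]].
have vaddC p q : vadd p q = vadd q p by rewrite /vadd !(addbC q.1.1, addbC q.1.2, addbC q.2).
have hv y z : a != y -> a != z -> y != z -> tri a y z \in H ->
    [/\ v != f y, v != f z & v != vadd (f y) (f z)].
  by move=> ay az yz /(he y z ay az yz)[] [-> ->]; split; rewrite // vaddC.
have vaddE p q r : (p == vadd q r) = (q == vadd p r).
  by case: p q r => [[[] []] []] [[[] []] []] [[[] []] []].
exists (fun w => if w == a then v else f w) => x y z xy xz yz tH.
have [h1 h2 h3] := hf x y z xy xz yz tH.
rewrite !inE; split.
- by case: eqP => //= _; exact: h1.
- case: (eqVneq x a) => [xa|nxa]; case: (eqVneq y a) => [ya|nya] //=.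
  + by rewrite xa ya eqxx in xy.
  + by rewrite xa in xy xz tH; have [] := hv y z xy xz yz tH.
  + move=> _ _; rewrite eq_sym; rewrite tri_rot tri_swap ya in tH.
    by rewrite ya eq_sym in xy; rewrite ya in yz; have [] := hv x z xy yz xz tH.
- case: (eqVneq x a) => [xa|nxa]; case: (eqVneq y a) => [ya|nya];
    case: (eqVneq z a) => [za|nza] //=.
  + by rewrite xa ya eqxx in xy.
  + by rewrite xa ya eqxx in xy.
  + by rewrite xa za eqxx in xz.
  + move=> _ _ _; rewrite xa in xy xz tH; rewrite vaddE vaddC.
    by have [] := hv y z xy xz yz tH.
  + by rewrite ya za eqxx in yz.
  + move=> _ _ _; rewrite tri_rot tri_swap ya in tH; rewrite vaddC vaddE vaddC.
    by rewrite ya eq_sym in xy; rewrite ya in yz; have [] := hv x z xy yz xz tH.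
  + move=> _ _ _; rewrite -tri_rot za in tH.
    by rewrite za eq_sym in xz; rewrite za eq_sym in yz; have [] := hv x y xz yz xy tH.
Qed.
End Signing.

(** * The size bound and the partition of the words *)

Section Tiling.
Variable n : nat.
Local Notation W := (word 3 n).

Definition supp (w : W) : {set 'I_n} := [set i | nat_of_ord (w i) != 0].
(** On the support the symbol is 1 or 2, so this bit determines it. *)
Definition sbit (w : W) i := nat_of_ord (w i) == 2.

Lemma in_Hq3 (w : W) : (w \in Hq 3 n 3) = (#|supp w| == 3).
Proof. by rewrite inE. Qed.

Lemma symbol_eq (w w' : W) i : i \in supp w -> i \in supp w' ->
  sbit w i = sbit w' i -> w i = w' i.
Proof.
rewrite !inE /sbit => h h' e; apply/val_inj => /=; move: h h' e.
by move: (ltn_ord (w i)) (ltn_ord (w' i)); case: (nat_of_ord (w i)) => [|[|[|?]]] //;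
   case: (nat_of_ord (w' i)) => [|[|[|?]]].
Qed.

Lemma word_eq (w w' : W) : supp w = supp w' ->
  (forall i, i \in supp w -> sbit w i = sbit w' i) -> w = w'.
Proof.
move=> e h; apply/ffunP=> i; case: (boolP (i \in supp w)) => [iw|niw].
  by apply: symbol_eq; rewrite -?e //; exact: h.
have niw' : i \notin supp w' by rewrite -e.
by move: niw niw'; rewrite !inE !negbK => /eqP a /eqP b; apply/val_inj; rewrite /= a b.
Qed.

Lemma hdist_supp (w w' : W) :
  (forall i, i \in supp w -> i \in supp w' -> sbit w i != sbit w' i) ->
  hdist w w' = #|supp w :|: supp w'|.
Proof.
move=> h; apply: eq_card => i; rewrite !inE; apply/idP/idP.
  by apply: contraNT; rewrite negb_or !negbK => /andP[/eqP a /eqP b];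
     apply/eqP/val_inj; rewrite /= a b.
case/orP=> hi; apply/negP=> /eqP e.
  by have := h i; rewrite !inE /sbit -e hi => /(_ isT isT); rewrite eqxx.
by have := h i; rewrite !inE /sbit e hi => /(_ isT isT); rewrite eqxx.
Qed.

(** A point together with a nonzero symbol occurs in at most one word: if two words agree at a
    common point of their supports, they differ only on the rest of the union, at most 4 places. So
    the 3|C| incidences inject into n points times 2 symbols. *)
Lemma code_size_le (C : {set W}) : is_code 5 3 C -> #|C| <= (2 * n) %/ 3.
Proof.
case/and3P=> /subsetP sC _ /forall_inP dC.
rewrite leq_divRL // mulnC [2 * n]mulnC.
pose D := [set p : W * 'I_n | (p.1 \in C) && (p.2 \in supp p.1)].
have cD : #|D| = #|C| * 3.
  rewrite -sum1_card (eq_bigl (fun p : W * 'I_n => (p.1 \in C) && (p.2 \in supp p.1))); last first.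
    by move=> p; rewrite inE.
  rewrite -(pair_big_dep (fun w => w \in C) (fun (w : W) i => i \in supp w) (fun _ _ => 1)) /=.
  rewrite -sum_nat_const; apply: eq_bigr => w wC; rewrite sum1_card; apply/eqP.
  by rewrite -in_Hq3 sC.
rewrite mulnC -cD; pose phi (p : W * 'I_n) := (p.2, sbit p.1 p.2).
have phi_inj : {in D &, injective phi}.
  move=> [w x] [w' x']; rewrite !inE /= => /andP[wC wx] /andP[w'C wx'] [ex eb].
  rewrite -{}ex in eb wx' *; congr (_, _); apply/eqP/negPn/negP=> nw.
  have /forall_inP/(_ w' w'C) := dC w wC; rewrite nw /= /hdist => d5.
  have eqx : w x = w' x by apply: symbol_eq; rewrite ?inE.
  have sub : [set i | w i != w' i] \subset (supp w :|: supp w') :\ x.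
    apply/subsetP=> i; rewrite !inE => ni; apply/andP; split.
      by apply: contraNneq ni => ->; rewrite eqx.
    apply: contraNT ni; rewrite negb_or !negbK => /andP[/eqP a /eqP b].
    by apply/eqP/val_inj; rewrite /= a b.
  have := subset_leq_card sub.
  have := cardsD1 x (supp w :|: supp w').
  have := cardsUI (supp w) (supp w').
  have /eqP-> : #|supp w| == 3 by rewrite -in_Hq3 sC.
  have /eqP-> : #|supp w'| == 3 by rewrite -in_Hq3 sC.
  have : 0 < #|supp w :&: supp w'| by apply/card_gt0P; exists x; rewrite !inE wx.
  rewrite !inE wx /= => h1 h2 h3 h4; have := leq_trans d5 h4; move: h1 h2 h3.
  by move: #|_ :\ x| #|_ :|: _| #|_ :&: _| => a b c; lia.
rewrite -(card_in_imset phi_inj); apply: leq_trans (max_card _) _.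
by rewrite card_prod card_ord card_bool.
Qed.

Lemma card_Hq3 : #|Hq 3 n 3| = 8 * 'C(n, 3).
Proof.
rewrite -sum1_card (partition_big supp (fun t : {set 'I_n} => #|t| == 3)); last first.
  by move=> w; rewrite in_Hq3.
have -> : 'C(n, 3) = #|[set t : {set 'I_n} | #|t| == 3]| by rewrite card_draws card_ord.
rewrite -sum1_card big_distrr /=.
apply: congr_big => // [t|t /eqP t3]; first by rewrite inE.
rewrite muln1 (eq_bigl (fun w => supp w == t)); last first.
  by move=> w; rewrite in_Hq3; case: (eqVneq (supp w) t) => [->|]; rewrite ?t3 ?andbF.
rewrite sum1dep_card.
rewrite (_ : 8 = #|[set~ (ord0 : 'I_3)]| ^ #|t|); last by rewrite t3 cardsC1 card_ord.
rewrite -(card_pffun_on (ord0 : 'I_3)); apply: eq_card => w.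
rewrite inE; apply/eqP/pffun_onP => [<-|[st ht]].
  split; first by apply/supportP=> i; rewrite inE negbK => /eqP e; apply/val_inj.
  by move=> b /imageP[i]; rewrite inE => hi ->; rewrite !inE -val_eqE.
apply/setP=> i; apply/idP/idP=> [|it].
  rewrite inE; apply: contraNT => nit.
  by move/supportP: st => /(_ i nit) ->.
by have := ht (w i); rewrite !inE -val_eqE; apply; apply: image_f.
Qed.

(** There are 8N classes with at most [m] words each, and 8 C(n,3) >= 8 N m words in all, so every
    class has exactly [m] words. This shows at once that no class is empty and that [m] is the
    maximum size of a code. *)
Lemma TOC_of_cover N : 3 <= n -> N * ((2 * n) %/ 3) <= 'C(n, 3) ->
  triple_cover 'I_n N -> TOC 3 n 5 3.
Proof.
set m := (2 * n) %/ 3 => n3 Nm cov.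
have m0 : 0 < m by rewrite /m; lia.
have [H0 [gH0 cH0]] := fam_of_cover cov (card_ord N).
pose H j := [set t in H0 j | #|t| == 3].
have H3 j t : t \in H j -> #|t| = 3 by rewrite inE => /andP[_ /eqP].
have gH j : good (H j).
  by apply: good_sub (gH0 j); apply/subsetP=> t; rewrite inE => /andP[].
have cH (t : {set 'I_n}) : #|t| = 3 -> exists j, t \in H j.
  by move=> t3; have [j tj] := cH0 t t3; exists j; rewrite inE tj t3.
have [f hf] := fin_all_exists (fun j => signing (gH j).1).
(* At most two edges of [H j] pass through [x]; [pick] selects one of them, and this bit tells the
   two apart. *)
pose o (j : 'I_N) (x : 'I_n) (t : {set 'I_n}) := t == odflt set0 [pick t' in H j | x \in t'].
have ho j x (t t' : {set 'I_n}) : t \in H j -> t' \in H j -> x \in t -> x \in t' -> t != t' ->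
    o j x t != o j x t'.
  rewrite /o => tH t'H xt xt' ntt; case: pickP => [e /andP[eH xe] /=|/(_ t)]; last by rewrite tH xt.
  case: (eqVneq t e) => [<-|nte]; first by rewrite (eq_sym t' t) (negPf ntt).
  case: (eqVneq t' e) => // nt'e; exfalso.
  have : #|tri t t' e| <= 2.
    apply: leq_trans ((gH j).1 x); apply/subset_leq_card/subsetP=> u.
    by rewrite in_tri => /or3P[] /eqP->; rewrite inE ?tH ?t'H ?eH.
  by rewrite card_tri.
(* A triple exists since [3 <= n]; its index supplies the value of [chi] on sets that are not
   triples. *)
have [t0 /eqP t03] : exists t : {set 'I_n}, #|t| == 3.
  have : 0 < #|[set t : {set 'I_n} | #|t| == 3]| by rewrite card_draws card_ord bin_gt0.
  by case/card_gt0P=> t; rewrite inE; exists t.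
(* A triple may lie in several hypergraphs; fixing one makes the classes disjoint. *)
have /fin_all_exists[chi hchi] : forall t : {set 'I_n}, exists j, #|t| = 3 -> t \in H j.
  move=> t; case: (eqVneq #|t| 3) => [/cH[j ?]|nt]; first by exists j.
  by have [j _] := cH t0 t03; exists j => e; rewrite e in nt.
(* Once the bit [o] is removed, the three symbols of a word prescribe the values of a linear form on
   three independent vectors; [lam] is the resulting form. *)
have /fin_all_exists[lam hlam] : forall w, exists l, w \in Hq 3 n 3 -> forall i, i \in supp w ->
    sbit w i = o (chi (supp w)) i (supp w) (+) vdot l (f (chi (supp w)) i).
  move=> w; case: (boolP (w \in Hq 3 n 3)) => [|_]; last by exists v0.
  rewrite in_Hq3 => /eqP s3; set j := chi _; set t := supp w.
  have [x [y [z [et xy xz yz]]]] := card3_tri s3.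
  have tH : tri x y z \in H j by rewrite -et hchi.
  have [l [lx ly lz]] := indep_solve (sbit w x (+) o j x t) (sbit w y (+) o j y t)
     (sbit w z (+) o j z t) (hf j x y z xy xz yz tH).
  exists l => _ i; rewrite {1}/t et in_tri => /or3P[] /eqP->; rewrite ?lx ?ly ?lz;
    by rewrite addbCA addbb addbF.
pose ka w := (chi (supp w), lam w).
pose cls c := [set w in Hq 3 n 3 | ka w == c].
(* In a class, the support determines the word. Different supports meet in at most one point, where
   the forms agree and [o] differs, so all points of the union, at least 5, contribute to the
   distance. *)
have code_cls c : cls c != set0 -> is_code 5 3 (cls c).
  move=> ne; apply/and3P; split => //; first by apply/subsetP=> w; rewrite inE => /andP[].
  apply/forall_inP=> w; rewrite inE => /andP[wH /eqP kw].
  apply/forall_inP=> w'; rewrite inE => /andP[w'H]; rewrite -kw xpair_eqE => /andP[/eqP ej /eqP el].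
  apply/implyP=> nw.
  have s3 : #|supp w| = 3 by apply/eqP; rewrite -in_Hq3.
  have s3' : #|supp w'| = 3 by apply/eqP; rewrite -in_Hq3.
  have tH := hchi _ s3; have t'H := hchi _ s3'; rewrite ej in t'H.
  have ns : supp w != supp w'.
    apply: contraNneq nw => es; apply/eqP/word_eq => // i iw.
    rewrite (hlam w wH i iw) (hlam w' w'H i); last by rewrite -es.
    by rewrite -es el.
  rewrite hdist_supp; last first.
    move=> i iw iw'; rewrite (hlam w) // (hlam w') // ej el.
    have := ho _ _ _ _ tH t'H iw iw' ns.
    by case: (o _ _ _); case: (o _ _ _); case: (vdot _ _).
  have : #|supp w :&: supp w'| <= 1.
    apply/card_le1P=> x; rewrite in_setI => /andP[xw xw'] y.
    rewrite in_setI [RHS]inE; apply/idP/eqP=> [/andP[yw yw']|->]; last by rewrite xw.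
    apply/eqP; rewrite eq_sym; apply: contraNT ns => nxy; apply/eqP.
    exact: (gH (chi (supp w))).2 tH t'H nxy xw yw xw' yw'.
  have := cardsUI (supp w) (supp w'); rewrite s3 s3'; lia.
have cls_le c : #|cls c| <= m ?= iff (#|cls c| == m).
  split=> //; case: (eqVneq (cls c) set0) => [->|/code_cls]; first by rewrite cards0.
  exact: code_size_le.
have sum_cls : \sum_c #|cls c| = #|Hq 3 n 3|.
  rewrite -sum1_card (partition_big ka xpredT) //; apply: eq_bigr => c _.
  by rewrite -sum1_card; apply: eq_bigl => w; rewrite inE.
have all_m c : #|cls c| = m.
  have [le eqi] := leqif_sum (fun c (_ : true) => cls_le c).
  have ge : \sum_(c : 'I_N * vec) m <= \sum_(c : 'I_N * vec) #|cls c|.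
    rewrite sum_cls card_Hq3 sum_nat_const card_prod card_ord !card_prod card_bool; nia.
  move: eqi; rewrite eqn_leq le ge => /esym/forallP/(_ c)/eqP; exact.
have isc c : is_code 5 3 (cls c) by apply: code_cls; rewrite -card_gt0 all_m.
have Am (c : 'I_N * vec) : Aq 3 n 5 3 = m.
  apply/eqP; rewrite eqn_leq; apply/andP; split.
    by apply/bigmax_leqP=> C; apply: code_size_le.
  by rewrite -(all_m c); apply: (@leq_bigmax_cond _ _ (fun C : {set W} => #|C|)) (isc c).
exists (preim_partition ka (Hq 3 n 3)); split; first exact: preim_partitionP.
move=> C /imsetP[w wH ->].
have -> : [set y in Hq 3 n 3 | ka w == ka y] = cls (ka w).
  by apply/setP=> y; rewrite !inE (eq_sym (ka w)).
by rewrite /optimal_code isc all_m (Am (ka w)) /=.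
Qed.
End Tiling.

(** * Cyclic development of base classes *)

Section Development.
Variables (v P : nat).

(* Points are 0, ..., P; those below v form a copy of Z_v, the others are fixed. *)
Definition shift s x := if x < v then (x + s) %% v else x.

(** The size bounds the degree of [a]; uniqueness of the flattened list says that two edges through
    [a] share no further point. *)
Definition ok_at (F : seq (seq nat)) a :=
  let L := [seq e <- F | a \in e] in
  (size L <= 2) && uniq (flatten [seq [seq x <- e | x != a] | e <- L]).

Definition ok_class (F : seq (seq nat)) := all (ok_at F) (iota 0 P.+1).

(** If translation by [l] permutes the edges of a class, its translates by 0, ..., l-1 are all its
    translates. *)
Definition ok_period (F : seq (seq nat)) l :=
  (l == v) || all (fun e => has (perm_eq (map (shift l) e)) F) F.

(** Translation by [v - a] moves [a] to 0; what remains is the pair of the other two points, in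
    either order. *)
Definition normal_pair e a :=
  let L := [seq x <- map (shift (v - a)) e | x != 0] in (nth 0 L 0, nth 0 L 1).

Definition ok_edge e := [&& size e == 3, uniq e & all (fun x => x <= P) e].

Definition pair_table (F : seq (seq nat)) :=
  flatten [seq [seq normal_pair e a | a <- e & a < v] | e <- F].

(** It is enough to treat triples {0, y, z}, since the others are translates of these. The row of
    [y] collects its partners from both positions because the pairs of the table are unordered. *)
Definition ok_cover (D : seq (nat * seq (seq nat))) :=
  let tb := flatten [seq pair_table F.2 | F <- D] in
  all (fun y => let row := [seq p.2 | p <- tb & p.1 == y] ++ [seq p.1 | p <- tb & p.2 == y] in
    all (fun z => z \in row) (iota y.+1 (P - y))) (iota 1 P).

(** [P < v + 2] allows at most two fixed points, so the smallest point of every triple is moved by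
    the translations and can be brought to 0. *)
Definition ok_data (D : seq (nat * seq (seq nat))) :=
  [&& 0 < v, v <= P.+1, P < v + 2,
      all (fun F => [&& 0 < F.1, ok_class F.2, ok_period F.2 F.1 & all ok_edge F.2]) D &
      ok_cover D].

Lemma shift_le s x : 0 < v -> v <= P.+1 -> x <= P -> shift s x <= P.
Proof. by rewrite /shift => v0 vP xP; case: ifP => // _; have := ltn_pmod (x + s) v0; lia. Qed.

Lemma shift_inj s : injective (shift s).
Proof.
move=> x y; rewrite /shift; case: ifP => hx; case: ifP => hy //.
- by move/eqP; rewrite eqn_modDr !modn_small // => /eqP.
- by have := ltn_pmod (x + s) (leq_ltn_trans (leq0n _) hx) => h e; rewrite e hy in h.
- by have := ltn_pmod (y + s) (leq_ltn_trans (leq0n _) hy) => h e; rewrite -e hx in h.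
Qed.

Lemma shiftD s s' x : shift s (shift s' x) = shift (s + s') x.
Proof.
rewrite /shift; case: (ltnP x v) => hx; last by rewrite ltnNge hx.
by rewrite ltn_pmod ?(leq_ltn_trans _ hx) // modnDml addnAC -addnA.
Qed.

Lemma shift_mod s x : shift s x = shift (s %% v) x.
Proof. by rewrite /shift modnDmr. Qed.

Lemma shift_mulv q x : shift (q * v) x = x.
Proof. by rewrite /shift; case: ifP => // h; rewrite addnC modnMDl modn_small. Qed.

Hypotheses (v0 : 0 < v) (vP : v <= P.+1).

Definition shiftO s (i : 'I_P.+1) : 'I_P.+1 := 
  Ordinal (shift_le s v0 vP (ltn_ord i) : shift s i < P.+1).

Lemma shiftO_inj s : injective (shiftO s).
Proof. by move=> i j /(congr1 val)/shift_inj/val_inj. Qed.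

Definition eset (e : seq nat) : {set 'I_P.+1} := [set i | val i \in e].

Definition class_of (F : seq (seq nat)) : {set {set 'I_P.+1}} := [set t in map eset F].

Lemma good_class F : ok_class F -> good (class_of F).
Proof.
move=> ok; have {}ok (i : 'I_P.+1) : ok_at F i.
  by apply: (allP ok); rewrite mem_iota add0n ltn_ord.
split=> [x|t t' x y].
  have /andP[s2 _] := ok x; apply: leq_trans s2; rewrite -(size_map eset).
  apply: leq_trans (card_size _); apply/subset_leq_card/subsetP=> t.
  rewrite !inE => /andP[/mapP[e eF ->]]; rewrite inE => xe.
  by apply: map_f; rewrite mem_filter xe.
rewrite !inE => /mapP[e eF ->] /mapP[e' e'F ->] nxy; rewrite !inE => xe ye xe' ye'.
have /andP[] := ok x.
have : e \in [seq e <- F | val x \in e] by rewrite mem_filter xe.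
have : e' \in [seq e <- F | val x \in e] by rewrite mem_filter xe'.
have nyx : val y != val x by rewrite val_eqE eq_sym.
have yo g : val y \in g -> val y \in [seq z <- g | z != val x] by rewrite mem_filter nyx.
case: [seq e <- F | val x \in e] => [|g1 [|g2 [|]]] //=; rewrite !inE.
  by move=> /eqP-> /eqP->.
rewrite cats0 cat_uniq => g'; case/orP=> /eqP eg _ /and3P[_ /hasPn h _]; move: g'.
  case/orP=> /eqP eg'; first by rewrite eg eg'.
  by have := h (val y); rewrite -?eg -?eg' => /(_ (yo _ ye')); rewrite (yo _ ye).
case/orP=> /eqP eg'; last by rewrite eg eg'.
by have := h (val y); rewrite -?eg -?eg' => /(_ (yo _ ye)); rewrite (yo _ ye').
Qed.

Lemma shiftO_eset s e : all (fun x => x <= P) e ->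
  shiftO s @: eset e = eset (map (shift s) e).
Proof.
move=> eP; apply/setP=> i; apply/imsetP/idP=> [[j]|].
  by rewrite !inE => je ->; apply: map_f.
rewrite inE => /mapP[x xe ei]; have xP : x < P.+1 by apply: (allP eP).
by exists (Ordinal xP); [rewrite inE | apply/val_inj].
Qed.

Definition develop (D : seq (nat * seq (seq nat))) :=
  flatten [seq [seq himg (shiftO s) (class_of F.2) | s <- iota 0 F.1] | F <- D].

Lemma size_develop D : size (develop D) = sumn [seq F.1 | F <- D].
Proof.
elim: D => //= F D IH; by rewrite /develop /= size_cat size_map size_iota -IH.
Qed.

Lemma develop_good D : ok_data D -> {in develop D, forall H, good H}.
Proof.
case/and5P=> _ _ _ /allP ok _ H /flattenP[_ /mapP[F /ok /and4P[_ okF _ _] ->] /mapP[s _ ->]].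
by apply: good_himg; [exact: shiftO_inj | exact: good_class].
Qed.

(** Write s = q l + r with r < l: translation by q l carries [e] to another edge of [F], up to the
    order of its points, and the translation by r is one that is listed. *)
Lemma period_class F l e s : 0 < l -> ok_period F l -> all ok_edge F -> e \in F ->
  exists2 r, r < l & eset (map (shift s) e) \in himg (shiftO r) (class_of F).
Proof.
move=> l0 per okF eF.
have key e' r : e' \in F -> eset (map (shift r) e') \in himg (shiftO r) (class_of F).
  move=> e'F; have /and3P[_ _ h] := allP okF _ e'F.
  by rewrite -shiftO_eset //; apply: imset_f; rewrite inE; apply: map_f.
case/orP: per => [/eqP->|per].
  exists (s %% v); first exact: ltn_pmod.
  by rewrite (eq_map (shift_mod s)); apply: key.
have step q : exists2 e', e' \in F & perm_eq (map (shift (q * l)) e) e'.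
  elim: q => [|q [e' e'F pe]].
    exists e => //; rewrite (@eq_map _ _ _ id) ?map_id // => x.
    by have := shift_mulv 0 x; rewrite mul0n.
  have /hasP[e2 e2F p2] := allP per _ e'F; exists e2 => //; apply: perm_trans p2.
  rewrite mulSn (eq_map (g := shift l \o shift (q * l))); last by move=> x /=; rewrite shiftD.
  by rewrite map_comp; apply: perm_map.
have [e' e'F pe] := step (s %/ l); exists (s %% l); first exact: ltn_pmod.
suff -> : eset (map (shift s) e) = eset (map (shift (s %% l)) e') by apply: key.
apply/setP=> i; rewrite !inE; apply: perm_mem.
rewrite {1}(divn_eq s l) addnC (eq_map (g := shift (s %% l) \o shift (s %/ l * l))).
  by rewrite map_comp; apply: perm_map.
by move=> x /=; rewrite shiftD.
Qed.

Lemma develop_cover D (t : {set 'I_P.+1}) : ok_data D ->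
  #|t| = 3 -> exists2 H, H \in develop D & t \in H.
Proof.
case/and5P=> _ _ Pv /allP ok cov t3.
have [x [y [z [tE nxy nxz nyz /andP[xy yz]]]]] := card3_sorted (@nat_of_ord P.+1) t3.
have {nxy nyz} [{}xy {}yz] : x < y /\ y < z by rewrite !ltn_neqAle !val_eqE nxy nyz xy.
have xv : x < v by have := ltn_ord z; lia.
(* This undoes the translation by [x]; as [x] is the smallest point of the triple, no reduction
   modulo [v] occurs. *)
pose un w := if w < v then w - x else w.
have unK w : x <= w -> shift x (un w) = w.
  rewrite /un /shift => xw; case: (ltnP w v) => wv; last by rewrite ltnNge wv.
  by rewrite ifT ?subnK ?modn_small //; lia.
have uy : 0 < un y by rewrite /un; case: ifP => _; lia.
have uyz : un y < un z by rewrite /un; case: ifP => hy; case: ifP => hz; lia.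
have uz : un z <= P by rewrite /un; case: ifP => _; have := ltn_ord z; lia.
set tb := flatten [seq pair_table F.2 | F <- D] in cov.
have [p ptb ep] : exists2 p, p \in tb & p = (un y, un z) \/ p = (un z, un y).
  have /(allP cov)/allP/(_ (un z)) : un y \in iota 1 P by rewrite mem_iota; lia.
  rewrite mem_iota mem_cat => /(_ _)/orP[|/mapP[p]|/mapP[p]]; first by lia.
    by rewrite mem_filter => /andP[/eqP e1 ptb] e2; exists p; rewrite // -e1 e2; left; case: (p).
  by rewrite mem_filter => /andP[/eqP e1 ptb] e2; exists p; rewrite // -e1 e2; right; case: (p).
case/flattenP: ptb => _ /mapP[F FD ->] /flattenP[_ /mapP[e eF ->]] /mapP[a].
rewrite mem_filter => /andP[av ae] pE.
have /and4P[l0 okc per oke] := ok _ FD.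
have /and3P[/eqP e3 ue eP] := allP oke _ eF.
set M := map (shift (v - a)) e in pE; set L := [seq x <- M | x != 0].
have M0 : 0 \in M.
  by apply/mapP; exists a; rewrite // /shift av subnKC ?modnn // ltnW.
have uM : uniq M by rewrite map_inj_uniq //; exact: shift_inj.
have sL : size L = 2.
  have := count_predC (pred1 0) M; rewrite count_uniq_mem // M0 size_map e3 => h.
  by rewrite size_filter; apply: (can_inj (addKn 1)).
have ML i : (i \in M) = [|| i == 0, i == un y | i == un z].
  have -> : (i \in M) = (i == 0) || (i \in L).
    by rewrite mem_filter; case: (eqVneq i 0) => [->|].
  congr orb; move: sL pE ep; rewrite /normal_pair -/M -/L.
  case: L => [|a1 [|a2 []]] //= _ -> [] [-> ->]; by rewrite !inE // orbC.
have tM : t = eset (map (shift (x + (v - a))) e).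
  rewrite (eq_map (g := shift x \o shift (v - a))); last by move=> w /=; rewrite shiftD.
  rewrite map_comp -/M tE; apply/setP=> i; rewrite in_tri inE.
  have sx0 : shift x 0 = x by rewrite /shift v0 add0n modn_small.
  apply/idP/mapP=> [h|[w]].
    case/or3P: h => /eqP->.
    - by exists 0; rewrite ?sx0.
    - by exists (un y); rewrite ?ML ?eqxx ?orbT ?unK // ltnW.
    - by exists (un z); rewrite ?ML ?eqxx ?orbT ?unK // ltnW // (ltn_trans xy).
  rewrite ML -!val_eqE => /or3P[]/eqP-> ->; rewrite /= ?sx0 ?unK ?eqxx ?orbT //.
    exact: ltnW.
  by rewrite ltnW // (ltn_trans xy).
have [r rl hr] := @period_class F.2 F.1 e (x + (v - a)) l0 per oke eF.
exists (himg (shiftO r) (class_of F.2)); last by rewrite tM.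
apply/flattenP; exists [seq himg (shiftO s) (class_of F.2) | s <- iota 0 F.1].
  by apply/mapP; exists F.
by apply: map_f; rewrite mem_iota.
Qed.
End Development.

(* The cover is for n + 1 points; when n = 3 mod 6 the count forces all classes to size 2n/3. *)
Definition S_cover n := triple_cover 'I_n.+1 ((n ^ 2 - 1) %/ 4).

(* For n = 9 mod 12 take d = 0: the classes have size 2n/3.  For n = 3 mod 12 that is
   impossible by parity, and d = 1 allows one more class which is a matching. *)
Definition R_cover d (T : finType) := exists (Hs : seq {set {set T}}) (H0 : {set {set T}}),
  [/\ 4 * size Hs + 2 * d <= (#|T| - 1) * (#|T| - 2), {in Hs, forall H, good H},
      linear_hg H0, forall x, degr H0 x <= d &
      forall t : {set T}, #|t| = 3 -> t \in H0 \/ exists2 H, H \in Hs & t \in H].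

(** The number of classes is (n+1)(n-1)/4. For n = 1 mod 4 these are (n-1)/4 full orbits of the
    translations of Z_(n+1); for n = 3 mod 4 one orbit has to be half as long. *)
Lemma S_cover_data n D : ok_data n.+1 n D -> sumn [seq F.1 | F <- D] <= (n ^ 2 - 1) %/ 4 ->
  S_cover n.
Proof.
move=> ok sD; exists (develop (ltn0Sn n) (leqnn n.+1) D); split.
- by rewrite size_develop.
- exact: develop_good.
- by move=> t; apply: develop_cover.
Qed.

(** For n + 2 points with n + 2 = 9 mod 12, the n(n+1)/4 classes make up (n+1)/4 full orbits of Z_n.
    This is why the cyclic group has order n and fixes two points. *)
Lemma R_cover_data0 n D : ok_data n n.+1 D -> 4 * sumn [seq F.1 | F <- D] <= n.+1 * n ->
  R_cover 0 'I_n.+2.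
Proof.
move=> ok sD; have /andP[v0 /andP[vP _]] := ok.
exists (develop v0 vP D), set0; split.
- by rewrite size_develop card_ord subn1 subn2 /= addn0.
- exact: develop_good.
- by move=> t t' x y; rewrite inE.
- by move=> x; rewrite leqn0; apply/degr0P=> t; rewrite inE.
- by move=> t t3; right; apply: develop_cover.
Qed.

(** On N = n + 1 points with N = 3 mod 12 there remain ((N-1)(N-2) - 2)/4 = N(N-3)/4 classes besides
    the matching, that is (N-3)/4 full orbits of Z_N. The matching [M] is checked as one more class
    of period 1, invariant under all translations. *)
Lemma R_cover_data1 n D M : ok_data n.+1 n (rcons D (1, M)) -> uniq (flatten M) ->
  4 * sumn [seq F.1 | F <- D] + 2 <= n * n.-1 -> R_cover 1 'I_n.+1.
Proof.
move=> ok uM sD; pose v0 := ltn0Sn n; pose vP := leqnn n.+1.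
have mM : matching (class_of n M).
  elim: M uM {ok sD} => [|e M IH] /=; first by move=> _ t t' x; rewrite inE.
  rewrite cat_uniq => /and3P[_ /hasPn h /IH{}IH].
  have sep (t : {set _}) (x : 'I_n.+1) : t \in class_of n M -> x \in t -> val x \notin e.
    rewrite inE => /mapP[e' e'M ->]; rewrite inE => xe'; apply: h.
    by apply/flattenP; exists e'.
  move=> t t' x; rewrite !in_set !inE => /orP[/eqP->|tM] /orP[/eqP->|t'M] //.
  - by rewrite inE => xe xt'; have := sep t' x; rewrite inE xe => /(_ t'M xt').
  - by move=> xt; rewrite inE => xe; have := sep t x; rewrite inE xe => /(_ tM xt).
  - by apply: IH; rewrite inE.
have mM' := matching_himg (@shiftO_inj _ _ v0 vP 0) mM.
exists (develop v0 vP D), (himg (shiftO v0 vP 0) (class_of n M)).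
have dE : develop v0 vP (rcons D (1, M)) =
    rcons (develop v0 vP D) (himg (shiftO v0 vP 0) (class_of n M)).
  by rewrite /develop map_rcons flatten_rcons /= cats1.
split.
- by rewrite size_develop card_ord subn1 subn2 /= muln1.
- by move=> H HD; apply: (develop_good ok); rewrite dE mem_rcons inE HD orbT.
- exact: matching_linear.
- by move=> x; apply: matching_degr.
- move=> t t3; have [H] := develop_cover v0 vP ok t3.
  by rewrite dE mem_rcons inE => /orP[/eqP-> ->|HD tH]; [left | right; exists H].
Qed.

Fixpoint chop (s : seq nat) : seq (seq nat) :=
  if s is x :: y :: z :: s' then [:: x; y; z] :: chop s' else [::].

Definition full (v : nat) (Fs : seq (seq nat)) := [seq (v, chop F) | F <- Fs].

(** Multiplication by a unit [g] normalizes the translations and preserves goodness, so one starter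
    class yields several base classes. In the uses below [k] is the order of [g] modulo [v]: 3 has
    order 5, 11 and 23 modulo 22, 46 and 94, and 7 has order 7 modulo 58. *)
Definition multiples v g k (F : seq nat) :=
  traject (map (fun x => (g * x) %% v)) F k.

(** * Classes on three blocks *)

Section Families.
Variables (T B : finType) (C : eqType) (col : T -> C) (c0 c1 c2 : C).
Hypotheses (c01 : c0 != c1) (c02 : c0 != c2) (c12 : c1 != c2).

Definition fam (p : B -> T * T * T) : {set {set T}} :=
  [set tri (p b).1.1 (p b).1.2 (p b).2 | b : B].

Definition colored (p : B -> T * T * T) :=
  forall b, [/\ col (p b).1.1 = c0, col (p b).1.2 = c1 & col (p b).2 = c2].

Lemma fam_col p t x : colored p -> t \in fam p -> x \in t -> col x \in [:: c0; c1; c2].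
Proof.
move=> cp /imsetP[b _ ->]; rewrite in_tri; have [h0 h1 h2] := cp b.
by case/or3P=> /eqP->; rewrite ?h0 ?h1 ?h2 !inE eqxx ?orbT.
Qed.

Lemma fam_common p q b b' x : colored p -> colored q ->
  x \in tri (p b).1.1 (p b).1.2 (p b).2 -> x \in tri (q b').1.1 (q b').1.2 (q b').2 ->
  [\/ col x = c0 /\ (p b).1.1 = (q b').1.1, col x = c1 /\ (p b).1.2 = (q b').1.2 |
      col x = c2 /\ (p b).2 = (q b').2].
Proof.
move=> cp cq; have [h0 h1 h2] := cp b; have [k0 k1 k2] := cq b'.
rewrite !in_tri; case/or3P=> /eqP->.
- rewrite h0; case/or3P=> /eqP e; [by constructor 1 | exfalso..].
    by case/eqP: c01; rewrite -h0 -k1 e.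
  by case/eqP: c02; rewrite -h0 -k2 e.
- rewrite h1; case/or3P=> /eqP e; [exfalso | by constructor 2 | exfalso].
    by case/eqP: c01; rewrite -h1 -k0 e.
  by case/eqP: c12; rewrite -h1 -k2 e.
- rewrite h2; case/or3P=> /eqP e; [exfalso.. | by constructor 3].
    by case/eqP: c02; rewrite -h2 -k0 e.
  by case/eqP: c12; rewrite -h2 -k1 e.
Qed.

Definition fam_inj (p : B -> T * T * T) :=
  [/\ injective (fun b => (p b).1.1), injective (fun b => (p b).1.2) &
      injective (fun b => (p b).2)].

Lemma fam_matching p : colored p -> fam_inj p -> matching (fam p).
Proof.
move=> cp [i0 i1 i2] t t' x /imsetP[b _ ->] /imsetP[b' _ ->] h h'.
by have [] := fam_common cp cp h h'; case=> _; [move/i0|move/i1|move/i2]=> ->.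
Qed.

Lemma fam_col_neq p t x y : colored p -> t \in fam p -> x \in t -> y \in t -> x != y ->
  col x != col y.
Proof.
move=> cp /imsetP[b _ ->] xp yp nxy; have [k0 k1 k2] := cp b.
by move: xp yp nxy; rewrite !in_tri => /or3P[]/eqP-> /or3P[]/eqP->; rewrite ?eqxx // => _;
  rewrite ?k0 ?k1 ?k2 // eq_sym.
Qed.

(** Each family is a matching since all its coordinates are injective, which bounds the degrees by
    two. Points of one edge have different colours, so two common points would be coincidences in
    two positions, and the hypothesis excludes all three choices of positions. *)
Lemma fam_pair_good p q : colored p -> colored q -> fam_inj p -> fam_inj q ->
  (forall b b', [/\ (p b).1.1 = (q b').1.1 -> (p b).1.2 != (q b').1.2,
     (p b).1.1 = (q b').1.1 -> (p b).2 != (q b').2 &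
     (p b).1.2 = (q b').1.2 -> (p b).2 != (q b').2]) ->
  good (fam p :|: fam q).
Proof.
move=> cp cq ip iq h.
have mp := fam_matching cp ip; have mq := fam_matching cq iq; split.
  by move=> x; apply: leq_trans (degrU _ _ _) (leq_add (matching_degr x mp) (matching_degr x mq)).
apply: linearU; [exact: matching_linear..|].
move=> _ _ x y /imsetP[b _ ->] /imsetP[b' _ ->] nxy xp yp xq yq; exfalso.
have [h01 h02 h12] := h b b'.
have colxy : col x != col y.
  by apply: fam_col_neq cp _ xp yp nxy; apply: imset_f.
have := fam_common cp cq xp xq; have := fam_common cp cq yp yq.
move=> [] [cy ey] [] [cx ex]; rewrite ?cx ?cy ?eqxx // in colxy.
- by have := h01 ey; rewrite ex eqxx.
- by have := h02 ey; rewrite ex eqxx.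
- by have := h01 ex; rewrite ey eqxx.
- by have := h12 ey; rewrite ex eqxx.
- by have := h02 ex; rewrite ey eqxx.
- by have := h12 ex; rewrite ey eqxx.
Qed.
End Families.

Lemma degr_le_seq (T : finType) (H : {set {set T}}) x (s : seq {set T}) :
  (forall t, t \in H -> x \in t -> t \in s) -> degr H x <= size s.
Proof.
move=> h; apply: leq_trans (card_size s); apply/subset_leq_card/subsetP=> t.
by rewrite inE => /andP[]; exact: h.
Qed.

Local Open Scope ring_scope.

(** An abstract form of the integers modulo 2e + 1. The odd order makes doubling injective and
    splits the nonzero differences into e pairs of opposite ones. *)
Record is_Zmod (e : nat) (K : finComNzRingType) : Prop := IsZmod {
  card_K : #|K| = (e.*2.+1)%N;
  K_char : (e.*2.+1)%:R = 0 :> K;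
  K_natP : forall x : K, exists2 m : nat, (m < e.*2.+1)%N & x = m%:R;
  K_nat_neq0 : forall m, (0 < m < e.*2.+1)%N -> m%:R != 0 :> K }.

Lemma exists_Zmod e : (0 < e)%N -> exists K, is_Zmod e K.
Proof.
move=> e0; have u1 : (1 < e.*2.+1)%N by lia.
exists 'Z_(e.*2.+1); split.
- by rewrite card_ord Zp_cast.
- exact: pchar_Zp.
- move=> x; exists (nat_of_ord x); last by rewrite natr_Zp.
  by rewrite -[X in (_ < X)%N](Zp_cast u1).
- move=> m /andP[m0 mu]; apply/negP=> /eqP/(congr1 val) /=.
  by rewrite val_Zp_nat // modn_small //; lia.
Qed.

(** * Pairing the translation orbits of transversal triples *)

Section Blocks.
Variables (e : nat) (K : finComNzRingType).
Hypothesis ZK : is_Zmod e K.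
Local Notation u := (e.*2.+1)%N.

Lemma K_odd (d : K) : d + d = 0 -> d = 0.
Proof.
move=> h; have : d *+ u = 0 by rewrite -mulr_natr (K_char ZK) mulr0.
by rewrite -[e.*2]muln2 mulnC mulrS mulrnA mulr2n h mul0rn addr0.
Qed.

(** The edges of the orbit [pT p] have the constant differences p.1, p.2 and p.1 + p.2 between their
    blocks; two orbits share no pair of points when all three are different. *)
Definition compat (p q : K * K) := [&& p.1 != q.1, p.2 != q.2 & p.1 + p.2 != q.1 + q.2].

Definition pair_idx := ('I_u * 'I_e + 'I_e)%type.

Lemma card_pair_idx : #|{: pair_idx}| = (u * e + e)%N.
Proof. by rewrite card_sum card_prod !card_ord. Qed.

(* On each line s - t = w, consecutive points are paired, leaving the point t = 0 (w even)
   or t = 1 (w odd); the leftovers of the lines w = 2q and w = 2q + 1 are paired. *)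
Definition ppair (r : pair_idx) : (K * K) * (K * K) :=
  match r with
  | inl (w, r) => let t := (r.*2.+1 + odd w)%:R in ((t + w%:R, t), (t + w%:R + 1, t + 1))
  | inr q => ((q.*2%:R, 0), (q.*2.+2%:R, 1))
  end.

(** The leftover of the line w = 2e, without a partner because the number of lines is odd. *)
Definition plast : K * K := (e.*2%:R, 0).

(** Paired parameters differ by (1, 1) on a line and by (2, 1) between leftovers, so the sums differ
    by 2 or 3. That 3 is nonzero is the reason for [1 < e]. *)
Lemma ppair_compat r : (1 < e)%N -> compat (ppair r).1 (ppair r).2.
Proof.
move=> e1; have H2 : (2%:R : K) != 0 by apply: (K_nat_neq0 ZK); lia.
have H1 : (1%:R : K) != 0 by apply: (K_nat_neq0 ZK); lia.
have H3 : (3%:R : K) != 0 by apply: (K_nat_neq0 ZK); lia.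
case: r => [[w r]|q]; rewrite /compat; apply/and3P; rewrite /ppair.
  set t := (_ + _)%:R; cbn [fst snd]; split; rewrite -subr_eq0.
  - by rewrite (_ : _ - _ = - 1%:R) ?oppr_eq0 //; ring.
  - by rewrite (_ : _ - _ = - 1%:R) ?oppr_eq0 //; ring.
  - by rewrite (_ : _ - _ = - 2%:R) ?oppr_eq0 //; ring.
cbn [fst snd]; split; rewrite -subr_eq0.
- by rewrite (_ : _ - _ = - 2%:R) ?oppr_eq0 // -(addn2 q.*2) natrD; ring.
- by rewrite sub0r oppr_eq0.
- by rewrite (_ : _ - _ = - 3%:R) ?oppr_eq0 // -(addn2 q.*2) natrD; ring.
Qed.

Lemma ppair_cover p : p = plast \/ exists r, p = (ppair r).1 \/ p = (ppair r).2.
Proof.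
(* [t'] is the position on the line counted from its leftover point; the positions 2r+1 and 2r+2
   form a pair. *)
case: p => s t; have [w wu ew] := K_natP ZK (s - t); have [t' t'u et] := K_natP ZK (t - (odd w)%:R).
have {}ew : s = t + w%:R by rewrite -ew; ring.
have {}et : t = t'%:R + (odd w)%:R by rewrite -et; ring.
case: (posnP t') => [t'0|t'0].
  rewrite t'0 add0r in et; case: (ltnP w e.*2) => we; last first.
    left; have {}we : w = e.*2 by lia.
    by rewrite /plast ew et we odd_double add0r.
  have qe : (w./2 < e)%N by lia.
  right; exists (inr (Ordinal qe)); rewrite /ppair /=; move: (odd_double_half w) ew et.
  case: (odd w) => /= wE ew et; [right|left]; congr (_, _); rewrite ?et // ew et.
    by rewrite (_ : w./2.*2.+2 = (1 + w)%N) ?natrD //; lia.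
  by rewrite add0r; congr (_%:R); lia.
have re : ((t'.-1)./2 < e)%N by lia.
right; exists (inl (Ordinal wu, Ordinal re)); rewrite /ppair /=.
have := odd_double_half t'.-1; case: (odd t'.-1) => /= h; [right|left].
  have et' : t = ((t'.-1)./2.*2.+1 + odd w)%:R + 1.
    by rewrite et -[1 in RHS]/(1%:R) -!natrD; congr (_%:R); lia.
  by rewrite ew et'; congr (_, _); ring.
have et' : t = ((t'.-1)./2.*2.+1 + odd w)%:R.
  by rewrite et -!natrD; congr (_%:R); lia.
by rewrite ew et'.
Qed.

(** * Orbits of triples on three blocks *)

Section Fills.
Variable I : finType.
Variables i j k : I.
Hypotheses (ij : i != j) (ik : i != k) (jk : j != k).
Local Notation pt := (I * K)%type.

Definition pT (p : K * K) (b : K) : pt * pt * pt := ((i, b + p.1 + p.2), (j, b), (k, b + p.1)).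
(** The transversal triples whose coordinate in [i] is the sum of the other two, sorted by the
    difference [s] of these. *)
Definition pM (s : K) (b : K) : pt * pt * pt := ((i, b + b + s), (j, b), (k, b + s)).
(* The edge of pT at b = p.2 is cut at infinity; the edges lost in this way are those of pM. *)
Definition pN (p : K * K) (b : K) : option pt * option pt * option pt :=
  (if b == p.2 then None else Some (i, b + p.1 + p.2), Some (j, b), Some (k, b + p.1)).

(** Infinity takes the colour of the block whose point it replaces, so the results on coloured
    families apply to [pN]. *)
Definition ocol (x : option pt) := if x is Some y then y.1 else i.

Lemma pT_col p : colored fst i j k (pT p). Proof. by []. Qed.
Lemma pM_col s : colored fst i j k (pM s). Proof. by []. Qed.
Lemma pN_col p : colored ocol i j k (pN p).
Proof. by move=> b; rewrite /pN /=; split => //; case: ifP. Qed.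

Lemma pT_inj p : fam_inj (pT p).
Proof.
by split=> b b' /= [] // h; [apply: (addIr p.1); apply: (addIr p.2) | apply: (addIr p.1)].
Qed.

Lemma pM_inj s : fam_inj (pM s).
Proof.
split=> b b' /= [] // h; last exact: (addIr s).
have {}h : b + b = b' + b' by apply: (addIr s).
 apply/eqP; rewrite -subr_eq0; apply/eqP/K_odd.
by rewrite (_ : _ + _ = (b + b) - (b' + b')); [rewrite h subrr | ring].
Qed.

Lemma pN_inj p : fam_inj (pN p).
Proof.
split=> b b' /=; [|by case|by case=> h; apply: (addIr p.1)].
case: eqP => [->|_]; case: eqP => [->|_] // [h].
by apply: (addIr p.1); apply: (addIr p.2).
Qed.

Lemma T_good p q : compat p q -> good (fam (pT p) :|: fam (pT q)).
Proof.
move=> /and3P[c1 c2 c3].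
apply: (fam_pair_good ij ik jk (pT_col p) (pT_col q) (pT_inj p) (pT_inj q)) => b b' /=.
split=> -[].
- move=> h; rewrite xpair_eqE eqxx /=; apply: contra c3 => /eqP eb.
  by move: h; rewrite eb -!addrA => /addrI ->.
- move=> h; rewrite xpair_eqE eqxx /=; apply: contra c2 => /eqP eb.
  by move: h; rewrite eb => /addrI ->.
- by move=> ->; rewrite xpair_eqE eqxx /= (inj_eq (addrI _)).
Qed.

Lemma M_good s s' : s != s' -> good (fam (pM s) :|: fam (pM s')).
Proof.
move=> ss.
apply: (fam_pair_good ij ik jk (pM_col s) (pM_col s') (pM_inj s) (pM_inj s')) => b b' /=.
split=> -[].
- move=> h; rewrite xpair_eqE eqxx /=; apply: contra ss => /eqP eb.
  by move: h; rewrite eb => /addrI ->.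
- move=> h; rewrite xpair_eqE eqxx /=; apply: contra ss => /eqP eb.
  have hb : b = b' by apply: (addIr (b' + s')); rewrite -{1}eb addrA h; ring.
  by move: eb; rewrite hb => /addrI ->.
- by move=> ->; rewrite xpair_eqE eqxx /= (inj_eq (addrI _)).
Qed.

(** The two cut edges meet at infinity; their other points p.2, q.2 in block [j] and p.1 + p.2, q.1
    + q.2 in block [k] differ by compatibility. *)
Lemma N_good p q : compat p q -> good (fam (pN p) :|: fam (pN q)).
Proof.
move=> /and3P[c1 c2 c3].
apply: (fam_pair_good ij ik jk (pN_col p) (pN_col q) (pN_inj p) (pN_inj q)) => b b' /=.
split.
- case: eqP => [->|_]; case: eqP => [->|_] //.
    by move=> _; rewrite (inj_eq Some_inj) xpair_eqE eqxx.
  move=> [h]; rewrite (inj_eq Some_inj) xpair_eqE eqxx /=; apply: contra c3 => /eqP eb.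
  by move: h; rewrite eb -!addrA => /addrI ->.
- case: eqP => [->|_]; case: eqP => [->|_] //.
    by move=> _; rewrite (inj_eq Some_inj) xpair_eqE eqxx /= addrC [q.2 + _]addrC.
  move=> [h]; rewrite (inj_eq Some_inj) xpair_eqE eqxx /=; apply: contra c2 => /eqP eb.
  by move: h; rewrite eb => /addrI ->.
- by move=> [->]; rewrite (inj_eq Some_inj) xpair_eqE eqxx /= (inj_eq (addrI _)).
Qed.

Lemma T_mem x y z : tri (i, x) (j, y) (k, z) \in fam (pT (z - y, x - z)).
Proof.
by apply/imsetP; exists y => //=; congr tri; congr (_, _); ring.
Qed.

Lemma N_mem x y z : x != y + z ->
  tri (Some (i, x)) (Some (j, y)) (Some (k, z)) \in fam (pN (z - y, x - z)).
Proof.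
move=> h; apply/imsetP; exists y => //=; rewrite ifN.
  by congr tri; congr (Some (_, _)); ring.
by apply: contra h => /eqP{1}->; apply/eqP; ring.
Qed.

Lemma N_mem_infty y z : tri None (Some (j, y)) (Some (k, z)) \in fam (pN (z - y, y)).
Proof.
by apply/imsetP; exists y => //=; rewrite eqxx; congr tri; congr (Some (_, _)); ring.
Qed.

Lemma M_mem x y z : x = y + z -> tri (i, x) (j, y) (k, z) \in fam (pM (z - y)).
Proof. by move=> ->; apply/imsetP; exists y => //=; congr tri; congr (_, _); ring. Qed.

Definition pA (j i : I) (d c x : K) : pt * pt * pt := ((j, x), (j, x + d), (i, x + c)).
(** A point of [j] or [k] has degree 2, through the differences [d] and [-d], and a point of [i] has
    one edge in each orbit. With 2u edges on 3u points the class is as large as possible. *)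
Definition AB d c := fam (pA j i d c) :|: fam (pA k i d c).

Lemma pA_common (a b : I) (d c x y : K) (p : pt) : a != b ->
  p \in tri (a, x) (a, x + d) (b, x + c) -> p \in tri (a, y) (a, y + d) (b, y + c) ->
  x = y \/ (p = (a, x) /\ x = y + d) \/ (p = (a, x + d) /\ y = x + d).
Proof.
move=> ab; rewrite !in_tri => /or3P[]/eqP->; rewrite !xpair_eqE ?eqxx /=.
- case/or3P=> [/eqP->|/eqP->|]; [by left | by right; left | by rewrite (negPf ab)].
- case/or3P=> [/eqP<-|/eqP/addIr->|]; [by right; right | by left | by rewrite (negPf ab)].
- by rewrite eq_sym (negPf ab) /= => /eqP/addIr->; left.
Qed.

(** Distinct edges with two common points would have base points with x = y + d and y = x + d,
    whence 2d = 0. *)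
Lemma pA_linear a b d c : a != b -> d != 0 -> linear_hg (fam (pA a b d c)).
Proof.
move=> ab d0 _ _ p q /imsetP[x _ ->] /imsetP[y _ ->] npq /= px qx py qy.
case: (pA_common ab px py) => [->//|hp]; case: (pA_common ab qx qy) => [->//|hq].
exfalso; have nd : d + d != 0 by apply: contra d0 => /eqP/K_odd->.
case: hp => [[ep h1]|[ep h1]]; case: hq => [[eq h2]|[eq h2]].
- by rewrite ep eq eqxx in npq.
- by case/eqP: nd; apply: (addrI x); rewrite addr0 {2}h1 h2; ring.
- by case/eqP: nd; apply: (addrI x); rewrite addr0 {2}h2 h1; ring.
- by rewrite ep eq eqxx in npq.
Qed.

Lemma pA_degr1 (a b : I) d c (p : pt) : a != b -> p.1 != a ->
  (degr (fam (pA a b d c)) p <= (p.1 == b))%N.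
Proof.
case: p => l w /= ab la; case: (eqVneq l b) => [->|lb].
  apply: (@degr_le_seq _ _ _ [:: tri (a, w - c) (a, w - c + d) (b, w - c + c)]).
  move=> _ /imsetP[x _ ->] /=; rewrite in_tri !xpair_eqE [b == a]eq_sym (negPf ab) eqxx /=.
  by move=> /eqP->; rewrite addrK mem_seq1.
rewrite leqn0; apply/degr0P=> _ /imsetP[x _ ->] /=.
by rewrite in_tri !xpair_eqE (negPf la) (negPf lb).
Qed.

Lemma pA_degr2 a b d c w : a != b -> (degr (fam (pA a b d c)) (a, w) <= 2)%N.
Proof.
move=> ab.
apply: (@degr_le_seq _ _ _ [:: tri (a, w) (a, w + d) (b, w + c);
   tri (a, w - d) (a, w - d + d) (b, w - d + c)]).
move=> _ /imsetP[x _ ->] /=; rewrite in_tri !xpair_eqE (negPf ab) eqxx /= orbF.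
by case/orP=> /eqP->; rewrite ?addrK !inE eqxx ?orbT.
Qed.

Lemma AB_good d c : d != 0 -> good (AB d c).
Proof.
move=> d0; have ji : j != i by rewrite eq_sym. have ki : k != i by rewrite eq_sym.
split.
  case=> l w; apply: leq_trans (degrU _ _ _) _.
  case: (eqVneq l j) => [->|lj].
    have := @pA_degr1 k i d c (j, w) ki; rewrite /= jk (negPf ji) leqn0 => /(_ isT)/eqP->.
    by rewrite addn0 pA_degr2.
  have h1 := @pA_degr1 j i d c (l, w) ji lj.
  case: (eqVneq l k) h1 => [->|lk] h1.
    by move: h1; rewrite /= (negPf ki) leqn0 => /eqP->; rewrite pA_degr2.
  have h2 := @pA_degr1 k i d c (l, w) ki lk.
  by apply: leq_trans (leq_add h1 h2) _; case: eqP.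
apply: linearU; [exact: pA_linear..|].
move=> _ _ p q /imsetP[x _ ->] /imsetP[y _ ->] npq /=; rewrite !in_tri.
have kj : k != j by rewrite eq_sym.
have key r : [|| r == (j, x), r == (j, x + d) | r == (i, x + c)] ->
   [|| r == (k, y), r == (k, y + d) | r == (i, y + c)] -> r = (i, x + c).
  by case/or3P=> /eqP->; rewrite // !xpair_eqE (negPf jk) (negPf ji).
by move=> hp hq /(key _ hp) ep /(key _ hq) eq; rewrite ep eq eqxx in npq.
Qed.

End Fills.

(** Exactly one of the opposite differences y - x and x - y is among 1, ..., e; this decides which
    of the two points is the base point. *)
Lemma A_mem (I : finType) (a b : I) x y z : x != y -> exists (r : 'I_e) (c : K),
  tri (a, x) (a, y) (b, z) \in fam (pA a b r.+1%:R c).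
Proof.
move=> xy; have [m mu em] := K_natP ZK (y - x).
have m0 : (0 < m)%N.
  by rewrite lt0n; apply: contra xy => /eqP m0; move/eqP: em; rewrite m0 subr_eq add0r eq_sym.
case: (ltnP e m) => me.
  have re : (u - m.+1 < e)%N by lia.
  exists (Ordinal re), (z - y); apply/imsetP; exists y => //=.
  have -> : y + (u - m.+1).+1%:R = x.
    have -> : (u - m.+1).+1 = (u - m)%N by lia.
    by rewrite natrB ?(K_char ZK) 1?ltnW // -em; ring.
  rewrite (_ : y + (z - y) = z); last by ring.
  by apply/setP=> p; rewrite !in_tri orbCA.
have re : (m.-1 < e)%N by lia.
exists (Ordinal re), (z - x); apply/imsetP; exists x => //=.
rewrite prednK // -em; congr tri; congr (_, _); ring.
Qed.
End Blocks.

Local Close Scope ring_scope.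

(** * Tripling *)

Lemma R_cover_transport d (T U : finType) : #|T| = #|U| -> R_cover d T -> R_cover d U.
Proof.
move=> e /=; have [f fi fs] := card_eq_bij e; move=> [Hs [H0 [sz gH lH dH cH]]].
exists (map (himg f) Hs), (himg f H0); split.
- by rewrite size_map -e.
- by move=> A /mapP[B /gH gB ->]; apply: good_himg.
- exact: linear_himg.
- by move=> x; apply: degr_himg_le.
- move=> u u3; have [t -> /cH[tH|[H HHs tH]]] := @preim_triple _ _ f fi u (fun x _ => fs x) u3.
    by left; rewrite mem_himg.
  by right; exists (himg f H); [apply: map_f | rewrite mem_himg].
Qed.

(** * Copies of a hypergraph on all levels *)

Section Levels.
Variables (I U : finType).

Definition lev (A : {set {set U}}) : {set {set I * U}} := \bigcup_l himg (pair l) A.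

Lemma pair_inj (l : I) : injective (@pair I U l). Proof. by move=> x y []. Qed.

Lemma lev_edge A t x : t \in lev A -> x \in t -> t \in himg (pair x.1) A.
Proof. by case/bigcupP=> l _ tA /(himgP tA)[t' [y [_ _ -> _]]]. Qed.

Lemma lev_same A t x y : t \in lev A -> x \in t -> y \in t -> x.1 = y.1.
Proof.
case/bigcupP=> l _ tA /(himgP tA)[_ [x' [_ _ -> _]]] /(himgP tA)[_ [y' [_ _ -> _]]].
by [].
Qed.

Lemma degr_lev A d x : (forall y, degr A y <= d) -> degr (lev A) x <= d.
Proof.
move=> dA; rewrite -[degr _ _]/(degr (lev A) x).
have : degr (himg (pair x.1) A) x <= d by apply: degr_himg_le; first exact: pair_inj.
apply: leq_trans; apply/subset_leq_card/subsetP=> t; rewrite !inE => /andP[tA xt].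
by rewrite xt andbT (lev_edge tA xt).
Qed.

Lemma linear_lev A : linear_hg A -> linear_hg (lev A).
Proof.
move=> lA t t' x y tA t'A nxy xt yt xt' yt'.
exact: (linear_himg (@pair_inj x.1) lA (lev_edge tA xt) (lev_edge t'A xt') nxy).
Qed.

Lemma good_lev A : good A -> good (lev A).
Proof. by case=> dA lA; split; [move=> x; apply: degr_lev | apply: linear_lev]. Qed.

Lemma lev_mem (A : {set {set U}}) (l : I) (t : {set U}) : t \in A -> pair l @: t \in lev A.
Proof. by move=> tA; apply/bigcupP; exists l; rewrite // mem_himg //; exact: pair_inj. Qed.

Lemma level_triple (t : {set I * U}) l : (forall x, x \in t -> x.1 = l) -> #|t| = 3 ->
  exists2 t' : {set U}, t = pair l @: t' & #|t'| = 3.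
Proof.
move=> h; apply: preim_triple; first exact: pair_inj.
by move=> [a b] /h /= ->; exists b.
Qed.
End Levels.

Local Open Scope ring_scope.

(** The number u^2 of transversal orbits is odd, so one matching is left unpaired. With the copies
    of [H0] it forms [X], of degree at most d + 1 and linear because its edges lie inside levels or
    across them. For d = 0 it is the new exceptional matching, for d = 1 it is good and becomes an
    ordinary class; so d turns into 1 - d. *)
Lemma R_cover_triple d (T T' : finType) e : #|T| = e.*2.+1 -> (1 < e)%N -> (d <= 1)%N ->
  #|T'| = (3 * #|T|)%N -> R_cover d T -> R_cover (1 - d)%N T'.
Proof.
move=> cT e1 d1 cT'; have [K ZK] := exists_Zmod (ltnW e1).
move=> /(@R_cover_transport _ _ K); rewrite (card_K ZK) => /(_ cT)[Hs [H0 [sz gH lH dH cH]]].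
rewrite (card_K ZK) in sz.
apply: (@R_cover_transport _ ('Z_3 * K)%type).
  by rewrite card_prod card_ord (card_K ZK) cT' cT.
have z01 : (0 : 'Z_3) != 1 by []. have z02 : (0 : 'Z_3) != 1 + 1 by [].
have z12 : (1 : 'Z_3) != 1 + 1 by [].
have zi1 (i : 'Z_3) : i != i + 1 by rewrite -subr_eq0 opprD addrA subrr sub0r.
have zi2 (i : 'Z_3) : i != i + 1 + 1 by rewrite -subr_eq0 -addrA opprD addrA subrr sub0r.
pose L1 := map (@lev 'Z_3 K) Hs.
pose L2 := [seq AB q.1.1 (q.1.1 + 1) (q.1.1 + 1 + 1) (q.1.2.+1%:R) q.2
             | q : 'Z_3 * 'I_e * K <- enum {: 'Z_3 * 'I_e * K}].
pose TT p := fam (@pT K 'Z_3 0 1 (1 + 1) p).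
pose L3 := [seq TT (ppair K r).1 :|: TT (ppair K r).2 | r <- enum {: pair_idx e}].
pose X := @lev 'Z_3 K H0 :|: TT (plast e K).
have mT p : matching (TT p) := fam_matching z01 z02 z12 (pT_col _ _ _ _) (pT_inj _ _ _ _).
have lX : linear_hg X.
  apply: linearU; [exact: linear_lev | exact: matching_linear | ].
  move=> t t' x y tA t'T nxy xt yt xt' yt'; exfalso.
  have := fam_col_neq z01 z02 z12 (pT_col _ _ _ _) t'T xt' yt' nxy.
  by rewrite (lev_same tA xt yt) eqxx.
have dX x : (degr X x <= d + 1)%N.
  by apply: leq_trans (degrU _ _ _) _; rewrite leq_add ?degr_lev // matching_degr.
have good123 : {in L1 ++ L2 ++ L3, forall H, good H}.
  move=> H; rewrite !mem_cat => /or3P[]/mapP.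
  - by case=> A /gH gA ->; apply: good_lev.
  - case=> -[[a r] c] _ ->; apply: (AB_good ZK); rewrite ?zi1 ?zi2 //.
    by apply: (K_nat_neq0 ZK) => /=; case: r => r re /=; lia.
  - by case=> r _ ->; apply: T_good; rewrite // (ppair_compat ZK).
have covAB a b x y z : a != b -> x != y ->
    exists2 H, H \in L1 ++ L2 ++ L3 & tri (a, x) (a, y) (b, z) \in H.
  move=> ab xy; have [r [c h]] := A_mem ZK a b z xy.
  exists (AB b (b + 1) (b + 1 + 1) r.+1%:R c).
    rewrite !mem_cat; apply/orP; right; apply/orP; left; apply/mapP.
    by exists (b, r, c); rewrite // mem_enum.
  have [ea|ea] : b + 1 = a \/ b + 1 + 1 = a.
    by move: ab; case: a {h} => -[|[|[|]]] // ?; case: b => -[|[|[|]]] // ? _;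
       [right|left|left|right|right|left]; apply/val_inj.
    by rewrite in_setU ea h.
  by rewrite in_setU ea h orbT.
have cov (t : {set 'Z_3 * K}) : #|t| = 3%N ->
   t \in X \/ exists2 H, H \in L1 ++ L2 ++ L3 & t \in H.
  move=> t3; have [[a x] [[b y] [[c z] [tE xy xz yz /andP[/= ab bc]]]]] :=
    card3_sorted (fun p : 'Z_3 * K => nat_of_ord p.1) t3.
  case: (eqVneq a b) => [eab|nab]; case: (eqVneq b c) => [ebc|nbc].
  - have [|t' et t'3] := @level_triple _ _ t c _ t3.
      by move=> p; rewrite tE in_tri eab ebc => /or3P[]/eqP->.
    case: (cH t' t'3) => [t'H|[H HHs t'H]].
      by left; rewrite inE et lev_mem.
    by right; exists (lev _ H); rewrite ?et ?lev_mem // mem_cat map_f.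
  - right; rewrite tE eab; apply: covAB => //.
    by apply: contraNneq xy => ->; rewrite eab.
  - right; rewrite tE tri_rot ebc; apply: covAB; first by rewrite -ebc eq_sym.
    by apply: contraNneq yz => ->; rewrite ebc.
  - have [ea eb ec] : [/\ a = 0, b = 1 & c = 1 + 1].
      move: ab bc nab nbc; case: a {tE xy xz} => -[|[|[|]]] // ?; case: b {yz} => -[|[|[|]]] // ?;
      by case: c => -[|[|[|]]] // ? ? ? ? ?; split; apply/val_inj.
    have h := @T_mem K 'Z_3 0 1 (1 + 1) x y z; rewrite tE ea eb ec.
    case: (ppair_cover ZK (z - y, x - z)) => [ep|[r hr]].
      by left; rewrite inE /TT -ep h orbT.
    right; exists (TT (ppair K r).1 :|: TT (ppair K r).2).
      by rewrite !mem_cat; apply/orP; right; apply/orP; right; apply/mapP;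
        exists r; rewrite ?mem_enum.
    by case: hr => er; rewrite inE /TT -er h ?orbT.
have szL : size (L1 ++ L2 ++ L3) = (size Hs + (3 * e * e.*2.+1 + (e.*2.+1 * e + e)))%N.
  rewrite /L1 /L2 /L3 !size_cat !size_map -!enumT -!cardE.
  rewrite card_pair_idx !card_prod !card_ord (card_K ZK) //.
have cIK : #|{: 'Z_3 * K}| = (3 * e.*2.+1)%N by rewrite card_prod card_ord (card_K ZK).
case: d d1 sz dH dX => [|[|//]] _ sz dH dX.
  exists (L1 ++ L2 ++ L3), X; split=> //; rewrite szL cIK; nia.
exists (X :: L1 ++ L2 ++ L3), set0; split.
- rewrite /= szL cIK; nia.
- by move=> H; rewrite inE => /orP[/eqP->|/good123//]; split.
- by move=> t t' x y; rewrite inE.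
- by move=> x; rewrite leqn0; apply/degr0P=> t; rewrite inE.
- move=> t /cov[tX|[H HL tH]]; right; first by exists X; rewrite ?mem_head.
  by exists H; rewrite // inE HL orbT.
Qed.

(** * Tripling with a point at infinity *)

(** The first component is the level, the second one a third of that level. *)
Definition blk := ('Z_3 * 'Z_3)%type.

(* (l, p, q) stands for the blocks (l, l-p-q), (l+1, p), (l+2, q), the first being
   distinguished; (l, d, i, c) for the two blocks of level l other than (l, i), and block c
   of level l+1 or l+2. *)
Definition spec := ('Z_3 * 'Z_3 * 'Z_3)%type.
Definition plain := ('Z_3 * bool * 'Z_3 * 'Z_3)%type.

Definition blocks (s : spec + plain) : blk * blk * blk :=
  match s with
  | inl (l, p, q) => ((l, l - p - q), (l + 1, p), (l + 1 + 1, q))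
  | inr (l, d, i, c) => ((l, i + 1), (l, i + 1 + 1), (l + (if d then 1 + 1 else 1), c))
  end.

Definition bseq s := let: (i, j, k) := blocks s in [:: i; j; k].

Definition z3 : seq 'Z_3 := [:: 0; 1; 1 + 1].

Lemma mem_z3 x : x \in z3.
Proof. by case: x => -[|[|[|]]]. Qed.

Lemma z3_neq (x y : 'Z_3) : x != y -> y = x + 1 \/ y = x + 1 + 1.
Proof.
by case: x => -[|[|[|]]] // ?; case: y => -[|[|[|]]] // ? _;
  first [by left; apply/val_inj | by right; apply/val_inj].
Qed.

(** Explicit lists of the 27 distinguished and 54 plain block triples let statements about all of
    them be decided by computation. *)
Definition all_spec : seq spec := [seq (lp, q) | lp <- [seq (l, p) | l <- z3, p <- z3], q <- z3].
Definition all_plain : seq plain :=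
  [seq (ldi, c) | ldi <- [seq (ld, i) | ld <- [seq (l, d) | l <- z3, d <- [:: false; true]],
                                        i <- z3], c <- z3].

Lemma mem_all_spec t : t \in all_spec.
Proof. by case: t => [[l p] q]; do 2?[apply: allpairs_f => //]; exact: mem_z3. Qed.

Lemma mem_all_plain t : t \in all_plain.
Proof.
case: t => [[[l d] i] c]; do 3?[apply: allpairs_f => //]; try exact: mem_z3.
by case: d.
Qed.

Definition all_blk : seq blk := [seq (l, x) | l <- z3, x <- z3].

Lemma mem_all_blk b : b \in all_blk.
Proof. by case: b => l x; apply: allpairs_f; exact: mem_z3. Qed.

Lemma forall_spec (P : pred spec) : all P all_spec -> forall t, P t.
Proof. by move=> /allP h t; apply: h; exact: mem_all_spec. Qed.

Lemma forall_plain (P : pred plain) : all P all_plain -> forall t, P t.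
Proof. by move=> /allP h t; apply: h; exact: mem_all_plain. Qed.

Lemma blocks_uniq s : uniq (bseq s).
Proof.
case: s => t; first by move: t; apply: forall_spec; vm_compute.
by move: t; apply: forall_plain; vm_compute.
Qed.

Lemma blocks_neq s : [/\ (blocks s).1.1 != (blocks s).1.2, (blocks s).1.1 != (blocks s).2 &
   (blocks s).1.2 != (blocks s).2].
Proof.
have := blocks_uniq s; rewrite /bseq; case: (blocks s) => [[i j] k] /=.
by rewrite !inE negb_or andbT => /andP[/andP[]].
Qed.

Definition sp (l p q : nat) : spec := (l%:R, p%:R, q%:R).
Definition pl (l : nat) d (i c : nat) : plain := (l%:R, d, i%:R, c%:R).

(* The blocks carry 81 + 27 leftover matchings; they are distributed over 20 classes so that
   two of them in the same class share at most one block, or infinity and no other block. *)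
Definition extraS : seq (seq (seq plain)) :=
  [:: [:: [:: pl 1 false 2 1; pl 1 false 1 0; pl 2 true 1 1; pl 2 true 0 2];
    [:: pl 1 false 2 0; pl 2 true 0 0; pl 1 false 0 1; pl 2 true 1 2]];
   [:: [:: pl 0 true 2 2; pl 0 true 1 0; pl 2 false 2 1; pl 2 false 0 2];
    [:: pl 0 true 2 0; pl 2 false 0 0; pl 0 true 0 2; pl 2 false 2 2]];
   [:: [:: pl 0 false 1 1; pl 1 true 1 0; pl 0 false 0 2; pl 1 true 2 1];
    [:: pl 0 false 1 0; pl 1 true 0 0; pl 0 false 0 1; pl 1 true 1 1]]].

Definition extraI : seq (seq spec * seq spec * seq plain) :=
  [:: ([:: sp 1 0 2], [:: sp 1 2 0; sp 2 1 0; sp 1 1 2],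
     [:: pl 0 false 2 1; pl 2 true 1 0]);
   ([:: sp 2 1 2; sp 0 0 1], [::],
     [:: pl 0 true 2 1; pl 1 true 2 0; pl 2 false 1 2; pl 1 false 0 0]);
   ([:: sp 1 2 0; sp 2 2 2], [::],
     [:: pl 0 false 2 0; pl 2 false 1 1; pl 1 true 2 2; pl 2 true 2 1]);
   ([:: sp 0 1 1; sp 2 2 0], [:: sp 2 2 1],
     [:: pl 0 false 2 2; pl 2 false 2 0; pl 1 false 1 2]);
   ([:: sp 0 0 0; sp 0 1 2], [:: sp 0 1 1; sp 0 2 2],
     [:: pl 0 false 0 0; pl 2 true 2 2]);
   ([:: sp 1 1 0; sp 0 1 0], [:: sp 2 0 2; sp 2 1 2],
     [:: pl 0 true 0 1; pl 1 false 2 2]);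
   ([:: sp 0 2 1; sp 2 1 1], [:: sp 0 0 0; sp 1 2 2],
     [:: pl 2 false 0 1; pl 1 true 0 2]);
   ([:: sp 2 1 0; sp 1 2 2], [:: sp 0 1 2; sp 0 2 1; sp 2 1 1; sp 1 0 2],
     [::]);
   ([:: sp 1 0 1; sp 0 2 2], [:: sp 2 0 0; sp 2 0 1; sp 1 1 1; sp 0 1 0],
     [::]);
   ([:: sp 2 0 0; sp 1 1 1], [:: sp 1 0 0; sp 0 0 1],
     [:: pl 0 true 0 0; pl 1 false 0 2]);
   ([:: sp 1 2 1; sp 1 1 2], [:: sp 1 0 1],
     [:: pl 0 false 1 2; pl 2 false 1 0; pl 1 false 1 1]);
   ([:: sp 2 0 1; sp 0 2 0], [:: sp 1 2 1],
     [:: pl 0 true 1 2; pl 1 true 1 2; pl 2 true 2 0]);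
   ([:: sp 1 0 0; sp 2 2 1], [:: sp 1 1 0; sp 0 0 2; sp 0 2 0; sp 2 2 2],
     [::]);
   ([:: sp 2 0 2; sp 0 0 2], [:: sp 2 2 0],
     [:: pl 0 true 1 1; pl 1 true 0 1; pl 2 true 0 1])].

(** A leftover matching: [Inf t] is the unpaired orbit of type [pN], [Reg] that of type [pM] on a
    distinguished block triple or of type [pT] on a plain one. *)
Inductive piece := Inf of spec | Reg of spec + plain.

(** The sets of blocks that an edge can meet, with [None] for infinity. [Inf] has a second one
    because of its cut edge. *)
Definition traces p : seq (seq (option blk)) :=
  match p with
  | Reg s => [:: map Some (bseq s)]
  | Inf t => let: (i, j, k) := blocks (inl t) in
      [:: [:: Some i; Some j; Some k]; [:: None; Some j; Some k]]
  end.

(** The points of an edge lie in different blocks, so matchings whose traces share at most one entry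
    have no pair of points in common. *)
Definition conflict p q :=
  has (fun tr => has (fun tr' => 1 < count (mem tr) tr')%N (traces q)) (traces p).

Definition touches o p := has (fun tr => o \in tr) (traces p).

Definition ok_pieces l := pairwise (fun p q => ~~ conflict p q) l &&
  all (fun o => count (touches o) l <= 2)%N (None :: map Some all_blk).

Definition pieces (c : seq spec * seq spec * seq plain) : seq piece :=
  map Inf c.1.1 ++ map (fun t => Reg (inl t)) c.1.2 ++ map (fun s => Reg (inr s)) c.2.

Lemma extraI_ok : all (fun c => ok_pieces (pieces c)) extraI.
Proof. by vm_compute. Qed.

Definition extraS_at (l : 'Z_3) (b : bool) := nth [::] (nth [::] extraS l) b.

(** The pieces have to stay off level [l] because their class also contains a recursive hypergraph
    on that level and infinity. *)
Lemma extraS_ok l b : ok_pieces (pieces ([::], [::], extraS_at l b)) &&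
  all (fun s => all (fun x : blk => x.1 != l) (bseq (inr s))) (extraS_at l b).
Proof. by case: l => -[|[|[|]]] // ?; case: b; vm_compute. Qed.

Lemma extra_inf : all (fun t => has (fun c => t \in c.1.1) extraI) all_spec.
Proof. by vm_compute. Qed.

Lemma extra_spec : all (fun t => has (fun c => t \in c.1.2) extraI) all_spec.
Proof. by vm_compute. Qed.

Lemma extra_plain : all (fun t => has (fun c => t \in c.2) extraI ||
  has (fun l => has (fun b => t \in extraS_at l b) [:: false; true]) z3) all_plain.
Proof. by vm_compute. Qed.

Lemma conflictP p q tr tr' o o' : ~~ conflict p q -> tr \in traces p -> tr' \in traces q ->
  o != o' -> o \in tr -> o' \in tr -> o \in tr' -> o' \in tr' -> False.
Proof.
move=> /hasPn h trp /(hasPn (h _ trp)) nc noo ot o't ot' o't'; case/negP: nc.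
rewrite -size_filter; apply: (@uniq_leq_size _ [:: o; o']); first by rewrite /= inE noo.
by move=> x; rewrite !inE mem_filter => /orP[]/eqP->; rewrite ?inE ?ot ?o't.
Qed.

(** * The classes of the tripled cover *)

Section STriple.
Variables (e : nat) (K : finComNzRingType).
Hypotheses (ZK : is_Zmod e K) (e1 : (1 < e)%N).
Local Notation pt := (option (blk * K)).

Definition ob (x : pt) : option blk := omap fst x.

Definition pclass (p : piece) : {set {set pt}} :=
  match p with
  | Inf t => let: (i, j, k) := blocks (inl t) in fam (pN i j k (plast e K))
  | Reg (inl t) => let: (i, j, k) := blocks (inl t) in himg Some (fam (pM i j k (0 : K)))
  | Reg (inr s) => let: (i, j, k) := blocks (inr s) in himg Some (fam (pT i j k (plast e K)))
  end.

Lemma pclass_matching p : matching (pclass p).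
Proof.
case: p => [t|[t|s]]; rewrite /pclass.
- have := blocks_neq (inl t); case: (blocks (inl t)) => [[i j] k] [ij ik jk].
  cbn [fst snd] in ij, ik, jk.
  exact: (fam_matching ij ik jk (pN_col _ _ _ _) (pN_inj _ _ _ _)).
- have := blocks_neq (inl t); case: (blocks (inl t)) => [[i j] k] [ij ik jk].
  cbn [fst snd] in ij, ik, jk.
  apply: matching_himg; first exact: Some_inj.
  exact: (fam_matching ij ik jk (pM_col _ _ _ _) (pM_inj ZK _ _ _ _)).
- have := blocks_neq (inr s); case: (blocks (inr s)) => [[i j] k] [ij ik jk].
  cbn [fst snd] in ij, ik, jk.
  apply: matching_himg; first exact: Some_inj.
  exact: (fam_matching ij ik jk (pT_col _ _ _ _) (pT_inj _ _ _ _)).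
Qed.

Lemma pclass_trace p t : t \in pclass p ->
  (exists2 tr, tr \in traces p & forall x, x \in t -> ob x \in tr) /\
  (forall x y, x \in t -> y \in t -> x != y -> ob x != ob y).
Proof.
have reg i j k x y z : uniq [:: i; j; k] ->
   let t := Some @: tri (i, x) (j, y) (k, z) : {set pt} in
   (exists2 tr, tr \in [:: map Some [:: i; j; k]] & forall x, x \in t -> ob x \in tr) /\
   (forall x y, x \in t -> y \in t -> x != y -> ob x != ob y).
  move=> un; cbv zeta; rewrite himg_tri; split.
    exists (map Some [:: i; j; k]); first by rewrite mem_head.
    by move=> w; rewrite in_tri => /or3P[]/eqP->; rewrite !inE eqxx ?orbT.
  move: un; rewrite /= !inE negb_or andbT => /andP[/andP[ij ik] jk].
  by move=> w w'; rewrite !in_tri => /or3P[]/eqP-> /or3P[]/eqP->; rewrite ?eqxx // => _;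
     rewrite (inj_eq Some_inj) //= eq_sym.
case: p => [s|[s|s]]; rewrite /pclass /traces.
- have := blocks_uniq (inl s); rewrite /bseq; case: (blocks (inl s)) => [[i j] k] un.
  move=> /imsetP[b _ ->] /=.
  move: (un); rewrite /= !inE negb_or andbT => /andP[/andP[ij ik] jk].
  case: ifP => _; last first.
    have := reg i j k (b + (plast e K).1 + (plast e K).2) b (b + (plast e K).1) un.
    rewrite /= himg_tri => -[[tr ht hx] h2]; split; last exact: h2.
    by exists tr => //; move: ht; rewrite !inE => ->.
  split.
    exists [:: None; Some j; Some k]; first by rewrite !inE eqxx orbT.
    by move=> w; rewrite in_tri => /or3P[]/eqP->; rewrite !inE eqxx ?orbT.
  by move=> w w'; rewrite !in_tri => /or3P[]/eqP-> /or3P[]/eqP->; rewrite ?eqxx // => _;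
     rewrite (inj_eq Some_inj) //= eq_sym.
- have := blocks_uniq (inl s); rewrite /bseq; case: (blocks (inl s)) => [[i j] k] un.
  by move=> /imsetP[_ /imsetP[b _ ->] ->]; apply: reg.
- have := blocks_uniq (inr s); rewrite /bseq; case: (blocks (inr s)) => [[i j] k] un.
  by move=> /imsetP[_ /imsetP[b _ ->] ->]; apply: reg.
Qed.

Definition pcup l := \bigcup_(p <- l) pclass p.

Lemma pclass_degr p x : (degr (pclass p) x <= touches (ob x) p)%N.
Proof.
case: (boolP (touches _ _)) => [_|nt].
  exact: (matching_degr x (@pclass_matching p)).
rewrite leqn0; apply/degr0P=> t tp; apply/negP=> xt; case/negP: nt.
by have [[tr trp /(_ x xt) h] _] := pclass_trace tp; apply/hasP; exists tr.
Qed.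

Lemma pcup_degr l x : (degr (pcup l) x <= count (touches (ob x)) l)%N.
Proof.
rewrite /pcup; elim: l => [|p l IH]; first by rewrite big_nil leqn0; apply/degr0P=> t; rewrite inE.
by rewrite big_cons; apply: leq_trans (degrU _ _ _) (leq_add (pclass_degr p x) IH).
Qed.

Lemma mem_pcup l p t : List.In p l -> t \in pclass p -> t \in pcup l.
Proof.
rewrite /pcup; elim: l => //= q l IH [->|pl]; rewrite big_cons inE => h; first by rewrite h.
by rewrite IH ?orbT.
Qed.

Lemma pcupP l t : t \in pcup l -> exists2 p, List.In p l & t \in pclass p.
Proof.
rewrite /pcup; elim: l => [|q l IH]; first by rewrite big_nil inE.
rewrite big_cons inE => /orP[h|/IH[p pl tp]]; [exists q => //; by left | exists p => //; by right].
Qed.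

Lemma pcup_good l : ok_pieces l -> good (pcup l).
Proof.
case/andP=> pw /allP dg; split.
  move=> x; apply: leq_trans (pcup_degr l x) (dg (ob x) _).
  by case: (ob x) => [b|]; rewrite in_cons ?eqxx // map_f ?orbT // mem_all_blk.
elim: l pw {dg} => [_|p l IH /= /andP[ap /IH lin]].
  by move=> t t' x y; rewrite /pcup big_nil inE.
rewrite /pcup big_cons; apply: linearU lin _; first exact: matching_linear (@pclass_matching p).
move=> t t' x y tp /pcupP[q ql tq] nxy xt yt xt' yt'; exfalso.
have npq : ~~ conflict p q.
  by elim: l ap ql {IH} => //= r l IHl /andP[npr al] [<-//|]; exact: IHl.
have [[tr trp hx] ne] := pclass_trace tp; have [[tr' trq hx'] _] := pclass_trace tq.
exact: (conflictP npq trp trq (ne x y xt yt nxy) (hx x xt) (hx y yt) (hx' x xt') (hx' y yt')).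
Qed.

(** A block triple has (u^2 - 1)/2 = 2 e(e+1) pairs of transversal orbits. A distinguished one also
    has ue classes [AB] and e pairs of orbits [pM], which is the same number. Hence both are indexed
    by [fidx], whose Boolean splits them into halves that are used in different classes. *)
Definition hh := (e * e.+1)%N.
Definition fidx := (bool * 'I_hh)%type.
Definition sidx := ('I_e * K + 'I_e)%type.

Lemma card_fidx : #|{: fidx}| = (e.*2.+1 * e + e)%N.
Proof. by rewrite card_prod card_bool card_ord /hh; nia. Qed.

Lemma card_sidx : #|{: sidx}| = (e.*2.+1 * e + e)%N.
Proof. by rewrite card_sum card_prod !card_ord (card_K ZK) mulnC. Qed.

Variables (g : fidx -> pair_idx e) (g' : fidx -> sidx).
Hypotheses (gP : forall r, exists m, r = g m) (g'P : forall r, exists m, r = g' m).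

(** The classes that avoid infinity, leftovers aside. On a distinguished triple they take the
    triples with two points in [j] or in [k] and the transversal ones lost by cutting; on a plain
    triple they take all transversal triples. *)
Definition reg (s : spec + plain) (m : fidx) : {set {set pt}} :=
  let: (i, j, k) := blocks s in
  himg Some (match s with
    | inl _ => match g' m with
               | inl (r, c) => AB i j k (r.+1%:R) c
               | inr r => fam (pM i j k (r.*2.+1%:R)) :|: fam (pM i j k (r.*2.+2%:R))
               end
    | inr _ => fam (pT i j k (ppair K (g m)).1) :|: fam (pT i j k (ppair K (g m)).2)
    end).

Definition inf (t : spec) (m : fidx) : {set {set pt}} :=
  let: (i, j, k) := blocks (inl t) in
  fam (pN i j k (ppair K (g m)).1) :|: fam (pN i j k (ppair K (g m)).2).

Definition supp_in (H : {set {set pt}}) (s : seq (option blk)) :=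
  forall t x, t \in H -> x \in t -> ob x \in s.

Lemma good_supp_disj A B s s' : good A -> good B -> supp_in A s -> supp_in B s' ->
  ~~ has (mem s) s' -> good (A :|: B).
Proof.
move=> gA gB sA sB /hasPn h; apply: good_disjU => // t t' x tA t'B xt xt'.
by have /negP := h _ (sB _ _ t'B xt'); apply; exact: sA tA xt.
Qed.

Lemma supp_inU A B s s' : supp_in A s -> supp_in B s' -> supp_in (A :|: B) (s ++ s').
Proof.
move=> sA sB t x; rewrite in_setU mem_cat => /orP[tA|tB] xt; first by rewrite (sA _ _ tA xt).
by rewrite (sB _ _ tB xt) orbT.
Qed.

Lemma reg_good s m : good (reg s m).
Proof.
rewrite /reg; have := blocks_neq s; case: (blocks s) => [[i j] k] [ij ik jk].
cbn [fst snd] in ij, ik, jk; apply: good_himg; first exact: Some_inj.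
case: s => [t|t]; last by apply: T_good => //; exact: (ppair_compat ZK).
case: (g' m) => [[r c]|r].
  by apply: (AB_good ZK) => //; apply: (K_nat_neq0 ZK); have := ltn_ord r; lia.
apply: (M_good ZK) => //; rewrite -subr_eq0.
rewrite (_ : _ - _ = - 1%:R) ?oppr_eq0 ?(K_nat_neq0 ZK) //; first lia.
by rewrite -(addn1 r.*2.+1) natrD; ring.
Qed.

Lemma reg_supp s m : supp_in (reg s m) (map Some (bseq s)).
Proof.
rewrite /reg /bseq; have := blocks_neq s; case: (blocks s) => [[i j] k] [ij ik jk] t x.
cbn [fst snd] in ij, ik, jk.
move=> /himgP h /h[t' [y [t'H _ -> yt']]] {h}.
rewrite -[ob _]/(Some y.1) mem_map; last exact: Some_inj.
have sA a b d c : t' \in fam (pA (K := K) a b d c) -> y.1 = a \/ y.1 = b.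
  move=> /imsetP[z _ et]; move: yt'; rewrite et in_tri => /or3P[]/eqP->; by [left|right].
have key : forall p, colored fst i j k p -> t' \in fam p -> y.1 \in [:: i; j; k].
  by move=> B p cp t'p; exact: fam_col cp t'p yt'.
case: s t'H => [s|s].
  case: (g' m) => [[r c]|r]; rewrite /AB in_setU => /orP[h|h].
  - by case: (sA _ _ _ _ h) => ->; rewrite !inE eqxx ?orbT.
  - by case: (sA _ _ _ _ h) => ->; rewrite !inE eqxx ?orbT.
  - exact: key (pM_col _ _ _ _) h.
  - exact: key (pM_col _ _ _ _) h.
by rewrite in_setU => /orP[h|h]; exact: key (pT_col _ _ _ _) h.
Qed.

Lemma inf_good t m : good (inf t m).
Proof.
rewrite /inf; have := blocks_neq (inl t); case: (blocks (inl t)) => [[i j] k] [ij ik jk].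
by apply: N_good => //; exact: (ppair_compat ZK).
Qed.

Lemma inf_supp t m : supp_in (inf t m) (None :: map Some (bseq (inl t))).
Proof.
rewrite /inf /bseq; case: (blocks (inl t)) => [[i j] k] t' x.
by rewrite in_setU => /orP[]/imsetP[b _ ->]; rewrite in_tri => /or3P[]/eqP->;
   rewrite /=; try case: ifP; rewrite !inE !eqxx ?orbT.
Qed.

Definition phi (l : 'Z_3) (y : option ('Z_3 * K)) : pt := omap (fun y => ((l, y.1), y.2)) y.

Lemma phi_inj l : injective (phi l).
Proof. by move=> [[x b]|] [[x' b']|] //= [-> ->]. Qed.

(** 9 e(e+1) + 2 is the number of classes of the recursive cover on 3(2e+1) + 1 points, a level and
    infinity. The two surplus ones are completed by leftovers. *)
Definition JS := ('Z_3 * 'Z_3 * 'I_hh + bool)%type.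
Variable HS : JS -> {set {set option ('Z_3 * K)}}.
Hypotheses (gHS : forall s, good (HS s)).
Hypothesis (cHS : forall t : {set option ('Z_3 * K)}, #|t| = 3%N -> exists s, t \in HS s).

(** Besides level [l] and infinity, six blocks are free. Two blocks of each of the other levels join
    the odd block of the opposite level, [i] in level l+1 and [c] in level l+2, to form two disjoint
    plain triples. *)
Definition cls1 (q : 'Z_3 * JS) : {set {set pt}} :=
  let: (l, s) := q in
  himg (phi l) (HS s) :|:
  match s with
  | inl (i, c, m) => reg (inr (l + 1, false, i, c)) (false, m) :|:
                     reg (inr (l + 1 + 1, true, c, i)) (false, m)
  | inr b => pcup (pieces ([::], [::], extraS_at l b))
  end.

(** The class [inf] uses one block of each level and infinity. The other six blocks split into two
    plain triples or into two distinguished ones with the same [l]. The plain classes used here are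
    the half [true], while [cls1] uses the half [false]. *)
Definition cls2 (q : spec * bool * 'I_hh) : {set {set pt}} :=
  let: (l, p, q, b, m) := q in
  inf (l, p, q) (b, m) :|:
  if b then reg (inr (l, false, l - p - q, p + 1)) (true, m) :|:
            reg (inr (l + 1 + 1, true, q, p + 1 + 1)) (true, m)
  else reg (inl (l, p + 1, q + 1)) (false, m) :|:
       reg (inl (l, p + 1 + 1, q + 1 + 1)) (true, m).

Definition lblk (l : 'Z_3) := None :: [seq Some (l, x) | x <- z3].

Lemma lev_supp l s : supp_in (himg (phi l) (HS s)) (lblk l).
Proof.
move=> t x /himgP h /h[t' [[[y b]|] [_ _ -> _]]]; rewrite /lblk /phi /= in_cons //.
by rewrite -[_ || _]/(Some (l, y) \in None :: [seq Some (l, x) | x <- z3]) in_cons map_f ?mem_z3.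
Qed.

Lemma cls1_good q : good (cls1 q).
Proof.
case: q => l [[[i c] m]|b] /=.
  have := @forall_spec (fun t : spec => let: (l, i, c) := t in
    ~~ has (mem (map Some (bseq (inr (l + 1, false, i, c)))))
       (map Some (bseq (inr (l + 1 + 1, true, c, i)))) &&
    ~~ has (mem (lblk l)) (map Some (bseq (inr (l + 1, false, i, c))) ++
       map Some (bseq (inr (l + 1 + 1, true, c, i))))).
  move=> /(_ _ (l, i, c))/andP[|h1 h2]; first by vm_compute.
  apply: good_supp_disj h2; first [exact: lev_supp | apply: supp_inU; exact: reg_supp | idtac].
    by apply: good_himg; first exact: phi_inj.
  by apply: good_supp_disj h1; first [exact: reg_good | exact: reg_supp].
have /andP[ok /allP av] := extraS_ok l b.
apply: good_disjU; first by apply: good_himg; first exact: phi_inj.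
  exact: pcup_good.
move=> t t' x /lev_supp h /pcupP[p pin t'p] /h{h} hx xt'.
have [[tr trp /(_ x xt') htr] _] := pclass_trace t'p.
have {pin} [s sin ep] : exists2 s, s \in extraS_at l b & p = Reg (inr s).
  elim: (extraS_at l b) pin => //= s r IH [<-|/IH[s' s'r ->]].
    by exists s; rewrite ?mem_head.
  by exists s'; rewrite // in_cons s'r orbT.
move: trp htr; rewrite ep /= mem_seq1 => /eqP-> /mapP[y ys ey].
have := av s sin => /allP/(_ y ys); apply/negP; rewrite negbK.
by move: hx; rewrite ey /lblk in_cons => /orP[//|/mapP[z _ [->]]].
Qed.

Lemma cls2_good q : good (cls2 q).
Proof.
case: q => [[[[l p] q] []] m] /=.
  have := @forall_spec (fun t : spec => let: (l, p, q) := t in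
    ~~ has (mem (map Some (bseq (inr (l, false, l - p - q, p + 1)))))
       (map Some (bseq (inr (l + 1 + 1, true, q, p + 1 + 1)))) &&
    ~~ has (mem (None :: map Some (bseq (inl (l, p, q)))))
       (map Some (bseq (inr (l, false, l - p - q, p + 1))) ++
        map Some (bseq (inr (l + 1 + 1, true, q, p + 1 + 1))))).
  move=> /(_ _ (l, p, q))/andP[|h1 h2]; first by vm_compute.
  apply: good_supp_disj h2; first [exact: inf_good | exact: inf_supp |
    apply: supp_inU; exact: reg_supp | idtac].
  by apply: good_supp_disj h1; first [exact: reg_good | exact: reg_supp].
have := @forall_spec (fun t : spec => let: (l, p, q) := t in
    ~~ has (mem (map Some (bseq (inl (l, p + 1, q + 1)))))
       (map Some (bseq (inl (l, p + 1 + 1, q + 1 + 1)))) &&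
    ~~ has (mem (None :: map Some (bseq (inl (l, p, q)))))
       (map Some (bseq (inl (l, p + 1, q + 1))) ++
        map Some (bseq (inl (l, p + 1 + 1, q + 1 + 1))))).
move=> /(_ _ (l, p, q))/andP[|h1 h2]; first by vm_compute.
apply: good_supp_disj h2; first [exact: inf_good | exact: inf_supp |
  apply: supp_inU; exact: reg_supp | idtac].
by apply: good_supp_disj h1; first [exact: reg_good | exact: reg_supp].
Qed.

(** * All triples are covered *)

Definition covd (t : {set pt}) :=
  [\/ exists q, t \in cls1 q, exists q, t \in cls2 q |
      exists2 c, c \in extraI & t \in pcup (pieces c)].

(** The parametrizations of [cls1] and [cls2] are inverted: the kind of block triple, its direction
    [d] and the half of the index determine where a regular class occurs. *)
Lemma cov_reg s m t : t \in reg s m -> covd t.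
Proof.
case: s m => [[[l p] q]|[[[l d] i] c]] [b m] h.
  constructor 2; case: b h => h.
    exists (l, p - 1 - 1, q - 1 - 1, false, m).
    by rewrite /cls2 !in_setU !subrK h !orbT.
  exists (l, p - 1, q - 1, false, m).
  by rewrite /cls2 !in_setU !subrK h !orbT.
case: b h => h; [constructor 2|constructor 1].
  case: d h => h.
    exists (l - 1 - 1, c - 1 - 1, i, true, m).
    by rewrite /cls2 !in_setU !subrK h !orbT.
  exists (l, c - 1, l - (c - 1) - i, true, m).
  by rewrite /cls2 !in_setU subKr subrK h !orbT.
case: d h => h.
  exists (l - 1 - 1, inl (c, i, m)).
  by rewrite /cls1 !in_setU !subrK h !orbT.
exists (l - 1, inl (i, c, m)).
by rewrite /cls1 !in_setU !subrK h !orbT.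
Qed.

Lemma cov_inf s m t : t \in inf s m -> covd t.
Proof.
by case: s m => [[l p] q] [b m] h; constructor 2; exists (l, p, q, b, m); rewrite /cls2 in_setU h.
Qed.

Lemma In_pieces c p :
  (exists2 t, t \in c.1.1 & p = Inf t) \/ (exists2 t, t \in c.1.2 & p = Reg (inl t)) \/
  (exists2 s, s \in c.2 & p = Reg (inr s)) -> List.In p (pieces c).
Proof.
have in_cat (s1 s2 : seq piece) : List.In p s1 \/ List.In p s2 -> List.In p (s1 ++ s2).
  elim: s1 => [|q s1 IH] /=; first by case.
  by case=> [[->|h]|h]; [left | right; apply: IH; left | right; apply: IH; right].
have in_map (A : eqType) (f : A -> piece) (s : seq A) x : x \in s -> List.In (f x) (map f s).
  by elim: s => //= y s IH; rewrite in_cons => /orP[/eqP->|/IH]; [left | right].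
case: c => [[c1 c2] c3] /= h; apply: (in_cat).
case: h => [[t tc ->]|h]; [by left; apply: in_map | right; apply: (in_cat)].
case: h => [[t tc ->]|[t tc ->]]; first by left; apply: (in_map _ (fun t => Reg (inl t))).
by right; apply: (in_map _ (fun s => Reg (inr s))).
Qed.

Lemma cov_pinf s t : t \in pclass (Inf s) -> covd t.
Proof.
move=> h; constructor 3; have /hasP[c cI sc] := forall_spec extra_inf s; exists c => //.
by apply: mem_pcup h; apply: In_pieces; left; exists s.
Qed.

Lemma cov_preg s t : t \in pclass (Reg s) -> covd t.
Proof.
case: s => s h.
  constructor 3; have /hasP[c cI sc] := forall_spec extra_spec s; exists c => //.
  by apply: mem_pcup h; apply: In_pieces; right; left; exists s.
have /orP[/hasP[c cI sc]|/hasP[l _ /hasP[b _ sb]]] := forall_plain extra_plain s.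
  constructor 3; exists c => //.
  by apply: mem_pcup h; apply: In_pieces; right; right; exists s.
constructor 1; exists (l, inr b); rewrite /cls1 in_setU; apply/orP; right.
by apply: mem_pcup h; apply: In_pieces; right; right; exists s.
Qed.

Definition P (b : blk) (x : K) : pt := Some (b, x).

Lemma cov_plain (s : plain) x y z :
  covd (tri (P (blocks (inr s)).1.1 x) (P (blocks (inr s)).1.2 y) (P (blocks (inr s)).2 z)).
Proof.
rewrite /P -himg_tri.
have hr m : reg (inr s) m = himg Some
   (fam (pT (blocks (inr s)).1.1 (blocks (inr s)).1.2 (blocks (inr s)).2 (ppair K (g m)).1) :|:
    fam (pT (blocks (inr s)).1.1 (blocks (inr s)).1.2 (blocks (inr s)).2 (ppair K (g m)).2)).
  by rewrite /reg; case: (blocks (inr s)) => [[i j] k].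
have hp : pclass (Reg (inr s)) = himg Some
   (fam (pT (blocks (inr s)).1.1 (blocks (inr s)).1.2 (blocks (inr s)).2 (plast e K))).
  by rewrite /pclass; case: (blocks (inr s)) => [[i j] k].
have := T_mem (blocks (inr s)).1.1 (blocks (inr s)).1.2 (blocks (inr s)).2 x y z.
case: (ppair_cover ZK (z - y, x - z)) => [->|[r hr']] h.
  by apply: (@cov_preg (inr s)); rewrite hp mem_himg //; exact: Some_inj.
have [m em] := gP r; apply: (@cov_reg (inr s) m); rewrite hr mem_himg; last exact: Some_inj.
by rewrite in_setU -em; case: hr' => <-; rewrite h ?orbT.
Qed.

Lemma cov_spec (s : spec) x y z :
  covd (tri (P (blocks (inl s)).1.1 x) (P (blocks (inl s)).1.2 y) (P (blocks (inl s)).2 z)).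
Proof.
pose i := (blocks (inl s)).1.1; pose j := (blocks (inl s)).1.2; pose k := (blocks (inl s)).2.
rewrite -/i -/j -/k; case: (eqVneq x (y + z)) => [ex|nx].
  rewrite /P -himg_tri; have h := M_mem i j k ex.
  have hp : pclass (Reg (inl s)) = himg Some (fam (pM i j k 0)).
    by rewrite /pclass /i /j /k; case: (blocks (inl s)) => [[? ?] ?].
  have [m mu em] := K_natP ZK (z - y); rewrite em in h.
  case: m mu h {em} => [|m] mu h.
    by apply: (@cov_preg (inl s)); rewrite hp mem_himg //; exact: Some_inj.
  have re : (m./2 < e)%N by lia.
  have [f ef] := g'P (inr (Ordinal re)).
  apply: (@cov_reg (inl s) f).
  have -> : reg (inl s) f =
      himg Some (fam (pM i j k m./2.*2.+1%:R) :|: fam (pM i j k m./2.*2.+2%:R)).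
    by rewrite /reg -ef /i /j /k; case: (blocks (inl s)) => [[? ?] ?].
  rewrite mem_himg; last exact: Some_inj.
  rewrite in_setU; case: (boolP (odd m)) => om.
    by rewrite (_ : m./2.*2.+2 = m.+1) ?h ?orbT //; lia.
  by rewrite (_ : m./2.*2.+1 = m.+1) ?h //; lia.
have h := N_mem i j k nx.
have hp : pclass (Inf s) = fam (pN i j k (plast e K)).
  by rewrite /pclass /i /j /k; case: (blocks (inl s)) => [[? ?] ?].
have hr m : inf s m = fam (pN i j k (ppair K (g m)).1) :|: fam (pN i j k (ppair K (g m)).2).
  by rewrite /inf /i /j /k; case: (blocks (inl s)) => [[? ?] ?].
case: (ppair_cover ZK (z - y, x - z)) h => [->|[r hr']] h.
  by apply: (@cov_pinf s); rewrite hp.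
have [m em] := gP r; apply: (@cov_inf s m); rewrite hr.
by rewrite in_setU -em; case: hr' => <-; rewrite h ?orbT.
Qed.

Lemma cov_infty (s : spec) y z :
  covd (tri None (P (blocks (inl s)).1.2 y) (P (blocks (inl s)).2 z)).
Proof.
pose i := (blocks (inl s)).1.1; pose j := (blocks (inl s)).1.2; pose k := (blocks (inl s)).2.
rewrite -/j -/k; have h := N_mem_infty i j k y z.
have hp : pclass (Inf s) = fam (pN i j k (plast e K)).
  by rewrite /pclass /i /j /k; case: (blocks (inl s)) => [[? ?] ?].
have hr m : inf s m = fam (pN i j k (ppair K (g m)).1) :|: fam (pN i j k (ppair K (g m)).2).
  by rewrite /inf /i /j /k; case: (blocks (inl s)) => [[? ?] ?].
case: (ppair_cover ZK (z - y, y)) h => [->|[r hr']] h.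
  by apply: (@cov_pinf s); rewrite hp.
have [m em] := gP r; apply: (@cov_inf s m); rewrite hr.
by rewrite in_setU -em; case: hr' => <-; rewrite h ?orbT.
Qed.

Lemma cov_AB (s : spec) (b : bool) x y z : x != y ->
  let a := if b then (blocks (inl s)).1.2 else (blocks (inl s)).2 in
  covd (tri (P a x) (P a y) (P (blocks (inl s)).1.1 z)).
Proof.
move=> xy a; have [r [c h]] := A_mem ZK a (blocks (inl s)).1.1 z xy.
have [f ef] := g'P (inl (r, c)).
rewrite /P -himg_tri; apply: (@cov_reg (inl s) f).
have -> : reg (inl s) f = himg Some (AB (blocks (inl s)).1.1
    (blocks (inl s)).1.2 (blocks (inl s)).2 (r.+1%:R) c).
  by rewrite /reg -ef; case: (blocks (inl s)) => [[? ?] ?].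
rewrite mem_himg; last exact: Some_inj.
by rewrite /AB in_setU; move: h; rewrite /a; case: b {a} => ->; rewrite ?orbT.
Qed.

Lemma cov_level l (t : {set pt}) : (forall b x, P b x \in t -> b.1 = l) -> #|t| = 3%N -> covd t.
Proof.
move=> h t3; have [|t' et t'3] := preim_triple (@phi_inj l) _ t3.
  move=> [[[l' a] x]|] xt; last by exists None.
  by exists (Some (a, x)); rewrite /phi /= -(h _ _ xt).
have [s ts] := cHS t'3; constructor 1; exists (l, s).
by rewrite /cls1 in_setU et mem_himg ?ts //; exact: phi_inj.
Qed.

(** Two points of one block require the distinguished triple whose special block contains the third
    point, filled by [AB]; points of two blocks of a level give a plain triple. *)
Lemma cov_two_levels l l' a1 a2 c x y z : l != l' -> P (l, a1) x != P (l, a2) y ->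
  covd (tri (P (l, a1) x) (P (l, a2) y) (P (l', c) z)).
Proof.
move=> ll; case: (eqVneq a1 a2) => [<-|aa] nxy.
  have {}nxy : x != y by apply: contraNneq nxy => ->.
  rewrite eq_sym in ll; case: (z3_neq ll) => ->.
    by have := @cov_AB (l', a1, l' - a1 - c) true x y z nxy; rewrite /= subKr.
  have := @cov_AB (l', l' - a1 - c, a1) false x y z nxy.
  by rewrite /= (_ : l' - (l' - a1 - c) - a1 = c) //; ring.
have [d hd] : exists d : bool, l' = l + (if d then 1 + 1 else 1).
  by case: (z3_neq ll) => ->; [exists false | exists true; rewrite addrA].
case: (z3_neq aa) => ea.
  by have := @cov_plain (l, d, a1 - 1, c) x y z; rewrite /= !subrK -hd -ea.
have e2 : a1 = a2 + 1 by rewrite ea; move: (a1) => -[[|[|[|]]] ?] //; apply/val_inj.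
by have := @cov_plain (l, d, a2 - 1, c) y x z; rewrite /= !subrK -hd -e2 tri_rot tri_swap.
Qed.

(** In a distinguished triple the labels l-p-q, p, q add up to [l], so the sum a + b + c tells which
    level is the special one. *)
Lemma cov_three_levels a b c x y z : covd (tri (P (0, a) x) (P (1, b) y) (P (1 + 1, c) z)).
Proof.
have z111 : 1 + 1 + 1 = 0 :> 'Z_3 by apply/val_inj.
have := mem_z3 (a + b + c); rewrite !inE => /or3P[]/eqP h.
- have := @cov_spec (0, b, c) x y z; rewrite /= !add0r.
  by rewrite (_ : - b - c = a) //; rewrite -[LHS]addr0 -h; ring.
- have := @cov_spec (1, c, a) y z x; rewrite /= (_ : 1 - c - a = b); last by rewrite -h; ring.
  by rewrite z111 -tri_rot.
- have := @cov_spec (1 + 1, a, b) z x y; rewrite (tri_rot (P (0, a) x)) (tri_rot (P (1, b) y)).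
  rewrite /= (_ : 1 + 1 - a - b = c); last by rewrite -h; ring.
  by rewrite z111 add0r.
Qed.

(** The special block lies on the third level, and the labels of the two given blocks serve as its
    parameters. *)
Lemma cov_infty_levels l l' a c x z : l != l' -> covd (tri None (P (l, a) x) (P (l', c) z)).
Proof.
move=> ll; case: (z3_neq ll) => ->.
  by have := @cov_infty (l - 1, a, c) x z; rewrite /= !subrK.
have := @cov_infty (l + 1, c, a) z x; rewrite /= tri_swap.
by rewrite (_ : l + 1 + 1 + 1 = l) //; case: l {ll} => -[|[|[|]]] // ?; apply/val_inj.
Qed.

Lemma cov_all (t : {set pt}) : #|t| = 3%N -> covd t.
Proof.
move=> t3.
(* Infinity has key 0, below all levels, so only the first of the sorted points can be infinity. *)
have [x [y [z [tE xy xz yz /andP[lxy lyz]]]]] :=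
  card3_sorted (fun x : pt => if x is Some (b, _) then (nat_of_ord b.1).+1 else 0%N) t3.
case: y tE xy yz lxy lyz => [[[l2 a2] y]|] tE xy yz; last first.
  by case: x tE xy xz => [[b x]|].
case: z tE xz yz => [[[l3 a3] z]|] tE xz yz // lxy lyz.
case: x tE xy xz lxy => [[[l1 a1] x]|] tE xy xz lxy; last first.
  case: (eqVneq l2 l3) => [e23|n23]; last by rewrite tE; apply: cov_infty_levels.
  apply: (@cov_level l2) => // b w; rewrite tE in_tri => /or3P[]/eqP// [-> _] //=.
case: (eqVneq l1 l2) => [e12|n12]; case: (eqVneq l2 l3) => [e23|n23].
- apply: (@cov_level l2) => // b w; rewrite tE in_tri => /or3P[]/eqP[-> _] //=.
- by rewrite e12 in tE xy; rewrite tE; apply: cov_two_levels.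
- rewrite tE tri_rot -e23; apply: cov_two_levels; first by rewrite eq_sym.
  by rewrite -e23 in yz.
have [ea eb ec] : [/\ l1 = 0, l2 = 1 & l3 = 1 + 1].
  move: lxy lyz n12 n23; case: l1 {tE xy xz} => -[|[|[|]]] // ?; case: l2 {yz} => -[|[|[|]]] // ?;
  by case: l3 => -[|[|[|]]] // ? ? ? ? ?; split; apply/val_inj.
by rewrite tE ea eb ec; exact: cov_three_levels.
Qed.
End STriple.

(** With h = e(e+1) the cover needs 81h + 20 classes on 9u + 1 points: [cls1] gives 3(9h + 2),
    [cls2] gives 54h, and the table [extraI] the last 14. *)
Lemma S_cover_triple n e : n = (3 * e.*2.+1)%N -> (1 < e)%N -> S_cover n -> S_cover (3 * n).
Proof.
move=> nE e1 Sn; have [K ZK] := exists_Zmod (ltnW e1).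
have c3 : #|'Z_3| = 3%N by rewrite card_ord.
have [g _ gP] := card_eq_bij (etrans (card_fidx e1) (esym (card_pair_idx e))).
have [g' _ g'P] := card_eq_bij (etrans (card_fidx e1) (esym (card_sidx ZK))).
have cov0 : triple_cover (option ('Z_3 * K)) ((n ^ 2 - 1) %/ 4).
  by apply: cover_transport Sn; rewrite card_option card_prod !card_ord (card_K ZK) nE.
have cJ : #|{: JS e}| = ((n ^ 2 - 1) %/ 4)%N.
  rewrite card_sum !card_prod c3 card_ord card_bool /hh nE.
  rewrite (_ : ((3 * e.*2.+1) ^ 2 - 1)%N = ((9 * (e * e.+1) + 2) * 4)%N).
    by rewrite mulnK.
  by rewrite -muln2; nia.
have [HS [gHS cHS]] := fam_of_cover cov0 cJ.
apply: (@cover_transport (option (blk * K))).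
  by rewrite card_option !card_prod c3 card_ord (card_K ZK) nE; lia.
pose H (j : 'Z_3 * JS e + spec * bool * 'I_(hh e) + 'I_14) :=
  match j with
  | inl (inl q) => cls1 g g' HS q
  | inl (inr q) => cls2 g g' q
  | inr r => pcup e K (pieces (nth ([::], [::], [::]) extraI r))
  end.
apply: (@cover_of_fam _ _ H).
- rewrite !(card_sum, card_prod) c3 !card_ord card_bool /hh nE.
  rewrite (_ : ((3 * (3 * e.*2.+1)) ^ 2 - 1)%N = ((81 * (e * e.+1) + 20) * 4)%N).
    by rewrite mulnK //; lia.
  by rewrite -muln2; nia.
- case=> [[q|q]|r]; rewrite /H; [exact: cls1_good | exact: cls2_good |].
  apply: (pcup_good ZK); apply: (allP extraI_ok); apply: mem_nth; exact: ltn_ord r.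
- move=> t /(cov_all ZK e1 gP g'P cHS)[[q h]|[q h]|[c cI h]].
  + by exists (inl (inl q)).
  + by exists (inl (inr q)).
  + have ic : (index c extraI < 14)%N by rewrite -[X in (_ < X)%N]/(size extraI) index_mem.
    by exists (inr (Ordinal ic)); rewrite /H /= nth_index.
Qed.

Local Close Scope ring_scope.

(** * Initial covers *)

(* Each class is a flat list of triples.  Where the first class of S_data is given separately,
   it is invariant under the translation by (n + 1) / 2. *)

Definition S_data9 := full 10 [:: [:: 0; 1; 3; 1; 4; 6; 2; 4; 5; 2; 8; 9; 3; 7; 9; 5; 6; 7]; [::
0; 4; 7; 0; 5; 9; 1; 3; 6; 2; 3; 9; 2; 7; 8; 4; 6; 8]].
Lemma S_cover9 : S_cover 9.
Proof. by apply: (@S_cover_data _ S_data9); vm_cast_no_check (erefl true). Qed.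

Definition S_data21 := full 22 (flatten [seq multiples 22 3 5 F | F <- [:: [:: 0; 5; 13; 0; 10;
11; 1; 9; 11; 1; 12; 17; 2; 7; 21; 2; 9; 18; 3; 7; 19; 3; 8; 13; 4; 6; 21; 4; 14; 20; 5; 8; 15;
10; 19; 20; 14; 16; 17; 15; 16; 18]]]).
Lemma S_cover21 : S_cover 21.
Proof. by apply: (@S_cover_data _ S_data21); vm_cast_no_check (erefl true). Qed.

Definition S_data27 := (14, chop [:: 0; 3; 13; 1; 18; 23; 1; 19; 25; 2; 8; 26; 2; 10; 12; 3; 6;
7; 4; 9; 15; 4; 22; 25; 5; 11; 15; 5; 20; 24; 6; 10; 19; 7; 9; 13; 8; 11; 18; 12; 16; 22; 14;
17; 27; 16; 24; 26; 17; 20; 21; 21; 23; 27]) :: full 28 [:: [:: 0; 5; 18; 0; 12; 14; 1; 2; 6; 1;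
11; 22; 2; 3; 17; 3; 11; 15; 4; 6; 15; 4; 9; 18; 5; 21; 26; 7; 16; 27; 7; 23; 24; 8; 13; 25; 8;
16; 19; 9; 13; 14; 10; 12; 24; 10; 22; 27; 17; 19; 25; 20; 23; 26]; [:: 0; 8; 15; 0; 18; 25; 1;
6; 26; 1; 10; 12; 2; 9; 24; 2; 23; 26; 3; 10; 19; 3; 15; 16; 4; 8; 13; 4; 11; 22; 5; 14; 17; 5;
20; 22; 7; 14; 16; 7; 19; 27; 9; 21; 27; 11; 13; 23; 12; 20; 21; 17; 18; 24]; [:: 0; 2; 7; 0;
10; 24; 1; 9; 26; 1; 19; 24; 2; 15; 27; 3; 7; 21; 3; 15; 25; 4; 8; 23; 4; 11; 18; 5; 6; 16; 5;
8; 22; 6; 21; 26; 9; 14; 18; 10; 13; 19; 11; 12; 20; 12; 16; 27; 13; 17; 25; 17; 20; 22]; [:: 0;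
5; 6; 0; 22; 26; 1; 4; 15; 1; 7; 23; 2; 8; 9; 2; 19; 25; 3; 9; 23; 3; 17; 18; 4; 16; 20; 5; 13;
27; 6; 13; 18; 7; 16; 26; 8; 12; 25; 10; 14; 17; 10; 20; 21; 11; 19; 24; 12; 21; 22; 14; 24;
27]; [:: 0; 1; 17; 0; 12; 25; 1; 25; 26; 2; 12; 22; 2; 13; 19; 3; 9; 24; 3; 21; 23; 4; 6; 7; 4;
18; 27; 5; 6; 13; 5; 20; 21; 7; 20; 27; 8; 14; 23; 9; 10; 15; 10; 16; 18; 11; 24; 26; 14; 19;
22; 15; 16; 17]; [:: 0; 18; 19; 0; 25; 26; 1; 17; 27; 1; 20; 26; 2; 4; 11; 2; 5; 14; 3; 14; 23;
3; 15; 24; 4; 9; 19; 5; 10; 12; 6; 7; 27; 6; 8; 10; 7; 16; 22; 11; 15; 22; 12; 23; 25; 13; 17;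
21; 13; 20; 24; 16; 18; 21]].
Lemma S_cover27 : S_cover 27.
Proof. by apply: (@S_cover_data _ S_data27); vm_cast_no_check (erefl true). Qed.

Definition S_data33 := full 34 [:: [:: 0; 7; 16; 0; 14; 24; 1; 3; 28; 1; 12; 22; 2; 3; 27; 2;
10; 26; 4; 9; 19; 4; 10; 29; 5; 11; 25; 5; 19; 26; 6; 21; 25; 7; 9; 13; 8; 15; 27; 8; 30; 32;
11; 17; 29; 12; 15; 33; 13; 18; 22; 14; 23; 31; 16; 20; 32; 17; 18; 33; 21; 24; 31; 23; 28; 30];
[:: 0; 5; 20; 0; 10; 17; 1; 2; 30; 1; 19; 33; 2; 4; 5; 3; 11; 18; 3; 23; 25; 4; 14; 15; 6; 7; 8;
6; 13; 29; 7; 12; 18; 8; 22; 30; 9; 13; 31; 9; 20; 32; 10; 15; 26; 11; 12; 33; 14; 16; 27; 16;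
21; 29; 17; 24; 25; 21; 27; 32; 22; 23; 28; 26; 28; 31]; [:: 0; 3; 27; 0; 21; 32; 1; 13; 22; 1;
15; 24; 2; 11; 13; 2; 23; 31; 3; 5; 22; 4; 8; 16; 4; 24; 28; 5; 9; 29; 6; 10; 29; 6; 30; 31; 7;
9; 15; 7; 20; 21; 8; 11; 33; 10; 16; 17; 12; 20; 28; 14; 17; 18; 14; 25; 33; 18; 23; 30; 19; 25;
27; 19; 26; 32]; [:: 0; 14; 29; 0; 18; 33; 1; 6; 31; 1; 25; 27; 2; 3; 5; 2; 16; 17; 3; 4; 15; 4;
10; 28; 5; 6; 23; 7; 21; 24; 7; 26; 27; 8; 11; 13; 8; 19; 22; 9; 26; 32; 10; 19; 23; 11; 12; 18;
12; 24; 29; 13; 14; 17; 15; 30; 33; 16; 20; 21; 22; 25; 31; 28; 30; 32]; [:: 0; 3; 14; 0; 17;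
30; 1; 26; 28; 1; 27; 30; 2; 6; 10; 2; 7; 31; 3; 5; 29; 4; 8; 19; 4; 9; 25; 5; 13; 17; 6; 12;
16; 7; 20; 27; 8; 25; 29; 9; 11; 26; 10; 19; 24; 11; 15; 31; 12; 24; 32; 13; 14; 18; 15; 18; 21;
16; 22; 32; 21; 23; 28; 22; 23; 33]; [:: 0; 1; 14; 0; 6; 28; 1; 18; 23; 2; 21; 31; 2; 27; 33; 3;
5; 14; 3; 21; 23; 4; 24; 30; 5; 17; 24; 6; 15; 29; 7; 11; 17; 7; 12; 25; 8; 25; 26; 8; 28; 33;
9; 13; 22; 9; 15; 31; 10; 13; 32; 10; 19; 26; 11; 16; 19; 12; 20; 30; 16; 27; 32; 18; 22; 29];
[:: 0; 8; 33; 0; 27; 30; 1; 4; 16; 1; 11; 22; 2; 8; 17; 2; 10; 13; 3; 14; 29; 3; 18; 31; 4; 25;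
26; 5; 7; 20; 5; 14; 30; 6; 12; 32; 6; 15; 27; 7; 10; 19; 9; 16; 23; 9; 25; 28; 11; 21; 33; 12;
23; 24; 15; 18; 32; 17; 20; 28; 19; 26; 31; 21; 22; 29]; [:: 0; 14; 30; 0; 19; 26; 1; 9; 22; 1;
18; 26; 2; 12; 21; 2; 15; 17; 3; 4; 29; 4; 20; 22; 5; 8; 21; 5; 9; 32; 6; 13; 24; 6; 16; 18; 7;
13; 20; 7; 28; 31; 8; 12; 15; 10; 17; 27; 10; 25; 31; 11; 23; 25; 14; 23; 33; 16; 27; 33; 19;
29; 32; 24; 28; 30]].
Lemma S_cover33 : S_cover 33.
Proof. by apply: (@S_cover_data _ S_data33); vm_cast_no_check (erefl true). Qed.

Definition S_data39 := (20, chop [:: 0; 8; 13; 0; 17; 28; 1; 5; 10; 1; 24; 31; 2; 6; 23; 2; 18;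
33; 3; 14; 35; 3; 22; 26; 4; 9; 30; 4; 11; 21; 5; 19; 34; 6; 16; 17; 7; 11; 12; 7; 18; 19; 8;
20; 37; 9; 16; 32; 10; 24; 29; 12; 29; 36; 13; 22; 38; 14; 25; 39; 15; 23; 34; 20; 28; 33; 21;
25; 30; 26; 36; 37; 27; 31; 32; 27; 38; 39]) :: full 40 [:: [:: 0; 3; 21; 0; 24; 27; 1; 25; 36;
1; 28; 30; 2; 11; 22; 2; 16; 18; 3; 8; 14; 4; 6; 33; 4; 25; 26; 5; 22; 37; 5; 29; 35; 6; 15; 23;
7; 16; 39; 7; 18; 34; 8; 10; 32; 9; 28; 39; 9; 31; 37; 10; 24; 38; 11; 26; 38; 12; 17; 29; 12;
20; 27; 13; 30; 31; 14; 15; 19; 17; 19; 20; 23; 32; 35; 33; 34; 36]; [:: 0; 3; 37; 0; 7; 34; 1;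
5; 36; 1; 8; 29; 2; 16; 38; 2; 17; 36; 3; 35; 38; 4; 6; 20; 4; 15; 30; 5; 23; 37; 6; 22; 33; 7;
14; 25; 8; 12; 30; 9; 15; 19; 9; 26; 35; 10; 19; 25; 10; 34; 39; 11; 12; 13; 11; 16; 24; 13; 20;
24; 17; 18; 26; 18; 27; 31; 21; 23; 32; 21; 29; 33; 22; 27; 28; 28; 31; 32]; [:: 0; 7; 13; 0;
15; 33; 1; 2; 5; 1; 14; 26; 2; 31; 34; 3; 4; 30; 3; 8; 25; 4; 17; 36; 5; 19; 32; 6; 22; 31; 6;
28; 39; 7; 16; 23; 8; 10; 27; 9; 11; 29; 9; 13; 32; 10; 16; 24; 11; 21; 35; 12; 15; 39; 14; 24;
34; 17; 35; 37; 18; 20; 27; 18; 25; 38; 19; 29; 36; 21; 22; 37; 23; 26; 38; 28; 30; 33]; [:: 0;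
12; 32; 0; 13; 30; 1; 12; 38; 1; 27; 35; 2; 5; 20; 2; 10; 26; 3; 7; 29; 3; 19; 33; 4; 8; 24; 4;
14; 19; 5; 11; 28; 6; 9; 25; 6; 14; 34; 7; 18; 21; 8; 20; 36; 9; 11; 16; 10; 30; 35; 13; 23; 34;
15; 29; 32; 15; 37; 38; 16; 31; 36; 17; 21; 24; 17; 33; 39; 22; 23; 39; 22; 25; 31; 26; 27; 37];
[:: 0; 16; 21; 0; 25; 36; 1; 10; 29; 1; 22; 39; 2; 6; 27; 2; 15; 23; 3; 8; 13; 3; 26; 30; 4; 18;
24; 4; 22; 35; 5; 10; 20; 5; 28; 31; 6; 7; 34; 7; 9; 13; 8; 12; 19; 9; 17; 27; 11; 12; 37; 11;
21; 33; 14; 17; 36; 14; 24; 32; 15; 34; 35; 18; 38; 39; 19; 23; 32; 20; 29; 38; 25; 28; 30; 26;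
31; 33]; [:: 0; 8; 11; 0; 14; 35; 1; 3; 26; 1; 22; 32; 2; 3; 34; 2; 6; 29; 4; 16; 20; 4; 22; 37;
5; 10; 17; 5; 15; 33; 6; 23; 31; 7; 9; 25; 7; 14; 33; 8; 21; 26; 9; 24; 27; 10; 16; 30; 11; 13;
25; 12; 18; 39; 12; 19; 24; 13; 28; 38; 15; 23; 37; 17; 19; 21; 18; 29; 35; 20; 27; 39; 28; 32;
36; 30; 36; 38]; [:: 0; 21; 30; 0; 24; 28; 1; 2; 35; 1; 15; 24; 2; 11; 39; 3; 4; 34; 3; 16; 37;
5; 7; 22; 5; 38; 39; 6; 7; 12; 6; 13; 33; 8; 14; 19; 8; 36; 37; 9; 26; 38; 9; 31; 36; 10; 13;
20; 10; 17; 18; 11; 27; 28; 12; 19; 26; 14; 16; 29; 15; 22; 31; 17; 21; 32; 20; 30; 33; 23; 25;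
35; 23; 27; 29; 25; 32; 34]; [:: 0; 6; 38; 0; 8; 36; 1; 9; 11; 1; 20; 29; 2; 10; 31; 2; 14; 16;
3; 5; 33; 3; 8; 24; 4; 22; 28; 4; 34; 36; 6; 9; 19; 7; 27; 30; 7; 31; 39; 10; 21; 30; 11; 18;
32; 12; 13; 37; 12; 15; 35; 13; 14; 23; 15; 16; 29; 17; 19; 38; 17; 34; 39; 18; 24; 27; 20; 26;
37; 22; 23; 35; 25; 26; 33; 25; 28; 32]; [:: 0; 4; 14; 0; 19; 34; 1; 12; 30; 1; 25; 35; 2; 4;
29; 2; 8; 17; 3; 9; 39; 3; 12; 25; 5; 21; 24; 6; 11; 20; 6; 23; 36; 7; 11; 31; 7; 14; 22; 8; 13;
36; 9; 21; 27; 10; 15; 18; 10; 28; 29; 13; 20; 23; 15; 27; 30; 16; 17; 31; 16; 32; 39; 18; 22;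
37; 19; 28; 33; 24; 34; 38; 26; 32; 38; 26; 35; 37]].
Lemma S_cover39 : S_cover 39.
Proof. by apply: (@S_cover_data _ S_data39); vm_cast_no_check (erefl true). Qed.

Definition S_data45 := full 46 (flatten [seq multiples 46 3 11 F | F <- [:: [:: 0; 7; 15; 0; 12;
20; 1; 3; 14; 1; 22; 32; 2; 4; 34; 2; 21; 39; 3; 35; 45; 4; 17; 36; 5; 6; 8; 5; 11; 31; 6; 13;
37; 7; 8; 18; 9; 10; 43; 9; 16; 39; 10; 25; 45; 11; 15; 36; 12; 25; 33; 13; 19; 34; 14; 21; 37;
16; 43; 44; 17; 31; 41; 18; 28; 35; 19; 20; 32; 22; 27; 44; 23; 24; 28; 23; 29; 40; 24; 38; 42;
26; 30; 42; 27; 40; 41; 30; 33; 38]]]).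
Lemma S_cover45 : S_cover 45.
Proof. by apply: (@S_cover_data _ S_data45); vm_cast_no_check (erefl true). Qed.

Definition S_data57 := full 58 (flatten [seq multiples 58 7 7 F | F <- [:: [:: 0; 21; 57; 0; 26;
51; 1; 2; 48; 1; 6; 32; 2; 24; 38; 3; 7; 31; 4; 32; 47; 4; 52; 53; 5; 8; 13; 5; 27; 46; 6; 12;
26; 7; 23; 45; 8; 21; 42; 9; 17; 22; 9; 29; 55; 10; 34; 45; 10; 41; 43; 11; 16; 30; 11; 18; 28;
12; 14; 16; 13; 42; 47; 14; 20; 54; 15; 24; 40; 15; 28; 51; 17; 44; 55; 18; 27; 56; 19; 30; 48;
19; 36; 37; 20; 33; 57; 22; 29; 35; 23; 34; 50; 25; 39; 49; 25; 44; 56; 33; 40; 53; 35; 41; 49;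
36; 52; 54; 37; 43; 46; 38; 39; 50]; [:: 0; 20; 35; 0; 36; 54; 1; 8; 10; 1; 39; 48; 2; 24; 51;
2; 45; 46; 3; 9; 21; 3; 15; 32; 4; 14; 26; 4; 46; 56; 5; 29; 56; 5; 38; 55; 6; 37; 44; 7; 13;
50; 7; 21; 53; 8; 23; 25; 9; 23; 35; 10; 27; 40; 11; 34; 57; 11; 45; 53; 12; 20; 50; 12; 22; 49;
13; 28; 48; 14; 19; 37; 15; 34; 47; 16; 25; 42; 16; 51; 52; 17; 27; 30; 17; 36; 47; 18; 31; 33;
18; 42; 43; 19; 38; 43; 22; 33; 55; 24; 30; 41; 26; 40; 49; 28; 39; 54; 29; 32; 44; 31; 41;
52]]]).
Lemma S_cover57 : S_cover 57.
Proof. by apply: (@S_cover_data _ S_data57); vm_cast_no_check (erefl true). Qed.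

Definition S_data87 := (44, chop [:: 0; 30; 65; 0; 57; 71; 1; 49; 82; 1; 77; 87; 2; 49; 80; 2;
59; 62; 3; 52; 62; 3; 56; 61; 4; 11; 35; 4; 55; 68; 5; 36; 46; 5; 38; 45; 6; 34; 39; 6; 59; 76;
7; 26; 72; 7; 40; 75; 8; 18; 47; 8; 20; 83; 9; 34; 68; 10; 25; 38; 10; 58; 72; 11; 24; 48; 12;
17; 47; 12; 19; 61; 13; 26; 43; 13; 27; 44; 14; 22; 64; 14; 28; 54; 15; 18; 46; 15; 32; 50; 16;
30; 81; 16; 33; 85; 17; 56; 63; 19; 23; 73; 20; 58; 66; 21; 44; 74; 21; 67; 80; 22; 25; 75; 23;
36; 65; 24; 53; 78; 27; 32; 81; 28; 51; 70; 29; 63; 67; 29; 84; 86; 31; 51; 84; 31; 66; 69; 33;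
43; 45; 35; 42; 85; 37; 60; 74; 37; 71; 76; 39; 52; 64; 40; 42; 73; 41; 60; 77; 41; 79; 86; 48;
55; 79; 50; 78; 83; 54; 69; 82; 57; 70; 87]) :: full 88 [:: [:: 0; 14; 56; 0; 83; 86; 1; 9; 69;
1; 19; 63; 2; 14; 68; 2; 53; 61; 3; 30; 39; 3; 38; 42; 4; 34; 37; 4; 74; 80; 5; 21; 28; 5; 59;
67; 6; 41; 66; 6; 58; 69; 7; 22; 53; 7; 41; 60; 8; 20; 24; 8; 50; 61; 9; 34; 35; 10; 25; 43; 10;
28; 87; 11; 32; 76; 11; 42; 48; 12; 30; 60; 12; 51; 87; 13; 29; 67; 13; 46; 70; 15; 17; 40; 15;
58; 66; 16; 46; 63; 17; 44; 54; 18; 25; 70; 18; 44; 74; 19; 33; 72; 20; 75; 84; 21; 29; 85; 22;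
65; 79; 23; 33; 45; 23; 81; 82; 24; 57; 77; 26; 39; 50; 26; 48; 52; 27; 55; 62; 27; 64; 71; 31;
35; 59; 31; 36; 78; 32; 56; 73; 36; 75; 79; 37; 57; 72; 38; 73; 78; 40; 62; 80; 43; 49; 84; 45;
52; 68; 47; 55; 76; 47; 64; 65; 49; 71; 77; 51; 81; 86; 54; 82; 85]; [:: 0; 41; 75; 0; 44; 72;
1; 5; 71; 1; 54; 66; 2; 16; 86; 2; 45; 46; 3; 52; 76; 3; 81; 84; 4; 13; 67; 4; 49; 68; 5; 35;
63; 6; 31; 78; 6; 40; 73; 7; 12; 47; 7; 20; 25; 8; 36; 40; 8; 51; 61; 9; 19; 76; 9; 32; 65; 10;
15; 74; 10; 39; 42; 11; 34; 73; 11; 79; 84; 12; 41; 62; 13; 47; 74; 14; 27; 48; 14; 36; 69; 15;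
55; 87; 17; 23; 56; 17; 51; 59; 18; 22; 26; 18; 43; 68; 19; 38; 42; 20; 29; 82; 21; 24; 85; 21;
57; 81; 22; 29; 38; 23; 37; 55; 24; 28; 87; 25; 33; 48; 26; 66; 77; 27; 64; 67; 28; 33; 85; 30;
35; 57; 30; 45; 72; 31; 62; 70; 32; 64; 70; 34; 43; 60; 37; 39; 69; 46; 49; 58; 50; 53; 78; 50;
63; 83; 52; 80; 86; 53; 58; 83; 54; 59; 79; 56; 61; 75; 60; 80; 82; 65; 71; 77]; [:: 0; 10; 79;
0; 54; 56; 1; 18; 83; 1; 34; 71; 2; 48; 68; 2; 50; 66; 3; 44; 53; 3; 61; 71; 4; 45; 81; 4; 56;
86; 5; 13; 63; 5; 27; 62; 6; 31; 66; 6; 64; 67; 7; 27; 76; 7; 41; 61; 8; 28; 48; 8; 36; 44; 9;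
16; 36; 9; 23; 25; 10; 32; 83; 11; 12; 76; 11; 19; 30; 12; 74; 82; 13; 25; 60; 14; 29; 64; 14;
80; 87; 15; 38; 47; 15; 55; 72; 16; 17; 69; 17; 33; 60; 18; 22; 75; 19; 58; 77; 20; 24; 32; 20;
57; 68; 21; 33; 40; 21; 42; 78; 22; 23; 35; 24; 46; 73; 26; 28; 75; 29; 43; 65; 30; 35; 39; 31;
40; 55; 34; 72; 81; 37; 41; 84; 37; 59; 74; 38; 57; 62; 42; 52; 85; 43; 47; 63; 45; 54; 87; 46;
58; 70; 49; 51; 84; 49; 52; 70; 50; 79; 86; 51; 53; 82; 59; 67; 69; 65; 78; 85; 73; 77; 80]; [::
0; 24; 64; 0; 30; 71; 1; 13; 52; 1; 39; 59; 2; 14; 40; 2; 44; 73; 3; 26; 71; 3; 47; 59; 4; 12;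
79; 4; 50; 77; 5; 9; 44; 5; 18; 86; 6; 28; 76; 6; 55; 87; 7; 16; 23; 7; 21; 48; 8; 40; 78; 8;
54; 79; 9; 19; 80; 10; 11; 21; 10; 22; 31; 11; 20; 33; 12; 67; 85; 13; 15; 60; 14; 56; 77; 15;
36; 64; 16; 81; 82; 17; 35; 70; 17; 48; 73; 18; 46; 66; 19; 61; 86; 20; 67; 84; 22; 53; 85; 23;
68; 74; 24; 45; 84; 25; 46; 47; 25; 57; 68; 27; 28; 49; 27; 31; 42; 29; 41; 63; 29; 61; 82; 30;
45; 75; 32; 37; 43; 32; 50; 55; 33; 51; 72; 34; 65; 66; 34; 72; 78; 35; 43; 65; 36; 42; 62; 37;
63; 70; 38; 58; 74; 38; 69; 83; 39; 49; 75; 41; 52; 83; 53; 56; 57; 54; 60; 81; 58; 80; 87; 62;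
69; 76]; [:: 0; 30; 34; 0; 33; 63; 1; 12; 22; 1; 39; 40; 2; 21; 24; 2; 46; 63; 3; 4; 35; 3; 65;
78; 4; 29; 80; 5; 6; 51; 5; 76; 82; 6; 74; 86; 7; 14; 18; 7; 24; 53; 8; 53; 76; 8; 54; 57; 9;
11; 68; 9; 40; 42; 10; 31; 43; 10; 44; 55; 11; 16; 23; 12; 58; 60; 13; 34; 38; 13; 35; 69; 14;
27; 77; 15; 17; 66; 15; 19; 37; 16; 25; 70; 17; 31; 68; 18; 45; 52; 19; 45; 79; 20; 32; 70; 20;
36; 49; 21; 64; 75; 22; 42; 51; 23; 56; 58; 25; 61; 75; 26; 28; 41; 26; 59; 73; 27; 61; 85; 28;
46; 82; 29; 47; 84; 30; 66; 81; 32; 47; 83; 33; 57; 80; 36; 48; 65; 37; 71; 74; 38; 55; 72; 39;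
62; 79; 41; 59; 69; 43; 64; 86; 44; 50; 78; 48; 50; 52; 49; 62; 84; 54; 72; 83; 60; 71; 73; 67;
77; 87; 81; 85; 87]; [:: 0; 9; 36; 0; 15; 48; 1; 57; 61; 1; 67; 69; 2; 17; 43; 2; 57; 71; 3; 6;
26; 3; 34; 70; 4; 41; 73; 4; 62; 64; 5; 22; 44; 5; 66; 82; 6; 19; 23; 7; 14; 17; 7; 30; 34; 8;
13; 32; 8; 26; 51; 9; 54; 59; 10; 30; 62; 10; 44; 84; 11; 29; 76; 11; 31; 81; 12; 13; 74; 12;
31; 47; 14; 25; 45; 15; 46; 72; 16; 79; 82; 16; 80; 84; 18; 21; 52; 18; 36; 49; 19; 35; 58; 20;
33; 71; 20; 56; 68; 21; 41; 65; 22; 37; 58; 23; 40; 47; 24; 28; 51; 24; 56; 83; 25; 63; 80; 27;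
60; 87; 28; 50; 69; 29; 37; 50; 32; 78; 86; 33; 73; 77; 35; 42; 65; 38; 53; 70; 38; 66; 83; 39;
40; 48; 39; 68; 81; 42; 72; 79; 43; 55; 60; 45; 52; 63; 46; 55; 77; 49; 75; 85; 53; 64; 78; 54;
74; 75; 59; 67; 86; 61; 76; 87]; [:: 0; 11; 35; 0; 48; 52; 1; 15; 73; 1; 28; 87; 2; 22; 35; 2;
26; 80; 3; 21; 84; 3; 42; 86; 4; 13; 27; 4; 22; 49; 5; 31; 45; 5; 54; 59; 6; 7; 84; 6; 62; 78;
7; 17; 24; 8; 40; 70; 8; 61; 65; 9; 26; 51; 9; 66; 82; 10; 39; 54; 10; 76; 79; 11; 29; 69; 12;
23; 72; 12; 63; 73; 13; 56; 68; 14; 56; 69; 14; 81; 86; 15; 33; 45; 16; 23; 33; 16; 36; 83; 17;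
25; 34; 18; 20; 64; 18; 27; 70; 19; 31; 46; 19; 74; 77; 20; 38; 66; 21; 68; 75; 24; 57; 85; 25;
58; 64; 28; 37; 77; 29; 81; 82; 30; 42; 61; 30; 59; 71; 32; 36; 46; 32; 38; 47; 34; 57; 60; 37;
51; 79; 39; 44; 85; 40; 41; 55; 41; 50; 52; 43; 63; 74; 44; 53; 76; 47; 71; 78; 48; 62; 67; 49;
65; 83; 50; 55; 87; 58; 60; 67; 72; 75; 80]; [:: 0; 41; 55; 0; 47; 72; 1; 23; 49; 1; 37; 40; 2;
5; 76; 2; 27; 56; 3; 52; 66; 3; 57; 81; 4; 28; 64; 4; 33; 44; 5; 25; 28; 6; 33; 46; 6; 65; 70;
7; 12; 30; 7; 75; 84; 8; 11; 87; 8; 46; 85; 9; 38; 58; 9; 77; 78; 10; 18; 38; 10; 55; 86; 11;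
21; 36; 12; 17; 61; 13; 29; 39; 13; 36; 44; 14; 19; 69; 14; 35; 54; 15; 21; 67; 15; 75; 81; 16;
42; 53; 16; 43; 45; 17; 66; 67; 18; 24; 29; 19; 68; 80; 20; 25; 52; 20; 61; 83; 22; 43; 70; 22;
60; 73; 23; 74; 78; 24; 71; 82; 26; 48; 85; 26; 63; 83; 27; 32; 86; 30; 51; 54; 31; 41; 82; 31;
47; 50; 32; 74; 80; 34; 48; 56; 34; 60; 87; 35; 57; 62; 37; 49; 59; 39; 42; 77; 40; 59; 73; 45;
68; 84; 50; 62; 64; 51; 58; 79; 53; 63; 71; 69; 72; 76]; [:: 0; 10; 66; 0; 27; 58; 1; 48; 81; 1;
65; 85; 2; 15; 40; 2; 31; 45; 3; 39; 61; 3; 67; 77; 4; 30; 73; 4; 42; 65; 5; 23; 46; 5; 31; 33;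
6; 8; 32; 6; 30; 55; 7; 35; 54; 7; 41; 47; 8; 16; 46; 9; 25; 26; 9; 54; 76; 10; 24; 48; 11; 22;
51; 11; 44; 61; 12; 41; 86; 12; 44; 83; 13; 32; 72; 13; 37; 66; 14; 22; 53; 14; 82; 85; 15; 38;
63; 16; 63; 76; 17; 21; 59; 17; 53; 79; 18; 20; 37; 18; 26; 74; 19; 28; 86; 19; 45; 50; 20; 23;
52; 21; 25; 62; 24; 60; 77; 27; 33; 36; 28; 49; 82; 29; 50; 87; 29; 52; 80; 34; 42; 69; 34; 64;
73; 35; 40; 69; 36; 38; 56; 39; 83; 84; 43; 49; 81; 43; 72; 78; 47; 56; 64; 55; 57; 67; 57; 68;
79; 58; 70; 71; 59; 75; 80; 60; 75; 84; 62; 78; 87; 68; 70; 74]; [:: 0; 64; 72; 0; 74; 80; 1;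
24; 76; 1; 86; 87; 2; 16; 26; 2; 31; 54; 3; 4; 55; 3; 12; 81; 4; 21; 26; 5; 11; 77; 5; 68; 82;
6; 28; 45; 6; 62; 68; 7; 14; 31; 7; 36; 79; 8; 9; 14; 8; 60; 66; 9; 41; 51; 10; 27; 46; 10; 53;
62; 11; 18; 43; 12; 13; 49; 13; 15; 16; 15; 43; 87; 17; 36; 72; 17; 42; 78; 18; 69; 75; 19; 24;
67; 19; 25; 59; 20; 47; 64; 20; 50; 61; 21; 40; 61; 22; 48; 60; 22; 71; 84; 23; 30; 35; 23; 40;
77; 27; 32; 49; 28; 50; 59; 29; 37; 73; 29; 81; 85; 30; 33; 39; 32; 75; 78; 33; 48; 63; 34; 35;
52; 34; 56; 69; 37; 82; 83; 38; 42; 55; 38; 70; 83; 39; 73; 85; 41; 58; 71; 44; 51; 63; 44; 65;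
79; 45; 47; 53; 46; 56; 86; 52; 65; 67; 54; 58; 80; 57; 66; 84; 57; 70; 76]; [:: 0; 10; 31; 0;
80; 85; 1; 59; 86; 1; 63; 83; 2; 18; 44; 2; 26; 72; 3; 22; 49; 3; 70; 74; 4; 58; 79; 4; 76; 82;
5; 15; 58; 5; 21; 38; 6; 15; 40; 6; 26; 43; 7; 55; 80; 7; 57; 77; 8; 9; 12; 8; 44; 62; 9; 13;
71; 10; 14; 87; 11; 52; 79; 11; 61; 85; 12; 31; 39; 13; 32; 47; 14; 30; 42; 16; 19; 27; 16; 24;
65; 17; 20; 53; 17; 30; 75; 18; 47; 83; 19; 33; 73; 20; 48; 57; 21; 41; 78; 22; 42; 86; 23; 25;
81; 23; 33; 67; 24; 32; 56; 25; 40; 59; 27; 29; 50; 28; 35; 36; 28; 45; 65; 29; 41; 52; 34; 63;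
81; 34; 66; 69; 35; 38; 74; 36; 60; 71; 37; 46; 62; 37; 55; 69; 39; 68; 84; 43; 50; 78; 45; 48;
82; 46; 66; 73; 51; 61; 64; 51; 68; 70; 53; 54; 72; 54; 67; 77; 56; 75; 87; 60; 64; 76]; [:: 0;
8; 31; 0; 83; 84; 1; 15; 81; 1; 30; 54; 2; 47; 50; 2; 48; 76; 3; 35; 39; 3; 46; 51; 4; 14; 33;
4; 25; 41; 5; 24; 87; 5; 49; 51; 6; 9; 79; 6; 19; 20; 7; 10; 62; 7; 28; 60; 8; 65; 69; 9; 23;
85; 10; 23; 53; 11; 53; 60; 11; 78; 84; 12; 15; 36; 12; 21; 30; 13; 55; 63; 13; 80; 81; 14; 43;
47; 16; 33; 69; 16; 45; 86; 17; 24; 74; 17; 40; 52; 18; 20; 39; 19; 54; 65; 21; 59; 64; 22; 44;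
46; 22; 50; 82; 25; 57; 77; 26; 32; 74; 26; 34; 62; 27; 35; 38; 27; 63; 82; 28; 55; 56; 29; 70;
78; 29; 75; 85; 31; 40; 79; 32; 37; 48; 34; 67; 71; 36; 67; 76; 37; 38; 61; 41; 44; 68; 42; 43;
80; 42; 59; 75; 45; 68; 83; 49; 66; 77; 52; 61; 87; 56; 58; 72; 57; 70; 86; 64; 72; 73; 66; 71;
73]; [:: 0; 23; 25; 0; 32; 47; 1; 31; 64; 1; 79; 81; 2; 8; 64; 2; 26; 60; 3; 14; 53; 3; 59; 86;
4; 27; 50; 4; 45; 58; 5; 50; 62; 5; 55; 71; 6; 29; 83; 6; 38; 39; 7; 33; 36; 7; 34; 40; 8; 17;
18; 9; 12; 84; 9; 51; 60; 10; 22; 35; 10; 42; 83; 11; 12; 70; 11; 20; 86; 13; 24; 25; 13; 47;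
84; 14; 71; 77; 15; 54; 72; 15; 66; 75; 16; 37; 63; 16; 56; 76; 17; 36; 87; 18; 58; 68; 19; 35;
81; 19; 52; 53; 20; 54; 61; 21; 27; 85; 21; 44; 76; 22; 30; 75; 23; 40; 61; 24; 37; 51; 26; 34;
42; 28; 43; 66; 28; 62; 85; 29; 48; 59; 30; 55; 73; 31; 80; 82; 32; 57; 68; 33; 45; 48; 38; 63;
87; 39; 44; 77; 41; 43; 65; 41; 70; 80; 46; 56; 78; 46; 65; 67; 49; 57; 67; 49; 69; 74; 69; 78;
82; 72; 74; 79]; [:: 0; 8; 61; 0; 56; 81; 1; 53; 74; 1; 76; 78; 2; 4; 69; 2; 75; 84; 3; 9; 48;
3; 10; 24; 4; 48; 51; 5; 7; 68; 5; 31; 64; 6; 17; 29; 6; 52; 71; 7; 23; 55; 8; 40; 82; 9; 61;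
84; 10; 25; 33; 11; 18; 59; 11; 65; 79; 12; 22; 26; 12; 27; 72; 13; 27; 41; 13; 32; 63; 14; 45;
80; 14; 46; 58; 15; 34; 87; 15; 44; 73; 16; 38; 78; 16; 43; 65; 17; 56; 86; 18; 52; 83; 19; 20;
85; 19; 39; 49; 20; 38; 81; 21; 63; 87; 21; 66; 77; 22; 37; 49; 23; 25; 76; 24; 45; 86; 26; 41;
47; 28; 35; 43; 28; 53; 67; 29; 33; 72; 30; 54; 58; 30; 57; 68; 31; 46; 60; 32; 69; 70; 34; 47;
66; 35; 55; 82; 36; 50; 57; 36; 60; 62; 37; 42; 79; 39; 64; 70; 40; 42; 80; 50; 67; 71; 51; 62;
75; 59; 77; 85; 73; 74; 83]; [:: 0; 7; 36; 0; 15; 84; 1; 24; 34; 1; 36; 42; 2; 3; 33; 2; 38; 85;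
3; 31; 53; 4; 11; 57; 4; 19; 26; 5; 11; 29; 5; 13; 67; 6; 41; 60; 6; 65; 84; 7; 34; 58; 8; 17;
38; 8; 27; 45; 9; 23; 29; 9; 46; 62; 10; 18; 22; 10; 54; 58; 12; 28; 69; 12; 37; 81; 13; 17; 86;
14; 16; 74; 14; 49; 79; 15; 50; 63; 16; 44; 87; 18; 62; 68; 19; 30; 51; 20; 46; 66; 20; 52; 86;
21; 65; 78; 21; 76; 77; 22; 53; 72; 23; 30; 61; 24; 27; 73; 25; 40; 78; 25; 55; 70; 26; 39; 83;
28; 43; 82; 31; 33; 81; 32; 45; 80; 32; 69; 74; 35; 42; 77; 35; 51; 59; 37; 67; 68; 39; 47; 72;
40; 64; 80; 41; 73; 75; 44; 55; 60; 47; 57; 82; 48; 50; 59; 48; 63; 83; 49; 71; 87; 52; 54; 66;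
56; 70; 71; 56; 79; 85; 61; 64; 75]; [:: 0; 6; 47; 0; 51; 53; 1; 22; 75; 1; 32; 50; 2; 12; 40;
2; 47; 84; 3; 7; 48; 3; 25; 36; 4; 33; 86; 4; 65; 83; 5; 6; 52; 5; 17; 85; 7; 23; 44; 8; 24; 85;
8; 53; 68; 9; 64; 70; 9; 67; 79; 10; 21; 40; 10; 69; 73; 11; 28; 67; 11; 37; 74; 12; 26; 70; 13;
34; 58; 13; 41; 54; 14; 63; 74; 14; 76; 81; 15; 37; 80; 15; 45; 61; 16; 34; 41; 16; 36; 82; 17;
29; 66; 18; 25; 52; 18; 26; 43; 19; 43; 62; 20; 27; 87; 20; 32; 75; 21; 44; 51; 22; 83; 84; 23;
28; 38; 24; 59; 71; 27; 42; 58; 30; 31; 56; 30; 33; 49; 31; 50; 57; 35; 45; 68; 35; 54; 55; 38;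
57; 79; 39; 48; 77; 39; 72; 81; 42; 55; 82; 46; 63; 78; 46; 64; 65; 49; 60; 87; 56; 62; 78; 59;
73; 77; 60; 66; 80; 61; 71; 76; 69; 72; 86]; [:: 0; 10; 55; 0; 11; 87; 1; 15; 69; 1; 21; 50; 2;
7; 85; 2; 44; 56; 3; 26; 37; 3; 45; 67; 4; 23; 55; 4; 51; 54; 5; 21; 83; 5; 42; 68; 6; 25; 67;
6; 48; 79; 7; 17; 30; 8; 19; 28; 8; 36; 77; 9; 16; 53; 9; 27; 84; 10; 43; 87; 11; 49; 73; 12;
37; 57; 12; 48; 86; 13; 20; 50; 13; 49; 85; 14; 35; 64; 15; 66; 80; 16; 25; 72; 17; 40; 78; 18;
23; 24; 18; 65; 77; 19; 61; 64; 20; 28; 33; 22; 34; 62; 22; 71; 78; 24; 46; 75; 26; 32; 36; 27;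
29; 32; 29; 63; 73; 30; 42; 66; 31; 43; 63; 31; 57; 76; 33; 38; 61; 34; 81; 83; 35; 71; 75; 38;
74; 82; 39; 46; 84; 39; 47; 79; 40; 52; 68; 41; 53; 59; 41; 81; 82; 44; 60; 80; 45; 47; 72; 51;
60; 65; 52; 70; 86; 54; 58; 59; 56; 62; 69; 58; 74; 76]; [:: 0; 27; 41; 0; 63; 82; 1; 25; 34; 1;
75; 86; 2; 14; 76; 2; 49; 85; 3; 5; 73; 3; 6; 51; 4; 44; 77; 4; 49; 58; 5; 16; 33; 6; 48; 85; 7;
37; 59; 7; 44; 79; 8; 14; 57; 8; 48; 79; 9; 30; 70; 9; 37; 47; 10; 19; 54; 10; 64; 65; 11; 20;
39; 11; 28; 73; 12; 33; 63; 12; 36; 54; 13; 57; 75; 13; 66; 84; 15; 19; 40; 16; 32; 36; 17; 22;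
31; 17; 45; 83; 18; 52; 78; 18; 60; 64; 20; 53; 69; 21; 43; 87; 21; 61; 86; 22; 23; 38; 23; 24;
87; 24; 26; 52; 25; 35; 66; 26; 50; 62; 27; 67; 69; 28; 35; 41; 29; 46; 72; 29; 55; 84; 30; 71;
74; 31; 74; 76; 32; 43; 58; 34; 39; 70; 38; 65; 81; 40; 55; 80; 42; 46; 80; 42; 59; 67; 45; 47;
81; 50; 53; 56; 51; 56; 82; 60; 71; 77; 61; 62; 68; 68; 72; 78]; [:: 0; 26; 77; 0; 53; 78; 1;
37; 62; 1; 44; 68; 2; 46; 61; 2; 60; 66; 3; 5; 85; 3; 6; 32; 4; 12; 87; 4; 49; 56; 5; 15; 63; 6;
9; 22; 7; 25; 85; 7; 30; 74; 8; 18; 35; 8; 34; 58; 9; 35; 70; 10; 16; 52; 10; 28; 80; 11; 12;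
52; 11; 19; 25; 13; 42; 70; 14; 17; 29; 14; 56; 72; 15; 61; 82; 16; 64; 81; 17; 45; 74; 18; 21;
31; 19; 37; 86; 20; 39; 58; 20; 47; 51; 21; 43; 84; 22; 47; 50; 23; 38; 39; 23; 76; 79; 24; 46;
69; 24; 65; 75; 26; 27; 55; 27; 59; 83; 28; 41; 73; 29; 36; 62; 30; 66; 76; 31; 72; 83; 32; 77;
79; 33; 48; 82; 33; 54; 59; 34; 54; 75; 36; 60; 87; 38; 45; 67; 40; 41; 48; 40; 42; 78; 43; 68;
80; 44; 53; 65; 50; 67; 73; 51; 55; 81; 57; 63; 64; 57; 71; 84; 69; 71; 86]; [:: 0; 39; 40; 0;
65; 69; 1; 13; 72; 1; 15; 24; 2; 36; 37; 2; 52; 81; 3; 11; 70; 4; 20; 78; 4; 35; 38; 5; 28; 54;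
5; 43; 47; 6; 8; 60; 6; 20; 77; 7; 27; 86; 7; 55; 56; 8; 41; 52; 9; 13; 18; 9; 64; 76; 10; 25;
30; 10; 49; 63; 11; 40; 80; 12; 15; 83; 12; 37; 45; 14; 19; 77; 14; 73; 87; 16; 54; 84; 16; 65;
85; 17; 22; 50; 17; 58; 81; 18; 38; 64; 19; 23; 32; 21; 29; 87; 21; 62; 78; 22; 61; 71; 23; 58;
67; 24; 25; 66; 26; 34; 74; 26; 72; 84; 27; 42; 66; 28; 67; 80; 29; 48; 57; 30; 51; 68; 31; 33;
83; 31; 35; 82; 32; 39; 79; 34; 56; 70; 36; 68; 73; 41; 46; 59; 42; 71; 79; 43; 45; 61; 44; 55;
62; 44; 59; 69; 46; 53; 86; 47; 48; 75; 49; 60; 82; 50; 51; 75; 53; 74; 85; 57; 63; 76]; [:: 0;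
12; 68; 0; 72; 82; 1; 33; 51; 1; 48; 57; 2; 35; 82; 2; 57; 61; 3; 11; 80; 3; 76; 84; 4; 16; 65;
4; 48; 62; 5; 35; 47; 5; 75; 78; 6; 65; 71; 6; 80; 81; 7; 43; 85; 7; 45; 61; 8; 27; 40; 8; 28;
53; 9; 19; 59; 9; 20; 87; 10; 37; 69; 10; 41; 52; 11; 71; 84; 12; 17; 77; 13; 31; 34; 13; 60;
86; 14; 15; 74; 14; 30; 63; 15; 46; 73; 16; 58; 86; 17; 26; 56; 18; 42; 55; 19; 20; 21; 21; 69;
72; 22; 60; 63; 22; 62; 74; 23; 38; 40; 23; 46; 83; 24; 32; 67; 24; 77; 78; 25; 29; 59; 25; 42;
51; 26; 44; 50; 27; 31; 38; 28; 52; 85; 29; 55; 68; 30; 39; 70; 32; 37; 49; 33; 66; 79; 34; 41;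
43; 36; 44; 87; 36; 64; 76; 39; 64; 83; 45; 67; 70; 47; 54; 73; 49; 50; 66; 53; 56; 79; 54; 75;
81]].
Lemma S_cover87 : S_cover 87.
Proof. by apply: (@S_cover_data _ S_data87); vm_cast_no_check (erefl true). Qed.

Definition S_data93 := full 94 (flatten [seq multiples 94 3 23 F | F <- [:: [:: 0; 19; 75; 0;
21; 44; 1; 55; 86; 1; 77; 92; 2; 29; 82; 2; 35; 58; 3; 4; 43; 3; 68; 85; 4; 20; 57; 5; 23; 30;
5; 69; 78; 6; 14; 38; 6; 39; 47; 7; 11; 61; 7; 41; 67; 8; 10; 50; 8; 33; 72; 9; 17; 43; 9; 32;
85; 10; 18; 39; 11; 40; 66; 12; 27; 66; 12; 56; 89; 13; 34; 46; 13; 74; 81; 14; 67; 93; 15; 24;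
42; 15; 76; 90; 16; 19; 28; 16; 63; 73; 17; 26; 29; 18; 75; 80; 20; 53; 65; 21; 49; 69; 22; 31;
92; 22; 33; 40; 23; 56; 57; 24; 53; 87; 25; 72; 74; 25; 90; 91; 26; 36; 70; 27; 28; 45; 30; 36;
60; 31; 52; 91; 32; 42; 88; 34; 41; 70; 35; 38; 87; 37; 47; 48; 37; 76; 77; 45; 48; 83; 46; 71;
82; 49; 51; 71; 50; 54; 63; 51; 61; 79; 52; 60; 79; 54; 62; 84; 55; 81; 84; 58; 62; 64; 59; 83;
89; 64; 78; 86; 65; 73; 88; 68; 80; 93]]]).
Lemma S_cover93 : S_cover 93.
Proof. by apply: (@S_cover_data _ S_data93); vm_cast_no_check (erefl true). Qed.

Definition R_data9 := full 7 [:: [:: 0; 2; 7; 0; 3; 6; 1; 4; 7; 1; 5; 6; 2; 5; 8; 3; 4; 8]; [::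
0; 1; 5; 0; 7; 8; 1; 3; 6; 2; 3; 7; 2; 4; 8; 4; 5; 6]].
Lemma R_cover9 : R_cover 0 'I_9.
Proof. by apply: (@R_cover_data0 7 R_data9); vm_cast_no_check (erefl true). Qed.

Definition R_data15 := full 15 [:: [:: 0; 1; 2; 0; 8; 13; 1; 12; 13; 2; 5; 11; 3; 4; 8; 3; 6; 9;
4; 9; 10; 5; 12; 14; 6; 7; 14; 7; 10; 11]; [:: 0; 2; 7; 0; 4; 5; 1; 7; 12; 1; 10; 14; 2; 3; 9;
3; 11; 14; 4; 8; 12; 5; 6; 8; 6; 10; 13; 9; 11; 13]; [:: 0; 3; 10; 0; 5; 12; 1; 2; 7; 1; 11; 14;
2; 4; 8; 3; 9; 13; 4; 5; 13; 6; 8; 11; 6; 12; 14; 7; 9; 10]].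
Lemma R_cover15 : R_cover 1 'I_15.
Proof.
(* The matching consists of the cosets of the subgroup of order 3, which every translation
   permutes. *)
by apply: (@R_cover_data1 14 R_data15 [seq [:: i; i + 5; i + 10] | i <- iota 0 5]);
  vm_cast_no_check (erefl true).
Qed.

Definition R_data21 := full 19 [:: [:: 0; 4; 10; 0; 6; 7; 1; 5; 15; 1; 14; 16; 2; 3; 18; 2; 8;
20; 3; 14; 19; 4; 16; 19; 5; 11; 18; 6; 10; 17; 7; 9; 11; 8; 9; 12; 12; 13; 15; 13; 17; 20]; [::
0; 5; 18; 0; 14; 19; 1; 7; 11; 1; 8; 12; 2; 5; 8; 2; 9; 18; 3; 4; 13; 3; 14; 15; 4; 6; 19; 6;
11; 16; 7; 10; 12; 9; 16; 17; 10; 17; 20; 13; 15; 20]; [:: 0; 4; 5; 0; 8; 10; 1; 8; 18; 1; 13;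
14; 2; 4; 17; 2; 12; 16; 3; 6; 12; 3; 9; 11; 5; 19; 20; 6; 11; 18; 7; 9; 14; 7; 10; 15; 13; 17;
19; 15; 16; 20]; [:: 0; 4; 18; 0; 11; 16; 1; 7; 19; 1; 13; 17; 2; 9; 11; 2; 10; 15; 3; 6; 19; 3;
8; 9; 4; 7; 15; 5; 10; 18; 5; 14; 20; 6; 8; 16; 12; 13; 14; 12; 17; 20]; [:: 0; 10; 19; 0; 16;
18; 1; 2; 19; 1; 3; 9; 2; 13; 17; 3; 6; 20; 4; 9; 11; 4; 12; 13; 5; 7; 10; 5; 12; 15; 6; 7; 15;
8; 14; 17; 8; 16; 20; 11; 14; 18]].
Lemma R_cover21 : R_cover 0 'I_21.
Proof. by apply: (@R_cover_data0 19 R_data21); vm_cast_no_check (erefl true). Qed.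

Definition R_data33 := full 31 [:: [:: 0; 5; 21; 0; 19; 20; 1; 9; 20; 1; 19; 28; 2; 13; 30; 2;
16; 32; 3; 13; 24; 3; 14; 16; 4; 7; 23; 4; 26; 32; 5; 12; 31; 6; 12; 14; 6; 22; 26; 7; 18; 21;
8; 9; 28; 8; 11; 24; 10; 17; 25; 10; 23; 31; 11; 18; 29; 15; 17; 30; 15; 27; 29; 22; 25; 27];
[:: 0; 1; 32; 0; 14; 15; 1; 21; 27; 2; 6; 8; 2; 12; 20; 3; 16; 29; 3; 21; 23; 4; 9; 15; 4; 18;
28; 5; 12; 13; 5; 23; 28; 6; 10; 17; 7; 10; 11; 7; 22; 24; 8; 11; 14; 9; 25; 30; 13; 16; 25; 17;
26; 29; 18; 31; 32; 19; 24; 31; 19; 27; 30; 20; 22; 26]; [:: 0; 11; 17; 0; 12; 28; 1; 2; 28; 1;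
10; 15; 2; 12; 32; 3; 4; 25; 3; 5; 31; 4; 8; 23; 5; 23; 24; 6; 16; 18; 6; 21; 25; 7; 19; 32; 7;
26; 30; 8; 16; 21; 9; 14; 29; 9; 22; 30; 10; 13; 17; 11; 26; 27; 13; 20; 29; 14; 18; 22; 15; 27;
31; 19; 20; 24]; [:: 0; 5; 9; 0; 20; 30; 1; 15; 21; 1; 18; 19; 2; 7; 14; 2; 11; 28; 3; 9; 32; 3;
20; 27; 4; 10; 13; 4; 12; 29; 5; 19; 28; 6; 17; 25; 6; 29; 30; 7; 24; 26; 8; 13; 27; 8; 23; 31;
10; 15; 16; 11; 12; 22; 14; 25; 31; 16; 17; 26; 18; 23; 32; 21; 22; 24]; [:: 0; 6; 12; 0; 10;
31; 1; 5; 25; 1; 14; 23; 2; 10; 16; 2; 13; 28; 3; 4; 9; 3; 21; 27; 4; 5; 19; 6; 9; 15; 7; 20;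
23; 7; 22; 32; 8; 14; 18; 8; 17; 24; 11; 17; 26; 11; 18; 28; 12; 20; 21; 13; 16; 30; 15; 25; 29;
19; 27; 31; 22; 24; 30; 26; 29; 32]; [:: 0; 2; 32; 0; 14; 27; 1; 4; 31; 1; 17; 25; 2; 17; 23; 3;
12; 23; 3; 19; 28; 4; 8; 21; 5; 8; 13; 5; 18; 29; 6; 7; 24; 6; 11; 13; 7; 11; 16; 9; 12; 22; 9;
20; 32; 10; 19; 31; 10; 24; 29; 14; 18; 28; 15; 21; 22; 15; 26; 30; 16; 20; 26; 25; 27; 30]; [::
0; 4; 7; 0; 5; 24; 1; 4; 25; 1; 13; 26; 2; 8; 23; 2; 10; 19; 3; 11; 32; 3; 20; 31; 5; 14; 26; 6;
15; 17; 6; 28; 30; 7; 9; 10; 8; 21; 32; 9; 16; 22; 11; 12; 18; 12; 20; 22; 13; 15; 25; 14; 24;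
27; 16; 18; 23; 17; 19; 21; 27; 28; 29; 29; 30; 31]; [:: 0; 3; 11; 0; 4; 31; 1; 3; 19; 1; 5; 24;
2; 8; 21; 2; 16; 18; 4; 11; 13; 5; 12; 32; 6; 15; 25; 6; 27; 29; 7; 9; 18; 7; 10; 17; 8; 26; 30;
9; 16; 28; 10; 15; 20; 12; 13; 21; 14; 22; 30; 14; 26; 27; 17; 22; 25; 19; 20; 23; 23; 29; 31;
24; 28; 32]].
Lemma R_cover33 : R_cover 0 'I_33.
Proof. by apply: (@R_cover_data0 31 R_data33); vm_cast_no_check (erefl true). Qed.

Definition R_data39 := full 39 [:: [:: 0; 2; 6; 0; 29; 37; 1; 4; 27; 1; 24; 26; 2; 4; 38; 3; 7;
24; 3; 28; 30; 5; 8; 19; 5; 28; 34; 6; 9; 18; 7; 13; 25; 8; 14; 15; 9; 22; 36; 10; 17; 18; 10;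
31; 35; 11; 20; 31; 11; 23; 34; 12; 14; 33; 12; 22; 23; 13; 19; 21; 15; 21; 29; 16; 26; 36; 16;
30; 35; 17; 32; 33; 20; 32; 38; 25; 27; 37]; [:: 0; 4; 27; 0; 19; 31; 1; 15; 29; 1; 21; 33; 2;
5; 6; 2; 17; 37; 3; 10; 15; 3; 16; 32; 4; 16; 18; 5; 14; 17; 6; 23; 26; 7; 18; 22; 7; 23; 37; 8;
12; 33; 8; 26; 32; 9; 12; 20; 9; 21; 24; 10; 20; 38; 11; 14; 36; 11; 24; 34; 13; 19; 36; 13; 22;
35; 25; 28; 34; 25; 31; 35; 27; 29; 30; 28; 30; 38]; [:: 0; 5; 35; 0; 26; 31; 1; 11; 31; 1; 14;
18; 2; 14; 28; 2; 21; 34; 3; 4; 20; 3; 13; 24; 4; 8; 11; 5; 9; 27; 6; 16; 21; 6; 23; 36; 7; 12;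
35; 7; 17; 25; 8; 10; 17; 9; 16; 37; 10; 15; 30; 12; 22; 37; 13; 15; 38; 18; 23; 32; 19; 20; 33;
19; 22; 34; 24; 28; 29; 25; 26; 30; 27; 32; 33; 29; 36; 38]; [:: 0; 14; 34; 0; 16; 35; 1; 3; 9;
1; 8; 19; 2; 5; 36; 2; 15; 21; 3; 11; 16; 4; 22; 31; 4; 29; 33; 5; 20; 30; 6; 10; 37; 6; 12; 18;
7; 9; 36; 7; 22; 24; 8; 10; 23; 11; 27; 38; 12; 14; 29; 13; 20; 34; 13; 24; 25; 15; 19; 26; 17;
23; 28; 17; 30; 31; 18; 21; 37; 25; 32; 35; 26; 27; 33; 28; 32; 38]; [:: 0; 14; 15; 0; 17; 24;
1; 19; 34; 1; 33; 36; 2; 8; 19; 2; 28; 35; 3; 13; 37; 3; 16; 18; 4; 12; 25; 4; 28; 36; 5; 16;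
29; 5; 20; 24; 6; 11; 15; 6; 13; 22; 7; 9; 27; 7; 25; 37; 8; 29; 31; 9; 21; 33; 10; 20; 32; 10;
30; 31; 11; 12; 14; 17; 23; 30; 18; 26; 38; 21; 22; 34; 23; 32; 38; 26; 27; 35]; [:: 0; 6; 22;
0; 20; 30; 1; 9; 31; 1; 21; 38; 2; 7; 14; 2; 26; 27; 3; 5; 33; 3; 18; 31; 4; 7; 17; 4; 10; 29;
5; 11; 24; 6; 23; 37; 8; 11; 18; 8; 12; 38; 9; 25; 27; 10; 13; 33; 12; 28; 36; 13; 34; 37; 14;
34; 36; 15; 16; 26; 15; 20; 32; 16; 19; 24; 17; 22; 35; 19; 29; 32; 21; 30; 35; 23; 25; 28]; [::
0; 27; 28; 0; 29; 34; 1; 11; 17; 1; 16; 19; 2; 5; 30; 2; 6; 31; 3; 22; 37; 3; 27; 33; 4; 9; 11;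
4; 12; 23; 5; 8; 38; 6; 18; 23; 7; 16; 35; 7; 20; 25; 8; 10; 36; 9; 15; 29; 10; 14; 26; 12; 21;
30; 13; 15; 17; 13; 28; 37; 14; 21; 31; 18; 19; 20; 22; 26; 35; 24; 25; 34; 24; 32; 38; 32; 33;
36]; [:: 0; 20; 27; 0; 23; 28; 1; 10; 17; 1; 11; 32; 2; 9; 22; 2; 18; 33; 3; 5; 38; 3; 13; 30;
4; 13; 35; 4; 21; 29; 5; 12; 34; 6; 7; 26; 6; 23; 38; 7; 20; 28; 8; 15; 31; 8; 16; 24; 9; 25;
29; 10; 26; 27; 11; 34; 37; 12; 30; 35; 14; 21; 25; 14; 33; 36; 15; 18; 32; 16; 19; 22; 17; 24;
31; 19; 36; 37]; [:: 0; 11; 37; 0; 18; 34; 1; 4; 22; 1; 7; 35; 2; 4; 9; 2; 16; 32; 3; 10; 28; 3;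
14; 38; 5; 9; 13; 5; 27; 31; 6; 7; 24; 6; 17; 25; 8; 16; 19; 8; 36; 38; 10; 22; 23; 11; 29; 30;
12; 19; 27; 12; 29; 34; 13; 24; 30; 14; 15; 20; 15; 26; 37; 17; 18; 33; 20; 21; 28; 21; 25; 33;
23; 31; 32; 26; 35; 36]].
Lemma R_cover39 : R_cover 1 'I_39.
Proof.
by apply: (@R_cover_data1 38 R_data39 [seq [:: i; i + 13; i + 26] | i <- iota 0 13]);
  vm_cast_no_check (erefl true).
Qed.

Definition R_data51 := full 51 [:: [:: 0; 5; 20; 0; 7; 9; 1; 6; 19; 1; 49; 50; 2; 17; 23; 2; 38;
42; 3; 7; 41; 3; 39; 42; 4; 15; 25; 4; 22; 35; 5; 19; 24; 6; 29; 32; 8; 9; 33; 8; 34; 46; 10;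
18; 34; 10; 21; 26; 11; 13; 28; 11; 22; 43; 12; 26; 41; 12; 36; 40; 13; 44; 47; 14; 27; 45; 14;
30; 48; 15; 20; 31; 16; 24; 37; 16; 29; 39; 17; 43; 45; 18; 23; 48; 21; 27; 46; 25; 35; 50; 28;
31; 36; 30; 32; 38; 33; 40; 47; 37; 44; 49]; [:: 0; 18; 41; 0; 45; 49; 1; 10; 15; 1; 16; 20; 2;
22; 43; 2; 31; 36; 3; 18; 50; 3; 28; 30; 4; 5; 24; 4; 23; 35; 5; 6; 15; 6; 9; 12; 7; 25; 34; 7;
32; 47; 8; 10; 12; 8; 19; 48; 9; 14; 17; 11; 20; 26; 11; 27; 40; 13; 28; 49; 13; 33; 36; 14; 30;
42; 16; 25; 37; 17; 44; 46; 19; 32; 43; 21; 24; 33; 21; 39; 41; 22; 44; 50; 23; 38; 40; 26; 27;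
31; 29; 37; 39; 29; 47; 48; 34; 38; 45; 35; 42; 46]; [:: 0; 6; 19; 0; 7; 30; 1; 2; 16; 1; 25;
35; 2; 4; 5; 3; 15; 37; 3; 36; 48; 4; 34; 44; 5; 10; 18; 6; 40; 49; 7; 14; 33; 8; 12; 28; 8; 20;
32; 9; 28; 35; 9; 40; 48; 10; 34; 45; 11; 17; 27; 11; 33; 42; 12; 13; 29; 13; 15; 43; 14; 26;
42; 16; 31; 49; 17; 30; 44; 18; 36; 43; 19; 27; 38; 20; 24; 50; 21; 22; 47; 21; 29; 39; 22; 31;
46; 23; 37; 45; 23; 46; 47; 24; 25; 38; 26; 32; 41; 39; 41; 50]; [:: 0; 10; 48; 0; 15; 28; 1;
24; 31; 1; 30; 33; 2; 12; 49; 2; 22; 30; 3; 13; 37; 3; 18; 42; 4; 10; 16; 4; 23; 44; 5; 24; 39;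
5; 32; 42; 6; 7; 50; 6; 18; 20; 7; 17; 19; 8; 14; 16; 8; 26; 38; 9; 11; 40; 9; 45; 47; 11; 27;
35; 12; 21; 44; 13; 14; 36; 15; 34; 40; 17; 23; 48; 19; 29; 38; 20; 21; 31; 22; 37; 47; 25; 35;
41; 25; 36; 49; 26; 27; 32; 28; 34; 46; 29; 43; 45; 33; 43; 50; 39; 41; 46]; [:: 0; 9; 35; 0;
27; 48; 1; 7; 47; 1; 33; 45; 2; 7; 37; 2; 8; 28; 3; 12; 43; 3; 36; 39; 4; 6; 26; 4; 9; 23; 5;
16; 38; 5; 47; 49; 6; 14; 19; 8; 22; 35; 10; 11; 32; 10; 22; 25; 11; 46; 50; 12; 18; 42; 13; 17;
38; 13; 40; 41; 14; 17; 24; 15; 25; 44; 15; 27; 28; 16; 30; 33; 18; 19; 50; 20; 31; 37; 20; 42;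
44; 21; 24; 26; 21; 29; 36; 23; 30; 45; 29; 34; 41; 31; 39; 40; 32; 34; 46; 43; 48; 49]; [:: 0;
8; 32; 0; 20; 40; 1; 11; 19; 1; 27; 49; 2; 10; 14; 2; 18; 50; 3; 5; 31; 3; 29; 34; 4; 10; 38; 4;
12; 42; 5; 23; 48; 6; 21; 41; 6; 24; 28; 7; 14; 30; 7; 26; 45; 8; 13; 36; 9; 23; 44; 9; 26; 28;
11; 22; 25; 12; 15; 46; 13; 33; 45; 15; 31; 35; 16; 30; 46; 16; 40; 47; 17; 20; 42; 17; 32; 35;
18; 24; 38; 19; 43; 49; 21; 25; 29; 22; 34; 39; 27; 33; 44; 36; 39; 43; 37; 41; 50; 37; 47; 48];
[:: 0; 28; 44; 0; 29; 45; 1; 16; 41; 1; 19; 22; 2; 5; 37; 2; 47; 49; 3; 12; 16; 3; 27; 47; 4;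
20; 40; 4; 21; 35; 5; 6; 21; 6; 10; 24; 7; 18; 32; 7; 34; 37; 8; 13; 42; 8; 31; 40; 9; 11; 41;
9; 28; 42; 10; 23; 35; 11; 14; 43; 12; 14; 33; 13; 22; 38; 15; 18; 31; 15; 48; 50; 17; 25; 46;
17; 29; 39; 19; 30; 32; 20; 23; 24; 25; 34; 45; 26; 30; 38; 26; 36; 46; 27; 39; 43; 33; 36; 50;
44; 48; 49]; [:: 0; 4; 31; 0; 5; 47; 1; 18; 27; 1; 20; 30; 2; 13; 30; 2; 33; 35; 3; 14; 26; 3;
22; 40; 4; 8; 45; 5; 11; 16; 6; 21; 29; 6; 24; 50; 7; 17; 38; 7; 42; 44; 8; 19; 23; 9; 11; 36;
9; 23; 27; 10; 15; 39; 10; 37; 43; 12; 13; 50; 12; 32; 41; 14; 18; 24; 15; 28; 44; 16; 33; 46;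
17; 39; 40; 19; 34; 48; 20; 37; 38; 21; 41; 46; 22; 25; 49; 25; 26; 32; 28; 43; 48; 29; 42; 49;
31; 36; 45; 34; 35; 47]; [:: 0; 36; 43; 0; 39; 50; 1; 7; 15; 1; 11; 50; 2; 3; 21; 2; 32; 39; 3;
16; 19; 4; 6; 27; 4; 7; 13; 5; 17; 42; 5; 22; 49; 6; 33; 37; 8; 18; 41; 8; 26; 48; 9; 20; 43; 9;
21; 35; 10; 29; 46; 10; 38; 44; 11; 34; 47; 12; 29; 49; 12; 42; 48; 13; 31; 36; 14; 28; 38; 14;
30; 41; 15; 20; 22; 16; 27; 34; 17; 24; 37; 18; 26; 40; 19; 33; 47; 23; 31; 40; 23; 44; 45; 24;
25; 45; 25; 28; 46; 30; 32; 35]; [:: 0; 22; 26; 0; 25; 41; 1; 4; 27; 1; 9; 31; 2; 7; 43; 2; 16;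
17; 3; 8; 20; 3; 12; 26; 4; 10; 42; 5; 13; 48; 5; 33; 38; 6; 12; 50; 6; 19; 47; 7; 19; 27; 8;
36; 50; 9; 15; 18; 10; 24; 35; 11; 13; 21; 11; 23; 40; 14; 23; 44; 14; 30; 32; 15; 28; 45; 16;
34; 40; 17; 45; 49; 18; 25; 34; 20; 24; 48; 21; 30; 47; 22; 29; 32; 28; 37; 46; 29; 35; 39; 31;
41; 44; 33; 42; 49; 36; 37; 38; 39; 43; 46]; [:: 0; 19; 23; 0; 30; 47; 1; 11; 45; 1; 17; 47; 2;
9; 21; 2; 28; 36; 3; 5; 22; 3; 18; 19; 4; 13; 43; 4; 14; 50; 5; 12; 41; 6; 30; 35; 6; 46; 49; 7;
8; 38; 7; 11; 28; 8; 16; 48; 9; 24; 33; 10; 29; 45; 10; 44; 48; 12; 21; 31; 13; 17; 39; 14; 36;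
43; 15; 20; 39; 15; 25; 41; 16; 32; 49; 18; 31; 40; 20; 27; 38; 22; 26; 44; 23; 35; 46; 24; 29;
50; 25; 26; 34; 27; 40; 42; 32; 37; 42; 33; 34; 37]; [:: 0; 8; 27; 0; 31; 45; 1; 9; 15; 1; 12;
50; 2; 3; 20; 2; 39; 42; 3; 4; 30; 4; 43; 44; 5; 10; 43; 5; 30; 48; 6; 14; 34; 6; 18; 47; 7; 10;
50; 7; 13; 29; 8; 32; 41; 9; 37; 40; 11; 17; 39; 11; 26; 38; 12; 21; 23; 13; 21; 36; 14; 15; 49;
16; 25; 28; 16; 37; 49; 17; 18; 25; 19; 24; 28; 19; 36; 44; 20; 33; 46; 22; 31; 32; 22; 41; 46;
23; 40; 47; 24; 38; 45; 26; 35; 48; 27; 33; 34; 29; 35; 42]].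
Lemma R_cover51 : R_cover 1 'I_51.
Proof.
by apply: (@R_cover_data1 50 R_data51 [seq [:: i; i + 17; i + 34] | i <- iota 0 17]);
  vm_cast_no_check (erefl true).
Qed.

Definition R_data69 := full 67 [:: [:: 0; 23; 64; 0; 36; 59; 1; 28; 54; 1; 33; 47; 2; 4; 6; 2;
15; 39; 3; 19; 52; 3; 21; 26; 4; 24; 66; 5; 27; 66; 5; 41; 44; 6; 19; 63; 7; 11; 62; 7; 17; 35;
8; 12; 21; 8; 37; 49; 9; 16; 58; 9; 56; 59; 10; 29; 49; 10; 41; 42; 11; 45; 67; 12; 18; 35; 13;
34; 53; 13; 64; 68; 14; 32; 55; 14; 47; 51; 15; 50; 54; 16; 31; 36; 17; 34; 48; 18; 40; 52; 20;
25; 65; 20; 29; 30; 22; 23; 44; 22; 38; 40; 24; 50; 68; 25; 27; 31; 26; 42; 62; 28; 32; 61; 30;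
37; 45; 33; 46; 53; 38; 43; 48; 39; 43; 51; 46; 60; 65; 55; 56; 57; 57; 63; 67; 58; 60; 61]; [::
0; 1; 27; 0; 10; 24; 1; 40; 52; 2; 18; 28; 2; 45; 62; 3; 5; 46; 3; 7; 67; 4; 47; 56; 4; 54; 58;
5; 22; 48; 6; 12; 41; 6; 24; 28; 7; 16; 64; 8; 17; 25; 8; 50; 60; 9; 33; 39; 9; 57; 63; 10; 46;
55; 11; 21; 51; 11; 23; 44; 12; 30; 45; 13; 19; 37; 13; 26; 34; 14; 34; 61; 14; 35; 50; 15; 19;
21; 15; 41; 52; 16; 31; 68; 17; 27; 66; 18; 62; 66; 20; 26; 38; 20; 36; 61; 22; 25; 44; 23; 53;
57; 29; 38; 40; 29; 42; 60; 30; 35; 51; 31; 39; 48; 32; 55; 67; 32; 59; 63; 33; 43; 59; 36; 49;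
64; 37; 53; 54; 42; 43; 65; 47; 58; 68; 49; 56; 65]; [:: 0; 9; 45; 0; 16; 35; 1; 22; 31; 1; 29;
40; 2; 9; 40; 2; 31; 47; 3; 10; 62; 3; 20; 50; 4; 24; 63; 4; 26; 64; 5; 20; 61; 5; 44; 68; 6; 7;
51; 6; 13; 23; 7; 16; 44; 8; 27; 58; 8; 34; 66; 10; 13; 35; 11; 14; 67; 11; 42; 57; 12; 25; 41;
12; 34; 42; 14; 17; 43; 15; 19; 46; 15; 30; 48; 17; 60; 68; 18; 25; 36; 18; 51; 54; 19; 27; 39;
21; 22; 59; 21; 32; 39; 23; 56; 64; 24; 33; 49; 26; 28; 37; 28; 54; 55; 29; 43; 55; 30; 59; 61;
32; 45; 47; 33; 38; 57; 36; 66; 67; 37; 52; 65; 38; 62; 65; 41; 52; 53; 46; 50; 56; 48; 58; 60;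
49; 53; 63]; [:: 0; 19; 53; 0; 47; 67; 1; 7; 56; 1; 25; 46; 2; 35; 60; 2; 37; 59; 3; 30; 53; 3;
39; 55; 4; 20; 33; 4; 44; 68; 5; 18; 41; 5; 43; 58; 6; 17; 19; 6; 30; 48; 7; 42; 43; 8; 14; 28;
8; 45; 68; 9; 16; 64; 9; 45; 66; 10; 18; 34; 10; 29; 54; 11; 14; 21; 11; 54; 61; 12; 21; 61; 12;
41; 50; 13; 16; 22; 13; 27; 37; 15; 23; 57; 15; 51; 67; 17; 59; 65; 20; 51; 58; 22; 24; 56; 23;
29; 55; 24; 44; 49; 25; 47; 50; 26; 31; 42; 26; 36; 63; 27; 32; 63; 28; 38; 57; 31; 62; 64; 32;
52; 60; 33; 34; 39; 35; 36; 38; 40; 46; 62; 40; 52; 66; 48; 49; 65]; [:: 0; 1; 35; 0; 39; 43; 1;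
39; 62; 2; 11; 34; 2; 40; 67; 3; 18; 28; 3; 23; 27; 4; 31; 59; 4; 49; 54; 5; 12; 31; 5; 52; 59;
6; 22; 36; 6; 40; 57; 7; 19; 58; 7; 25; 28; 8; 12; 56; 8; 33; 37; 9; 23; 65; 9; 26; 37; 10; 22;
53; 10; 32; 51; 11; 45; 48; 13; 20; 38; 13; 30; 50; 14; 42; 66; 14; 60; 68; 15; 17; 25; 15; 46;
64; 16; 27; 45; 16; 52; 63; 17; 41; 63; 18; 48; 66; 19; 26; 53; 20; 24; 47; 21; 29; 51; 21; 41;
56; 24; 49; 65; 29; 30; 60; 32; 42; 67; 33; 47; 55; 34; 50; 55; 35; 44; 58; 36; 54; 68; 38; 44;
64; 43; 57; 61; 46; 61; 62]; [:: 0; 14; 63; 0; 36; 55; 1; 3; 68; 1; 60; 66; 2; 7; 59; 2; 35; 51;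
3; 27; 62; 4; 27; 42; 4; 59; 68; 5; 6; 67; 5; 28; 65; 6; 29; 43; 7; 35; 41; 8; 21; 40; 8; 55;
64; 9; 11; 49; 9; 50; 58; 10; 13; 14; 10; 37; 45; 11; 52; 56; 12; 22; 56; 12; 39; 53; 13; 24;
48; 15; 20; 58; 15; 24; 37; 16; 25; 34; 16; 51; 66; 17; 31; 67; 17; 46; 54; 18; 21; 33; 18; 38;
40; 19; 52; 57; 19; 62; 64; 20; 32; 44; 22; 36; 53; 23; 26; 61; 23; 44; 49; 25; 30; 43; 26; 48;
54; 28; 38; 60; 29; 30; 47; 31; 50; 63; 32; 33; 41; 34; 45; 61; 39; 46; 47; 42; 57; 65]; [:: 0;
10; 22; 0; 11; 24; 1; 9; 47; 1; 35; 56; 2; 13; 35; 2; 31; 68; 3; 28; 64; 3; 32; 38; 4; 19; 34;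
4; 30; 64; 5; 39; 61; 5; 41; 51; 6; 8; 18; 6; 15; 61; 7; 21; 43; 7; 30; 59; 8; 16; 44; 9; 13;
17; 10; 12; 54; 11; 20; 67; 12; 46; 51; 14; 24; 53; 14; 26; 27; 15; 49; 57; 16; 62; 63; 17; 21;
22; 18; 41; 62; 19; 48; 59; 20; 33; 37; 23; 40; 52; 23; 53; 58; 25; 44; 66; 25; 45; 55; 26; 38;
43; 27; 29; 56; 28; 33; 42; 29; 57; 60; 31; 36; 50; 32; 34; 52; 36; 49; 55; 37; 42; 50; 39; 58;
67; 40; 65; 66; 45; 47; 63; 46; 48; 65; 54; 60; 68]; [:: 0; 27; 59; 0; 51; 67; 1; 24; 33; 1; 29;
45; 2; 27; 46; 2; 41; 48; 3; 8; 63; 3; 26; 65; 4; 6; 11; 4; 31; 62; 5; 16; 22; 5; 18; 44; 6; 8;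
15; 7; 28; 46; 7; 34; 58; 9; 20; 56; 9; 37; 66; 10; 35; 65; 10; 55; 62; 11; 29; 35; 12; 19; 47;
12; 21; 55; 13; 31; 42; 13; 39; 41; 14; 19; 58; 14; 24; 49; 15; 36; 52; 16; 30; 32; 17; 54; 57;
17; 59; 61; 18; 30; 40; 20; 32; 51; 21; 37; 53; 22; 36; 64; 23; 25; 28; 23; 44; 57; 25; 38; 47;
26; 67; 68; 33; 43; 60; 34; 52; 53; 38; 43; 64; 39; 40; 68; 42; 50; 61; 45; 54; 66; 48; 60; 63;
49; 50; 56]; [:: 0; 1; 59; 0; 20; 32; 1; 23; 38; 2; 4; 51; 2; 33; 37; 3; 18; 51; 3; 44; 53; 4;
11; 61; 5; 6; 13; 5; 34; 59; 6; 31; 42; 7; 30; 57; 7; 39; 61; 8; 13; 17; 8; 35; 46; 9; 14; 39;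
9; 43; 44; 10; 21; 64; 10; 28; 60; 11; 22; 47; 12; 19; 25; 12; 24; 54; 14; 25; 37; 15; 18; 32;
15; 41; 62; 16; 30; 36; 16; 50; 66; 17; 29; 58; 19; 63; 68; 20; 23; 26; 21; 22; 26; 24; 45; 62;
27; 46; 60; 27; 49; 68; 28; 50; 64; 29; 42; 56; 31; 34; 36; 33; 54; 57; 35; 43; 67; 38; 49; 53;
40; 52; 65; 40; 55; 67; 41; 48; 52; 45; 55; 58; 47; 56; 66; 48; 63; 65]; [:: 0; 3; 47; 0; 40;
60; 1; 3; 18; 1; 27; 34; 2; 14; 54; 2; 34; 37; 4; 19; 43; 4; 27; 31; 5; 6; 35; 5; 22; 55; 6; 41;
55; 7; 14; 39; 7; 21; 36; 8; 28; 49; 8; 50; 68; 9; 11; 23; 9; 29; 43; 10; 26; 35; 10; 32; 67;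
11; 17; 57; 12; 20; 22; 12; 25; 53; 13; 17; 33; 13; 38; 60; 15; 21; 56; 15; 62; 63; 16; 36; 65;
16; 46; 61; 18; 41; 57; 19; 37; 51; 20; 33; 45; 23; 48; 58; 24; 29; 30; 24; 39; 42; 25; 28; 52;
26; 38; 40; 30; 42; 50; 31; 58; 67; 32; 59; 62; 44; 51; 63; 44; 52; 66; 45; 56; 64; 46; 49; 65;
47; 54; 61; 48; 53; 68; 59; 64; 66]; [:: 0; 13; 43; 0; 23; 34; 1; 15; 68; 1; 52; 62; 2; 13; 58;
2; 23; 66; 3; 8; 14; 3; 44; 46; 4; 28; 48; 4; 44; 61; 5; 33; 34; 5; 39; 49; 6; 47; 65; 6; 51;
53; 7; 40; 54; 7; 45; 49; 8; 21; 26; 9; 10; 66; 9; 22; 67; 10; 56; 63; 11; 12; 27; 11; 37; 67;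
12; 30; 52; 14; 28; 57; 15; 17; 31; 16; 19; 24; 16; 58; 59; 17; 41; 42; 18; 32; 45; 18; 35; 37;
19; 62; 63; 20; 26; 31; 20; 36; 40; 21; 35; 38; 22; 25; 43; 24; 59; 64; 25; 33; 64; 27; 51; 55;
29; 36; 60; 29; 48; 54; 30; 39; 60; 32; 46; 53; 38; 41; 68; 42; 47; 50; 50; 56; 57; 55; 61; 65];
[:: 0; 13; 64; 0; 35; 37; 1; 26; 55; 1; 46; 61; 2; 29; 56; 2; 59; 60; 3; 4; 51; 3; 16; 50; 4; 5;
8; 5; 29; 62; 6; 34; 67; 6; 39; 52; 7; 18; 28; 7; 45; 54; 8; 17; 49; 9; 18; 48; 9; 26; 58; 10;
27; 67; 10; 44; 68; 11; 21; 31; 11; 40; 57; 12; 14; 45; 12; 20; 41; 13; 19; 47; 14; 23; 41; 15;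
22; 57; 15; 53; 59; 16; 33; 64; 17; 22; 65; 19; 28; 68; 20; 24; 42; 21; 30; 54; 23; 25; 62; 24;
35; 40; 25; 44; 60; 27; 42; 46; 30; 47; 52; 31; 43; 66; 32; 50; 63; 32; 58; 61; 33; 56; 63; 34;
38; 43; 36; 38; 49; 36; 55; 66; 37; 51; 65; 39; 48; 53]; [:: 0; 1; 34; 0; 21; 42; 1; 40; 41; 2;
11; 30; 2; 13; 45; 3; 24; 38; 3; 30; 31; 4; 16; 44; 4; 58; 59; 5; 9; 51; 5; 13; 28; 6; 20; 36;
6; 45; 47; 7; 10; 35; 7; 49; 63; 8; 14; 66; 8; 18; 56; 9; 14; 44; 10; 15; 41; 11; 48; 54; 12;
31; 50; 12; 56; 61; 15; 17; 50; 16; 34; 61; 17; 21; 55; 18; 33; 53; 19; 38; 62; 19; 40; 67; 20;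
27; 59; 22; 26; 63; 22; 42; 60; 23; 26; 36; 23; 39; 60; 24; 49; 52; 25; 29; 32; 25; 37; 67; 27;
28; 46; 29; 35; 65; 32; 48; 55; 33; 46; 68; 37; 57; 58; 39; 62; 65; 43; 51; 57; 43; 64; 66; 47;
54; 68; 52; 53; 64]; [:: 0; 40; 56; 0; 41; 54; 1; 26; 41; 1; 47; 66; 2; 6; 47; 2; 40; 60; 3; 18;
24; 3; 28; 61; 4; 51; 68; 4; 59; 65; 5; 12; 63; 5; 22; 30; 6; 29; 59; 7; 24; 52; 7; 26; 54; 8;
9; 23; 8; 42; 48; 9; 34; 39; 10; 12; 25; 10; 14; 49; 11; 17; 53; 11; 48; 58; 13; 19; 28; 13; 30;
45; 14; 15; 58; 15; 55; 61; 16; 20; 31; 16; 44; 62; 17; 21; 68; 18; 43; 60; 19; 36; 37; 20; 53;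
64; 21; 50; 64; 22; 34; 66; 23; 37; 62; 25; 35; 43; 27; 38; 57; 27; 42; 51; 29; 36; 39; 31; 32;
45; 32; 57; 67; 33; 44; 65; 33; 50; 56; 35; 46; 55; 38; 46; 49; 52; 63; 67]; [:: 0; 4; 11; 0;
35; 38; 1; 4; 55; 1; 10; 49; 2; 32; 35; 2; 33; 43; 3; 11; 44; 3; 63; 67; 5; 9; 29; 5; 22; 61; 6;
23; 32; 6; 25; 46; 7; 8; 44; 7; 21; 30; 8; 45; 58; 9; 53; 56; 10; 39; 61; 12; 13; 23; 12; 19;
52; 13; 21; 50; 14; 26; 43; 14; 42; 59; 15; 27; 47; 15; 36; 37; 16; 57; 58; 16; 62; 66; 17; 22;
56; 17; 37; 53; 18; 30; 54; 18; 49; 68; 19; 28; 59; 20; 28; 33; 20; 40; 64; 24; 29; 62; 24; 47;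
60; 25; 38; 48; 26; 63; 65; 27; 34; 54; 31; 46; 65; 31; 50; 57; 34; 36; 55; 39; 51; 66; 40; 42;
67; 41; 45; 60; 41; 51; 68; 48; 52; 64]; [:: 0; 3; 36; 0; 9; 13; 1; 12; 56; 1; 39; 61; 2; 14;
32; 2; 17; 66; 3; 15; 65; 4; 22; 48; 4; 63; 68; 5; 22; 46; 5; 24; 27; 6; 8; 29; 6; 14; 27; 7;
17; 28; 7; 26; 68; 8; 10; 53; 9; 25; 28; 10; 40; 59; 11; 16; 23; 11; 18; 34; 12; 36; 44; 13; 16;
20; 15; 31; 55; 18; 33; 49; 19; 49; 51; 19; 52; 64; 20; 37; 41; 21; 43; 66; 21; 58; 62; 23; 31;
35; 24; 50; 65; 25; 41; 47; 26; 32; 39; 29; 33; 54; 30; 51; 58; 30; 57; 62; 34; 54; 60; 35; 52;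
55; 37; 42; 57; 38; 43; 67; 38; 44; 47; 40; 46; 56; 42; 60; 67; 45; 48; 59; 45; 53; 63; 50; 61;
64]; [:: 0; 6; 14; 0; 31; 63; 1; 12; 62; 1; 25; 35; 2; 27; 54; 2; 42; 61; 3; 15; 52; 3; 54; 62;
4; 26; 66; 4; 38; 51; 5; 8; 16; 5; 41; 65; 6; 13; 43; 7; 8; 36; 7; 32; 50; 9; 35; 40; 9; 44; 65;
10; 23; 60; 10; 36; 46; 11; 13; 19; 11; 51; 59; 12; 18; 49; 14; 50; 52; 15; 20; 30; 16; 22; 37;
17; 26; 29; 17; 57; 59; 18; 53; 67; 19; 44; 64; 20; 45; 47; 21; 27; 61; 21; 45; 67; 22; 58; 66;
23; 53; 64; 24; 31; 33; 24; 40; 48; 25; 60; 68; 28; 33; 57; 28; 41; 63; 29; 39; 43; 30; 38; 55;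
32; 47; 58; 34; 37; 46; 34; 48; 49; 39; 56; 68; 42; 55; 56]].
Lemma R_cover69 : R_cover 0 'I_69.
Proof. by apply: (@R_cover_data0 67 R_data69); vm_cast_no_check (erefl true). Qed.

Definition R_data75 := full 75 [:: [:: 0; 29; 66; 0; 53; 58; 1; 10; 63; 1; 44; 74; 2; 8; 14; 2;
33; 55; 3; 9; 55; 3; 31; 35; 4; 36; 68; 4; 51; 57; 5; 27; 50; 5; 48; 63; 6; 16; 56; 6; 43; 70;
7; 17; 72; 7; 21; 56; 8; 11; 52; 9; 54; 64; 10; 21; 42; 11; 43; 72; 12; 25; 28; 12; 26; 53; 13;
18; 44; 13; 23; 73; 14; 15; 27; 15; 59; 61; 16; 34; 73; 17; 41; 47; 18; 51; 71; 19; 40; 65; 19;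
45; 54; 20; 29; 65; 20; 31; 41; 22; 34; 68; 22; 52; 69; 23; 39; 40; 24; 59; 66; 24; 67; 70; 25;
32; 67; 26; 35; 39; 28; 38; 71; 30; 46; 69; 30; 47; 49; 32; 37; 58; 33; 45; 74; 36; 46; 61; 37;
49; 60; 38; 62; 64; 42; 60; 62; 48; 50; 57]; [:: 0; 29; 37; 0; 36; 71; 1; 10; 51; 1; 26; 59; 2;
12; 57; 2; 22; 73; 3; 21; 71; 3; 28; 47; 4; 5; 52; 4; 49; 63; 5; 19; 50; 6; 18; 48; 6; 31; 44;
7; 16; 61; 7; 42; 47; 8; 22; 29; 8; 24; 35; 9; 32; 58; 9; 36; 50; 10; 20; 42; 11; 12; 33; 11;
25; 27; 13; 38; 41; 13; 40; 45; 14; 38; 57; 14; 61; 65; 15; 34; 51; 15; 43; 68; 16; 54; 65; 17;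
28; 35; 17; 30; 49; 18; 23; 45; 19; 64; 72; 20; 43; 60; 21; 23; 62; 24; 46; 66; 25; 53; 70; 26;
69; 74; 27; 66; 68; 30; 34; 53; 31; 32; 55; 33; 62; 63; 37; 55; 67; 39; 44; 48; 39; 54; 56; 40;
60; 72; 41; 67; 74; 46; 69; 70; 52; 58; 73; 56; 59; 64]; [:: 0; 24; 48; 0; 32; 70; 1; 16; 31; 1;
38; 73; 2; 6; 61; 2; 20; 49; 3; 17; 43; 3; 22; 67; 4; 7; 11; 4; 39; 56; 5; 51; 61; 5; 72; 73; 6;
10; 25; 7; 15; 27; 8; 39; 47; 8; 49; 60; 9; 13; 70; 9; 37; 50; 10; 69; 72; 11; 12; 53; 12; 25;
40; 13; 24; 33; 14; 22; 68; 14; 41; 45; 15; 53; 57; 16; 19; 27; 17; 23; 65; 18; 21; 37; 18; 59;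
63; 19; 31; 71; 20; 42; 43; 21; 52; 67; 23; 41; 68; 26; 35; 50; 26; 40; 54; 28; 52; 66; 28; 54;
59; 29; 34; 35; 29; 45; 63; 30; 33; 48; 30; 36; 74; 32; 58; 74; 34; 42; 65; 36; 55; 62; 38; 55;
71; 44; 57; 58; 44; 64; 69; 46; 47; 64; 46; 51; 60; 56; 62; 66]; [:: 0; 5; 16; 0; 8; 65; 1; 7;
64; 1; 30; 63; 2; 13; 63; 2; 34; 50; 3; 11; 37; 3; 57; 73; 4; 46; 50; 4; 62; 68; 5; 14; 74; 6;
39; 64; 6; 53; 68; 7; 45; 48; 8; 56; 70; 9; 12; 32; 9; 25; 28; 10; 22; 38; 10; 40; 44; 11; 55;
71; 12; 70; 72; 13; 21; 39; 14; 51; 67; 15; 19; 61; 15; 29; 69; 16; 27; 60; 17; 43; 65; 17; 47;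
48; 18; 20; 58; 18; 24; 41; 19; 21; 27; 20; 31; 73; 22; 33; 36; 23; 25; 52; 23; 40; 59; 24; 51;
59; 26; 35; 66; 26; 52; 71; 28; 62; 72; 29; 41; 54; 30; 31; 32; 33; 56; 74; 34; 43; 45; 35; 49;
67; 36; 42; 60; 37; 38; 58; 42; 46; 47; 44; 53; 61; 49; 54; 66; 55; 57; 69]; [:: 0; 11; 31; 0;
24; 63; 1; 3; 53; 1; 12; 13; 2; 12; 61; 2; 19; 67; 3; 49; 69; 4; 16; 41; 4; 42; 57; 5; 6; 37; 5;
28; 62; 6; 9; 60; 7; 29; 68; 7; 32; 71; 8; 18; 36; 8; 40; 41; 9; 21; 71; 10; 11; 70; 10; 25; 64;
13; 50; 54; 14; 51; 68; 14; 52; 66; 15; 18; 40; 15; 44; 69; 16; 22; 62; 17; 58; 59; 17; 70; 74;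
19; 38; 42; 20; 36; 73; 20; 48; 54; 21; 49; 72; 22; 59; 66; 23; 25; 72; 23; 34; 39; 24; 27; 57;
26; 27; 51; 26; 50; 55; 28; 29; 43; 30; 31; 44; 30; 35; 43; 32; 38; 65; 33; 48; 67; 33; 58; 63;
34; 55; 56; 35; 45; 46; 37; 45; 47; 39; 65; 73; 46; 61; 64; 47; 53; 74; 52; 56; 60]; [:: 0; 20;
54; 0; 31; 64; 1; 5; 37; 1; 16; 40; 2; 3; 21; 2; 4; 7; 3; 60; 67; 4; 12; 29; 5; 63; 64; 6; 24;
29; 6; 35; 52; 7; 9; 27; 8; 30; 55; 8; 41; 74; 9; 13; 71; 10; 15; 48; 10; 45; 46; 11; 22; 37;
11; 47; 49; 12; 48; 59; 13; 20; 36; 14; 42; 71; 14; 54; 70; 15; 28; 68; 16; 50; 66; 17; 27; 59;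
17; 39; 42; 18; 25; 33; 18; 35; 62; 19; 26; 69; 19; 43; 72; 21; 69; 73; 22; 34; 65; 23; 25; 53;
23; 36; 43; 24; 33; 52; 26; 46; 73; 28; 44; 57; 30; 63; 66; 31; 40; 70; 32; 51; 67; 32; 55; 58;
34; 39; 49; 38; 45; 51; 38; 57; 58; 41; 44; 72; 47; 50; 68; 53; 60; 61; 56; 61; 74; 56; 62; 65];
[:: 0; 1; 27; 0; 20; 34; 1; 31; 58; 2; 41; 56; 2; 46; 55; 3; 23; 61; 3; 28; 30; 4; 15; 37; 4;
21; 63; 5; 17; 31; 5; 45; 57; 6; 42; 52; 6; 44; 62; 7; 25; 65; 7; 33; 43; 8; 14; 44; 8; 41; 59;
9; 33; 58; 9; 39; 55; 10; 13; 24; 10; 36; 64; 11; 18; 69; 11; 22; 24; 12; 17; 48; 12; 19; 67;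
13; 22; 61; 14; 50; 73; 15; 16; 46; 16; 27; 70; 18; 43; 51; 19; 38; 63; 20; 57; 60; 21; 52; 54;
23; 26; 71; 25; 54; 73; 26; 29; 39; 28; 47; 56; 29; 35; 72; 30; 34; 40; 32; 35; 37; 32; 59; 74;
36; 62; 65; 38; 64; 68; 40; 50; 66; 42; 49; 69; 45; 66; 68; 47; 53; 67; 48; 60; 72; 49; 51; 74;
53; 70; 71]; [:: 0; 34; 40; 0; 36; 65; 1; 6; 29; 1; 15; 73; 2; 24; 32; 2; 54; 59; 3; 9; 63; 3;
39; 57; 4; 12; 66; 4; 23; 58; 5; 16; 70; 5; 49; 64; 6; 23; 35; 7; 11; 65; 7; 22; 40; 8; 33; 51;
8; 55; 58; 9; 12; 67; 10; 19; 43; 10; 25; 30; 11; 13; 44; 13; 42; 49; 14; 17; 29; 14; 27; 44;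
15; 46; 72; 16; 26; 47; 17; 45; 54; 18; 25; 48; 18; 38; 62; 19; 22; 53; 20; 52; 74; 20; 61; 68;
21; 35; 71; 21; 41; 73; 24; 26; 45; 27; 59; 72; 28; 37; 55; 28; 56; 64; 30; 42; 61; 31; 51; 53;
31; 62; 66; 32; 36; 52; 33; 46; 69; 34; 41; 63; 37; 70; 74; 38; 48; 60; 39; 43; 68; 47; 69; 71;
50; 56; 57; 50; 60; 67]; [:: 0; 37; 68; 0; 43; 45; 1; 11; 45; 1; 21; 57; 2; 39; 72; 2; 41; 42;
3; 27; 49; 3; 44; 71; 4; 17; 35; 4; 19; 51; 5; 34; 61; 5; 44; 66; 6; 52; 53; 6; 67; 71; 7; 16;
59; 7; 73; 74; 8; 19; 49; 8; 20; 72; 9; 17; 38; 9; 33; 36; 10; 41; 62; 10; 57; 64; 11; 28; 39;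
12; 20; 67; 12; 48; 60; 13; 18; 38; 13; 32; 54; 14; 23; 30; 14; 48; 61; 15; 16; 43; 15; 36; 58;
18; 52; 55; 21; 63; 70; 22; 35; 60; 22; 64; 65; 23; 26; 53; 24; 26; 40; 24; 28; 65; 25; 56; 69;
25; 62; 73; 27; 29; 37; 29; 31; 33; 30; 40; 54; 31; 50; 68; 32; 50; 63; 34; 42; 51; 46; 55; 56;
46; 58; 59; 47; 66; 69; 47; 70; 74]; [:: 0; 37; 67; 0; 53; 59; 1; 6; 55; 1; 23; 42; 2; 9; 16; 2;
44; 56; 3; 46; 64; 3; 54; 57; 4; 12; 41; 4; 17; 71; 5; 15; 61; 5; 43; 64; 6; 24; 28; 7; 27; 46;
7; 62; 67; 8; 30; 34; 8; 36; 60; 9; 40; 58; 10; 26; 65; 10; 31; 66; 11; 13; 48; 11; 20; 32; 12;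
29; 38; 13; 38; 61; 14; 37; 60; 14; 49; 73; 15; 32; 63; 16; 30; 45; 17; 50; 52; 18; 19; 25; 18;
39; 69; 19; 65; 68; 20; 33; 54; 21; 35; 55; 21; 39; 72; 22; 40; 51; 22; 48; 63; 23; 28; 62; 24;
35; 70; 25; 50; 74; 26; 45; 56; 27; 33; 57; 29; 42; 53; 31; 41; 47; 34; 44; 69; 36; 59; 72; 43;
51; 52; 47; 49; 74; 58; 68; 71; 66; 70; 73]; [:: 0; 6; 55; 0; 7; 69; 1; 34; 73; 1; 50; 53; 2;
17; 52; 2; 41; 71; 3; 4; 60; 3; 11; 54; 4; 7; 49; 5; 18; 40; 5; 49; 63; 6; 42; 70; 8; 36; 39; 8;
53; 65; 9; 44; 57; 9; 52; 61; 10; 13; 20; 10; 24; 43; 11; 41; 51; 12; 28; 59; 12; 66; 70; 13;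
26; 31; 14; 56; 69; 14; 58; 64; 15; 23; 72; 15; 35; 66; 16; 23; 25; 16; 35; 37; 17; 44; 65; 18;
28; 30; 19; 27; 32; 19; 36; 68; 20; 30; 58; 21; 29; 48; 21; 46; 62; 22; 27; 55; 22; 39; 47; 24;
31; 40; 25; 42; 64; 26; 38; 48; 29; 37; 57; 32; 34; 45; 33; 59; 72; 33; 60; 62; 38; 47; 74; 43;
50; 67; 45; 51; 74; 46; 68; 73; 54; 61; 71; 56; 63; 67]; [:: 0; 20; 24; 0; 25; 70; 1; 9; 62; 1;
10; 52; 2; 14; 36; 2; 54; 69; 3; 22; 27; 3; 34; 43; 4; 8; 67; 4; 10; 29; 5; 38; 46; 5; 58; 65;
6; 17; 70; 6; 29; 66; 7; 11; 71; 7; 32; 64; 8; 14; 40; 9; 45; 72; 11; 35; 65; 12; 26; 51; 12;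
45; 59; 13; 26; 40; 13; 28; 32; 15; 20; 60; 15; 39; 56; 16; 34; 69; 16; 48; 57; 17; 49; 68; 18;
23; 64; 18; 38; 73; 19; 28; 42; 19; 30; 71; 21; 31; 74; 21; 37; 58; 22; 30; 36; 23; 50; 66; 24;
25; 63; 27; 43; 51; 31; 44; 50; 33; 35; 55; 33; 44; 61; 37; 48; 72; 39; 49; 54; 41; 53; 56; 41;
67; 68; 42; 46; 73; 47; 55; 63; 47; 59; 61; 52; 60; 74; 53; 57; 62]; [:: 0; 10; 23; 0; 38; 58;
1; 31; 60; 1; 37; 59; 2; 3; 49; 2; 12; 16; 3; 8; 61; 4; 11; 23; 4; 29; 49; 5; 9; 20; 5; 37; 45;
6; 7; 43; 6; 27; 33; 7; 10; 42; 8; 14; 45; 9; 27; 63; 11; 63; 65; 12; 21; 24; 13; 22; 47; 13;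
50; 51; 14; 15; 19; 15; 16; 18; 17; 25; 55; 17; 40; 54; 18; 33; 71; 19; 30; 36; 20; 32; 60; 21;
28; 62; 22; 56; 57; 24; 35; 73; 25; 48; 53; 26; 29; 65; 26; 44; 61; 28; 46; 56; 30; 66; 70; 31;
41; 71; 32; 36; 50; 34; 35; 44; 34; 52; 72; 38; 40; 53; 39; 51; 66; 39; 67; 69; 41; 62; 74; 42;
58; 70; 43; 47; 54; 46; 64; 73; 48; 52; 64; 55; 67; 74; 57; 59; 68; 68; 69; 72]; [:: 0; 14; 24;
0; 29; 69; 1; 21; 61; 1; 49; 64; 2; 15; 57; 2; 28; 48; 3; 35; 72; 3; 37; 67; 4; 34; 54; 4; 60;
62; 5; 12; 42; 5; 26; 60; 6; 31; 43; 6; 56; 65; 7; 17; 59; 7; 22; 53; 8; 11; 20; 8; 34; 64; 9;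
18; 27; 9; 22; 38; 10; 39; 74; 10; 55; 71; 11; 44; 50; 12; 41; 73; 13; 36; 57; 13; 40; 63; 14;
16; 17; 15; 28; 52; 16; 37; 70; 18; 19; 41; 19; 25; 58; 20; 31; 47; 21; 45; 55; 23; 40; 66; 23;
51; 65; 24; 73; 74; 25; 46; 59; 26; 49; 71; 27; 35; 38; 29; 53; 68; 30; 33; 36; 30; 43; 56; 32;
39; 42; 32; 46; 70; 33; 54; 61; 44; 68; 72; 45; 47; 63; 48; 66; 69; 50; 58; 62; 51; 52; 67]; [::
0; 9; 26; 0; 24; 59; 1; 15; 27; 1; 35; 70; 2; 18; 24; 2; 58; 63; 3; 4; 53; 3; 52; 54; 4; 46; 56;
5; 7; 40; 5; 20; 47; 6; 10; 18; 6; 44; 71; 7; 26; 41; 8; 14; 74; 8; 19; 63; 9; 16; 60; 10; 38;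
45; 11; 28; 41; 11; 35; 69; 12; 16; 47; 12; 43; 55; 13; 20; 73; 13; 22; 50; 14; 33; 61; 15; 54;
62; 17; 29; 70; 17; 53; 66; 19; 39; 57; 21; 28; 66; 21; 34; 72; 22; 52; 64; 23; 39; 59; 23; 62;
69; 25; 30; 37; 25; 34; 55; 27; 40; 72; 29; 49; 64; 30; 36; 38; 31; 32; 51; 31; 58; 71; 32; 48;
74; 33; 50; 65; 36; 68; 73; 37; 51; 60; 42; 43; 48; 42; 45; 46; 44; 61; 67; 49; 65; 67; 56; 57;
68]; [:: 0; 1; 30; 0; 8; 69; 1; 20; 71; 2; 19; 74; 2; 60; 72; 3; 23; 46; 3; 43; 57; 4; 10; 53;
4; 29; 40; 5; 7; 29; 5; 46; 51; 6; 10; 36; 6; 16; 25; 7; 13; 33; 8; 18; 42; 9; 16; 68; 9; 64;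
71; 11; 15; 24; 11; 44; 73; 12; 27; 36; 12; 59; 61; 13; 32; 45; 14; 23; 49; 14; 44; 74; 15; 19;
65; 17; 22; 64; 17; 37; 38; 18; 31; 41; 20; 47; 69; 21; 39; 61; 21; 52; 57; 22; 51; 54; 24; 42;
58; 25; 37; 63; 26; 34; 58; 26; 38; 73; 27; 68; 70; 28; 32; 60; 28; 35; 67; 30; 54; 65; 31; 49;
56; 33; 53; 56; 34; 66; 70; 35; 52; 66; 39; 50; 63; 40; 45; 50; 41; 43; 48; 47; 55; 62; 48; 62;
67; 55; 59; 72]; [:: 0; 8; 40; 0; 57; 65; 1; 4; 71; 1; 10; 42; 2; 13; 68; 2; 21; 27; 3; 26; 45;
3; 47; 66; 4; 41; 67; 5; 14; 24; 5; 32; 72; 6; 21; 63; 6; 28; 34; 7; 12; 73; 7; 64; 70; 8; 30;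
39; 9; 18; 68; 9; 49; 54; 10; 59; 63; 11; 20; 74; 11; 52; 69; 12; 17; 41; 13; 16; 74; 14; 46;
48; 15; 19; 69; 15; 25; 73; 16; 47; 61; 17; 23; 33; 18; 52; 67; 19; 27; 58; 20; 39; 53; 22; 50;
60; 22; 51; 71; 23; 30; 55; 24; 53; 62; 25; 49; 61; 26; 32; 60; 28; 31; 37; 29; 35; 48; 29; 37;
62; 31; 38; 66; 33; 43; 70; 34; 36; 40; 35; 42; 56; 36; 51; 65; 38; 45; 64; 43; 54; 72; 44; 46;
56; 44; 58; 59; 50; 55; 57]; [:: 0; 9; 29; 0; 40; 41; 1; 17; 60; 1; 24; 31; 2; 7; 23; 2; 12; 56;
3; 13; 39; 3; 59; 70; 4; 26; 33; 4; 50; 62; 5; 13; 24; 5; 53; 56; 6; 14; 58; 6; 21; 73; 7; 26;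
63; 8; 16; 49; 8; 28; 71; 9; 58; 73; 10; 34; 35; 10; 38; 65; 11; 48; 69; 11; 61; 72; 12; 19; 55;
14; 20; 25; 15; 28; 30; 15; 44; 46; 16; 22; 66; 17; 52; 67; 18; 23; 59; 18; 27; 40; 19; 34; 62;
20; 36; 64; 21; 42; 70; 22; 54; 57; 25; 48; 63; 27; 32; 38; 29; 66; 68; 30; 31; 74; 32; 51; 74;
33; 45; 53; 35; 39; 60; 36; 43; 67; 37; 41; 43; 37; 55; 61; 42; 49; 54; 44; 52; 68; 45; 64; 72;
46; 47; 57; 47; 50; 69; 51; 65; 71]].
Lemma R_cover75 : R_cover 1 'I_75.
Proof.
by apply: (@R_cover_data1 74 R_data75 [seq [:: i; i + 25; i + 50] | i <- iota 0 25]);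
  vm_cast_no_check (erefl true).
Qed.

(** * Iterated tripling *)

Lemma bin3E n : 'C(n, 3) * 6 = n * n.-1 * n.-2.
Proof. by rewrite -[6]/(3`!) bin_ffact !ffactnS ffactn0 muln1 mulnA. Qed.

Lemma TOC_of_R n : n %% 12 = 9 -> R_cover 0 'I_n -> TOC 3 n 5 3.
Proof.
move=> n9 [Hs [H0 [sz gH _ dH cH]]]; rewrite card_ord in sz.
apply: (@TOC_of_cover n (size Hs)); first lia.
  have [k nE] : exists k, n = 12 * k + 9 by exists (n %/ 12); lia.
  rewrite (_ : (2 * n) %/ 3 = 8 * k + 6); last lia.
  move: sz (bin3E n); move: (size Hs) 'C(n, 3) => s c sz cE.
  have h : 4 * s * n <= (n - 1) * (n - 2) * n by rewrite leq_mul2r; lia.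
  rewrite -(leq_pmul2r (isT : 0 < 6)) cE.
  rewrite (_ : s * (8 * k + 6) * 6 = 4 * s * n); last by rewrite nE; lia.
  by apply: leq_trans h _; rewrite mulnC mulnA subn1 subn2.
exists Hs; split=> // t t3; case: (cH t t3) => // tH0.
have /card_gt0P[x xt] : 0 < #|t| by rewrite t3.
by have := dH x; rewrite leqn0 => /degr0P/(_ t tH0); rewrite xt.
Qed.

Lemma TOC_of_S n : n %% 6 = 3 -> S_cover n -> TOC 3 (n + 1) 5 3.
Proof.
move=> n3 S; rewrite addn1; apply: (TOC_of_cover _ _ S); first lia.
have [k nE] : exists k, n = 6 * k + 3 by exists (n %/ 6); lia.
rewrite (_ : (2 * n.+1) %/ 3 = 4 * k + 2); last lia.
rewrite (_ : n ^ 2 - 1 = (3 * k + 1) * (3 * k + 2) * 4) ?mulnK //; last by rewrite nE; nia.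
rewrite -(leq_pmul2r (isT : 0 < 6)) bin3E nE /=; nia.
Qed.

Lemma R_cover_iter d n k : d <= 1 -> 5 <= n -> odd n -> R_cover d 'I_n ->
  R_cover (if odd k then 1 - d else d) 'I_(3 ^ k * n).
Proof.
move=> d1 n5 on Rn; elim: k => [|k IH]; first by rewrite mul1n.
set d' := if odd k then 1 - d else d in IH.
have -> : (if odd k.+1 then 1 - d else d) = 1 - d' by rewrite /d' /=; case: (odd k) => /=; lia.
have o3 : odd (3 ^ k * n) by rewrite oddM on oddX orbT.
have p3 : 0 < 3 ^ k by rewrite expn_gt0.
have g5 : 5 <= 3 ^ k * n by nia.
apply: (@R_cover_triple d' 'I_(3 ^ k * n) _ (3 ^ k * n)./2) IH; rewrite ?card_ord.
- lia.
- lia.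
- by rewrite /d'; case: (odd k); lia.
- by rewrite expnS mulnA.
Qed.

(** The blocks are thirds of a level, so [15 <= n] makes them of size at least 5. *)
Lemma S_cover_iter n k : n %% 6 = 3 -> 15 <= n -> S_cover n -> S_cover (3 ^ k * n).
Proof.
move=> n3 n15 Sn; elim: k => [|k IH]; first by rewrite mul1n.
have o3 : (3 ^ k * n) %% 6 = 3.
  elim: k {IH} => [|k IHk]; first by rewrite mul1n.
  by rewrite expnS -mulnA -modnMmr IHk.
have p3 : 0 < 3 ^ k by rewrite expn_gt0.
have g5 : 15 <= 3 ^ k * n by nia.
rewrite expnS -mulnA; apply: (@S_cover_triple _ ((3 ^ k * n) %/ 6)) IH; lia.
Qed.

(** Multiplication by 3 exchanges the residues 3 and 9 modulo 12. *)
Lemma pow3_mod12 m b : b %% 12 = (if odd m then 3 else 9) -> (3 ^ m * b) %% 12 = 9.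
Proof.
elim: m b => [|m IH] b; first by rewrite mul1n.
rewrite expnS -mulnA mulnCA => h; apply: IH; rewrite /= in h; rewrite -modnMmr h.
by case: (odd m) h.
Qed.

Lemma pow3_mod6 m b : b %% 6 = 3 -> (3 ^ m * b) %% 6 = 3.
Proof.
move=> h; elim: m => [|m IH]; first by rewrite mul1n.
by rewrite expnS -mulnA -modnMmr IH.
Qed.

Lemma TOC_iter_R d b k : d <= 1 -> 5 <= b -> b %% 12 = (if d == 0 then 9 else 3) ->
  odd k = (d == 1) -> R_cover d 'I_b -> TOC 3 (3 ^ k * b) 5 3.
Proof.
move=> d1 b5 bm kd Rb; apply: TOC_of_R.
  by apply: pow3_mod12; rewrite kd bm; case: d d1 {bm kd Rb} => [|[|]].
have := R_cover_iter k d1 b5 _ Rb; rewrite kd.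
by case: d d1 bm {kd Rb} => [|[|]] //= _ bm; apply; lia.
Qed.

Lemma TOC_iter_S b k : b %% 6 = 3 -> 15 <= b -> S_cover b -> TOC 3 (3 ^ k * b + 1) 5 3.
Proof.
by move=> b3 b15 Sb; apply: TOC_of_S; [exact: pow3_mod6 | exact: S_cover_iter].
Qed.

Theorem theorem4p11 (a m : nat) :
  0 < a -> a %% 6 = 3 -> a < 100 ->
  (a %% 12 = 3 -> odd m) -> (a %% 12 = 9 -> ~~ odd m) ->
  (a \notin [:: 57; 87; 93] -> TOC 3 (3 ^ m * a) 5 3) /\
  (a \notin [:: 51; 69; 75] -> TOC 3 (3 ^ m * a + 1) 5 3).
Proof.
move=> _ a3 a100 h3 h9.
have pow k b : 3 ^ m * (3 ^ k * b) = 3 ^ (m + k) * b by rewrite mulnA -expnD.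
have powP b : odd m -> 3 ^ m * b = 3 ^ m.-1 * (3 * b).
  by case: m {h3 h9 pow} => // k _; rewrite expnSr -mulnA.
(* The thirds of 9 points have size 3, which is too small for the tripling; from the first tripling
   on, the cover for 27 takes over. *)
have TOC9 k : TOC 3 (3 ^ k * 9 + 1) 5 3.
  case: k => [|k]; first by rewrite mul1n; apply: TOC_of_S S_cover9.
  by rewrite expnSr -mulnA; exact: TOC_iter_S S_cover27.
have a_in : a \in [:: 3; 9; 15; 21; 27; 33; 39; 45; 51; 57; 63; 69; 75; 81; 87; 93; 99].
  rewrite !inE; lia.
have R0 b k : 5 <= b -> b %% 12 = 9 -> ~~ odd k -> R_cover 0 'I_b -> TOC 3 (3 ^ k * b) 5 3.
  by move=> b5 bm /negPf ok; apply: TOC_iter_R.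
have R1 b k : 5 <= b -> b %% 12 = 3 -> odd k -> R_cover 1 'I_b -> TOC 3 (3 ^ k * b) 5 3.
  by move=> b5 bm ok; apply: TOC_iter_R.
move: a_in; rewrite !inE; do ?case/orP; move=> /eqP ea; rewrite {}ea in h3 h9 *.
- have om := h3 erefl; split=> _.
    (* As [m] is odd, one factor 3 turns the order 3 into 9 and leaves an even exponent. *)
    by rewrite powP //; apply: R0 R_cover9 => //; case: (m) om => //= k.
  by rewrite powP //; exact: TOC9.
- have em := h9 erefl; split=> _.
    exact: R0 R_cover9.
  exact: TOC9.
- have om := h3 erefl; split=> _.
    exact: R1 R_cover15.
  (* Since [m] is at least 1, the initial cover for 45 can stand in for one for 15. *)
  by rewrite powP //; exact: TOC_iter_S S_cover45.
- have em := h9 erefl; split=> _.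
    exact: R0 R_cover21.
  exact: TOC_iter_S S_cover21.
- have om := h3 erefl; split=> _.
    by rewrite (pow 1 9); apply: R0 R_cover9 => //; rewrite oddD om.
  exact: TOC_iter_S S_cover27.
- have em := h9 erefl; split=> _.
    exact: R0 R_cover33.
  exact: TOC_iter_S S_cover33.
- have om := h3 erefl; split=> _.
    exact: R1 R_cover39.
  exact: TOC_iter_S S_cover39.
- have em := h9 erefl; split=> _.
    by rewrite (pow 1 15); apply: R1 R_cover15 => //; rewrite oddD (negPf em).
  exact: TOC_iter_S S_cover45.
- have om := h3 erefl; split=> [_|//]; exact: R1 R_cover51.
- have em := h9 erefl; split=> [//|_]; exact: TOC_iter_S S_cover57.
- have om := h3 erefl; split=> _.
    by rewrite (pow 1 21); apply: R0 R_cover21 => //; rewrite oddD om.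
  by rewrite (pow 1 21); exact: TOC_iter_S S_cover21.
- have em := h9 erefl; split=> [_|//]; exact: R0 R_cover69.
- have om := h3 erefl; split=> [_|//]; exact: R1 R_cover75.
- have em := h9 erefl; split=> _.
    by rewrite (pow 2 9); apply: R0 R_cover9 => //; rewrite oddD (negPf em).
  by rewrite (pow 1 27); exact: TOC_iter_S S_cover27.
- have om := h3 erefl; split=> [//|_]; exact: TOC_iter_S S_cover87.
- have em := h9 erefl; split=> [//|_]; exact: TOC_iter_S S_cover93.
- have om := h3 erefl; split=> _.
    by rewrite (pow 1 33); apply: R0 R_cover33 => //; rewrite oddD om.
  by rewrite (pow 1 33); exact: TOC_iter_S S_cover33.
Qed.
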